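(* Let $\bar n>0$ and let $\varepsilon_0,\mu',\gamma_0,a_1>0$. Let $L$ be either of the self-adjoint operators $\overline L_3$ or $\overline L_3^{\varepsilon}$ on $L^2(\nu)$ defined in the context. Then $L$ is non-negative and its zero subspace (kernel) is spanned by the constant function. In addition, $L$ has a spectral gap in $L^2(\nu)$, i.e. there is $\lambda>0$ such that the spectrum of $L$ is contained in $\{0\}\cup[\lambda,\infty)$; and thus the semigroup $(e^{-tL})_{t\ge0}$ is strictly contractive on the orthogonal complement of the zero subspace (for every $t>0$ the restriction of $e^{-tL}$ to the orthogonal complement of the constants has operator norm $<1$).
   Context: On $\mathbb R$ let $\nu(dw)=e^{-w}(\ln(1+e^w))^{5/2}\,dw$, and $$\overline K_3(u,v)=4\bar n\,[\ln(1+e^u)\ln(1+e^v)]^{-3/2}\,\frac{e^{-|u-v|}}{1+e^{-\min(u,v)}+e^{-\max(u,v)}}\;\frac{2+e^{\max(u,v)}}{1-e^{-|u-v|}},$$ $$\overline K_3^{\varepsilon}(u,v)=\overline K_3(u,v)\,\frac{1-e^{-\min(\varepsilon(u,v),|u-v|)}}{1-e^{-\varepsilon(u,v)}},\qquad \varepsilon(u,v)=\varepsilon_0\exp\Big(-\frac{\mu'}{\gamma_0}\max(a_1,u,v)\Big).$$ For $k\in\{\overline K_3,\overline K_3^\varepsilon\}$ define the form $\tilde Q_k(\phi,\psi)=\frac12\int_{\mathbb R^2}\nu(du)\nu(dv)\,k(u,v)(\phi(u)-\phi(v))^*(\psi(u)-\psi(v))$ and $Q_k(\phi,\psi)=\tilde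 Q_k(\phi,\psi)+(\phi,\psi)_{L^2(\nu)}$ with domain $D(Q_k)=\{\psi\in L^2(\nu):Q_k(\psi,\psi)<\infty\}$. The associated self-adjoint operator (Friedrichs extension) $L_k$ has domain $\{\psi\in D(Q_k):\exists C<\infty,\ |Q_k(\phi,\psi)|\le C\|\phi\|_{L^2(\nu)}\ \forall\phi\in D(Q_k)\}$ and satisfies $(\phi,L_k\psi)=Q_k(\phi,\psi)-(\phi,\psi)$ for all $\phi\in D(Q_k)$. Then $\overline L_3:=L_{\overline K_3}$ and $\overline L_3^\varepsilon:=L_{\overline K_3^\varepsilon}$. *)

(* Defs.v *)
From HB Require Import structures.
From mathcomp Require Import all_boot all_order all_algebra.
From mathcomp Require Import all_classical all_reals all_analysis.
From mathcomp Require Import measurable_realfun complex.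
Set Implicit Arguments.
Unset Strict Implicit.
Unset Printing Implicit Defensive.
Import Order.TTheory GRing.Theory Num.Theory.
Import numFieldNormedType.Exports.
Import ComplexField.Normc.
Local Open Scope classical_set_scope.
Local Open Scope complex_scope.
Local Open Scope ring_scope.

(* Elements of the complex Hilbert space L^2(mu) are represented by functions
   T -> R[i]; equality in L^2(mu) is equality mu-almost everywhere. *)
Section L2.
Context d (T : measurableType d) (R : realType).
Variable mu : {measure set T -> \bar R}.
Implicit Types (f g : T -> R[i]) (V : set (T -> R[i])).

Definition L2 : set (T -> R[i]) :=
  [set f | (fun x => complex.Re (f x)) \in Lfun mu 2%:E /\
           (fun x => complex.Im (f x)) \in Lfun mu 2%:E].

Definition Cintegral f : R[i] :=
  (\int[mu]_x complex.Re (f x)) +i* (\int[mu]_x complex.Im (f x)).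

(* conjugate-linear in the first argument *)
Definition inner f g : R[i] := Cintegral (fun x => conjc (f x) * g x).

Definition l2norm f : R := Num.sqrt (\int[mu]_x normc (f x) ^+ 2).

Definition orthocompl V : set (T -> R[i]) :=
  [set f | L2 f /\ forall g, V g -> inner g f = 0].

Definition opnorm_on V (A : (T -> R[i]) -> (T -> R[i])) : \bar R :=
  ereal_sup [set (l2norm (A f))%:E | f in [set f | [/\ V f, L2 f & l2norm f <= 1]]].

End L2.

(* Unbounded operators on L^2(mu) are given by their graphs: [A f g] means that
   f is in the domain of A and A f = g. *)
Section operators.
Context d (T : measurableType d) (R : realType).
Variable mu : {measure set T -> \bar R}.
Variable A : (T -> R[i]) -> (T -> R[i]) -> Prop.
Implicit Types (f g : T -> R[i]) (z : R[i]).

Definition nonneg_operator : Prop := forall f g, A f g -> 0 <= inner mu f g.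

Definition operator_kernel : set (T -> R[i]) := [set f | A f (cst 0)].

(* A - z is a bijection from the domain of A onto L^2(mu) with bounded inverse;
   its injectivity is contained in the bound on the inverse. *)
Definition resolvent_set : set R[i] :=
  [set z | (forall h, L2 mu h ->
              exists f g, A f g /\ (fun x => g x - z * f x) = h %[ae mu]) /\
           (exists M : R, forall f g, A f g ->
              l2norm mu f <= M * l2norm mu (fun x => g x - z * f x))].

Definition spectrum : set R[i] := ~` resolvent_set.

(* S is the strongly continuous semigroup (e^{-tA})_{t >= 0} of bounded linear
   operators on L^2(mu), i.e. the one whose infinitesimal generator is exactly
   -A *)
Definition is_semigroup_exp (S : R -> (T -> R[i]) -> (T -> R[i])) : Prop :=
  [/\ forall t, 0 <= t ->
        [/\ forall f, L2 mu f -> L2 mu (S t f),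
            forall (a : R[i]) f g, L2 mu f -> L2 mu g ->
              S t (fun x => a * f x + g x) = (fun x => a * S t f x + S t g x) %[ae mu] &
            exists M : R, forall f, L2 mu f -> l2norm mu (S t f) <= M * l2norm mu f],
      forall f, L2 mu f -> S 0 f = f %[ae mu],
      forall s t f, 0 <= s -> 0 <= t -> L2 mu f ->
        S (s + t) f = S s (S t f) %[ae mu],
      forall f, L2 mu f ->
        l2norm mu (fun x => S t f x - f x) @[t --> 0^'+] --> (0 : R) &
      forall f g, A f g <->
        [/\ L2 mu f, L2 mu g &
            l2norm mu (fun x => (t^-1)%:C * (S t f x - f x) + g x)
              @[t --> 0^'+] --> (0 : R)]].

End operators.

Section forms.
Context d (T : measurableType d) (R : realType).
Variables (mu : {sigma_finite_measure set T -> \bar R}) (k : T -> T -> R).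
Implicit Types phi psi eta : T -> R[i].

Definition dform phi psi : R[i] :=
  (2^-1)%:C * Cintegral (mu \x mu)%E (fun p : T * T =>
    (k p.1 p.2)%:C * (conjc (phi p.1 - phi p.2) * (psi p.1 - psi p.2))).

Definition form phi psi : R[i] := dform phi psi + inner mu phi psi.

(* Since k >= 0, Q(psi, psi) < +oo is the finiteness of this nonnegative
   integral; it cannot be tested on [form], which is total. *)
Definition form_domain : set (T -> R[i]) :=
  [set psi | L2 mu psi /\
    (\int[mu \x mu]_p (k p.1 p.2 * normc (psi p.1 - psi p.2) ^+ 2)%:E < +oo)%E].

Definition form_operator_domain : set (T -> R[i]) :=
  [set psi | form_domain psi /\
    exists C : R, forall phi, form_domain phi ->
      normc (form phi psi) <= C * l2norm mu phi].

Definition form_operator psi eta : Prop :=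
  [/\ form_operator_domain psi, L2 mu eta &
      forall phi, form_domain phi ->
        inner mu phi eta = form phi psi - inner mu phi psi].

End forms.

Section kernels.
Context (R : realType).
Implicit Types nbar u v w : R.

Definition nu_density w : R := expR (- w) * ln (1 + expR w) `^ (5 / 2).

(* The diagonal u = v, where the last factor is a division by 0, is a null set
   and carries no weight in the form. *)
Definition K3 nbar u v : R :=
  4 * nbar * (ln (1 + expR u) * ln (1 + expR v)) `^ (- (3 / 2)) *
  (expR (- `|u - v|) /
    (1 + expR (- Num.min u v) + expR (- Num.max u v))) *
  ((2 + expR (Num.max u v)) / (1 - expR (- `|u - v|))).

Definition epsuv (eps0 mu' gamma0 a1 : R) u v : R :=
  eps0 * expR (- (mu' / gamma0) * Num.max a1 (Num.max u v)).

Definition K3eps nbar (eps0 mu' gamma0 a1 : R) u v : R :=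
  let e := epsuv eps0 mu' gamma0 a1 u v in
  K3 nbar u v * ((1 - expR (- Num.min e `|u - v|)) / (1 - expR (- e))).

Definition nu (A : set (measurableTypeR R)) : \bar R :=
  (\int[lebesgue_measure]_(w in A) (nu_density w)%:E)%E.

Lemma nu_density_ge0 w : 0 <= nu_density w.
Proof. by rewrite mulr_ge0 ?expR_ge0 ?powR_ge0. Qed.

Lemma measurable_nu_density : measurable_fun setT nu_density.
Proof.
apply: measurable_funM; first by apply: measurableT_comp => //; exact: measurable_oppr.
apply: (measurableT_comp (measurable_powR _)).
by apply: measurableT_comp => //; apply: measurable_funD.
Qed.

Let nu0 : nu set0 = 0%E.
Proof. by rewrite /nu integral_set0. Qed.

Let nu_ge0 A : (0 <= nu A)%E.
Proof. by apply: integral_ge0 => x _; rewrite lee_fin nu_density_ge0. Qed.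

Let nu_sigma_additive : semi_sigma_additive nu.
Proof.
move=> /= F mF tF mUF; rewrite /nu; apply: cvg_toP.
  apply: ereal_nondecreasing_is_cvgn => m n mn.
  by apply: lee_sum_nneg_natr => // k _ _; exact: nu_ge0.
rewrite ge0_integral_bigcup//=.
- by apply/measurable_funTS/measurableT_comp => //; exact: measurable_nu_density.
- by move=> x _; rewrite lee_fin nu_density_ge0.
Qed.

HB.instance Definition _ := isMeasure.Build _ _ _ nu nu0 nu_ge0 nu_sigma_additive.

Let nu_sigma_finite : sigma_finite setT nu.
Proof.
exists (fun n : nat => `[- n%:R, n%:R]%classic).
  apply/esym; rewrite -subTset => x _.
  exists (Num.truncn `|x|).+1 => //=.
  by rewrite in_itv/= -ler_norml ltW// truncnS_gt.
move=> n; split => //.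
pose c := expR n%:R * ln (1 + expR n%:R) `^ (5 / 2) : R.
apply: (@le_lt_trans _ _ (\int[lebesgue_measure]_(w in `[(- n%:R)%R, n%:R]%classic) cst c%:E w)%E).
  apply: ge0_le_integral.
  - exact: measurable_itv.
  - by move=> x _; rewrite lee_fin nu_density_ge0.
  - by apply/measurable_funTS/measurableT_comp => //; exact: measurable_nu_density.
  - exact: (measurable_cst c%:E).
  move=> x /=; rewrite in_itv/= => /andP[nx xn]; rewrite lee_fin /nu_density /c.
  have e1 (y : R) : 1 <= 1 + expR y by rewrite lerDl expR_ge0.
  have e0 (y : R) : 0 < 1 + expR y by rewrite (lt_le_trans ltr01).
  apply: ler_pM; [exact: expR_ge0|exact: powR_ge0| |].
    by rewrite ler_expR lerNl.
  apply: ge0_ler_powR; rewrite ?nnegrE ?ln_ge0 ?divr_ge0//.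
  by rewrite ler_ln ?posrE// lerD2l ler_expR.
by rewrite integral_cst//= lebesgue_measure_itv/= lte_fin; case: ifP => _;
  rewrite ?mule0 ?ltry// -EFinB -EFinM ltry.
Qed.

HB.instance Definition _ := Measure_isSigmaFinite.Build _ _ _ nu nu_sigma_finite.

End kernels.

(* Main.v *)
(* [L^2(nu)] is seen as a real Hilbert space with the inner product
   [Re (f, g)] and multiplication by [i], and [L] as the operator of the closed
   form [dip].  Riesz representation in the form domain makes [1 + L] onto, and
   the Poincare inequality [lam |f|^2 <= dip f f] for [f] orthogonal to the
   constants yields the kernel and, as [L] is symmetric, a lower bound for
   [L - z] off [{0}] and [[lam, +oo[]; its range is then closed and dense.  For
   the semigroup, [|g + h L g| >= (1 + h lam) |g|] and [S s f] is close to
   [(1 + h L) (S (s + h) f)]; many small steps give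
   [(1 + t lam) |S t f| <= |f|].

   For the Poincare inequality a point [u] of large modulus jumps to some [w]
   between [u / 2] and [3 u / 4], with an intensity bounded by a multiple of
   the kernel.  The total intensity out of [u] is at least 1, and the one into
   [w] at most 1/4 because the density of [nu] increases at least 8 times along
   a jump.  Averaging [|f u - f v|^2 <= 2 |f u - f w|^2 + 2 |f w - f v|^2] over
   the jumps then bounds the integral of [|f u - f v|^2] over the tails by the
   form plus half of the full integral; near the origin the kernel is bounded
   below.  Both kernels exceed their common nonsingular part [K0], so [K0] is
   the only one to be estimated. *)
Require Import Defs.
From HB Require Import structures.
From mathcomp Require Import all_boot all_order all_algebra.
From mathcomp Require Import all_classical all_reals all_analysis.
From mathcomp Require Import measurable_realfun complex ring lra.
Set Implicit Arguments.
Unset Strict Implicit.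
Unset Printing Implicit Defensive.
Import Order.TTheory GRing.Theory Num.Theory.
Import numFieldNormedType.Exports.
Import ComplexField.Normc.
Local Open Scope classical_set_scope.
Local Open Scope complex_scope.
Local Open Scope ring_scope.

(** * Semi-inner products *)

(* Distinct vectors may be at distance 0, so that functions represent their
   almost-everywhere classes without quotients. *)
Section semi_hilbert.
Context (R : realType) (V : lmodType R) (b : V -> V -> R).
Implicit Types (x y z : V) (a e : R).

(** The kernel [K0 u v] tends to 0 when [v] is fixed and [u] goes to either infinity, so the form
    does not dominate the double integral of [|f u - f v|^2] by a pointwise comparison of kernels.
    Jumps of bounded ratio avoid this. In the left tail [nu_density w * K0 u w] behaves, up to
    constant factors, like [exp (u / 2 - w)], which confines the jumps to [|w| >= |u| / 2]; the
    other end [3 u / 4] leaves a distance [|u| / 4] over which the density of [nu] can grow.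
    Absorbing half of the integral replaces the iteration of jumps down to the core; it is
    legitimate because [nu] is finite and [f] is square integrable, so that the integral is finite.
    The semigroup is not constructed but only characterised by its generator, and each [S t] is
    bounded with no control in [t]. A bound uniform near 0 therefore has to come from the uniform
    boundedness principle; only then do the errors of the small time steps add up to something
    negligible. *)

Record semi_hilbert := SemiHilbert {
  ipC : forall x y, b x y = b y x;
  ip_linear : forall a x y z, b (a *: x + y) z = a * b x z + b y z;
  ip_ge0 : forall x, 0 <= b x x;
  ip_complete : forall u : nat -> V,
    (forall e, 0 < e -> exists N, forall m n, (N <= m)%N -> (N <= n)%N ->
       b (u m - u n) (u m - u n) <= e) ->
    exists l, forall e, 0 < e -> exists N, forall n, (N <= n)%N ->
      b (u n - l) (u n - l) <= e }.

Definition nrm x := Num.sqrt (b x x).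

Hypothesis bH : semi_hilbert.
Let bC := ipC bH.
Let b_ge0 := ip_ge0 bH.

Lemma ipDl x y z : b (x + y) z = b x z + b y z.
Proof. by have := ip_linear bH 1 x y z; rewrite scale1r mul1r. Qed.

Lemma ip0l z : b 0 z = 0.
Proof. by have := ipDl 0 0 z; rewrite addr0 => h; lra. Qed.

Lemma ipZl a x z : b (a *: x) z = a * b x z.
Proof. by have := ip_linear bH a x 0 z; rewrite addr0 ip0l addr0. Qed.

Lemma ipNl x z : b (- x) z = - b x z.
Proof. by rewrite -scaleN1r ipZl mulN1r. Qed.

Lemma ipDr x y z : b z (x + y) = b z x + b z y.
Proof. by rewrite bC ipDl !(bC z). Qed.

Lemma ip0r z : b z 0 = 0.
Proof. by rewrite bC ip0l. Qed.

Lemma ipZr a x z : b z (a *: x) = a * b z x.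
Proof. by rewrite bC ipZl (bC z). Qed.

Lemma ipNr x z : b z (- x) = - b z x.
Proof. by rewrite bC ipNl (bC z). Qed.

Definition ipE := (ipDl, ipDr, ipNl, ipNr, ipZl, ipZr).

Lemma nrm_ge0 x : 0 <= nrm x. Proof. exact: sqrtr_ge0. Qed.

Lemma sqr_nrm x : nrm x ^+ 2 = b x x.
Proof. by rewrite sqr_sqrtr. Qed.

Lemma nrm0 : nrm 0 = 0. Proof. by rewrite /nrm ip0l sqrtr0. Qed.

Lemma cauchy_schwarz_sqr x y : b x y ^+ 2 <= b x x * b y y.
Proof.
have q t : 0 <= b x x - 2 * t * b x y + t ^+ 2 * b y y.
  by have := b_ge0 (x - t *: y); rewrite !ipE (bC y x) => h; nra.
have [y0|y0] := eqVneq (b y y) 0.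
  rewrite y0 mulr0; have [->|xy0] := eqVneq (b x y) 0; first by rewrite expr0n.
  (* For a null [y] the nonnegative polynomial is affine in [t]; at this [t] it would equal -1. *)
  have := q ((b x x + 1) / (2 * b x y)); rewrite y0 mulr0 addr0.
  have -> : 2 * ((b x x + 1) / (2 * b x y)) * b x y = b x x + 1 by field.
  by move=> h; lra.
have yp : 0 < b y y by rewrite lt_def y0 b_ge0.
have := q (b x y / b y y).
have -> : b x x - 2 * (b x y / b y y) * b x y + (b x y / b y y) ^+ 2 * b y y
   = b x x - b x y ^+ 2 / b y y by field.
by rewrite subr_ge0 ler_pdivrMr.
Qed.

Lemma cauchy_schwarz x y : `|b x y| <= nrm x * nrm y.
Proof.
by rewrite -(@ler_pXn2r _ 2) ?nnegrE ?mulr_ge0 ?nrm_ge0// exprMn !sqr_nrm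
  real_normK ?num_real// cauchy_schwarz_sqr.
Qed.

Lemma nrmZ a x : nrm (a *: x) = `|a| * nrm x.
Proof. by rewrite /nrm !ipE mulrA -expr2 sqrtrM ?sqr_ge0// sqrtr_sqr. Qed.

Lemma nrmN x : nrm (- x) = nrm x.
Proof. by rewrite -scaleN1r nrmZ normrN1 mul1r. Qed.

Lemma nrmD x y : nrm (x + y) <= nrm x + nrm y.
Proof.
rewrite -(@ler_pXn2r _ 2) ?nnegrE ?addr_ge0 ?nrm_ge0// sqr_nrm !ipE (bC y x).
have := le_trans (ler_norm _) (cauchy_schwarz x y).
by have := sqr_nrm x; have := sqr_nrm y; nra.
Qed.

Lemma nrmB x y : nrm (x - y) <= nrm x + nrm y.
Proof. by rewrite -(nrmN y) nrmD. Qed.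

Lemma nrm_distC x y : nrm (x - y) = nrm (y - x).
Proof. by rewrite -nrmN opprB. Qed.

Lemma nrm_tri z x y : nrm (x - y) <= nrm (x - z) + nrm (z - y).
Proof. by have := nrmD (x - z) (z - y); rewrite addrA subrK. Qed.

Lemma nrm_null x y : nrm (x - y) = 0 -> nrm x = nrm y.
Proof.
move=> h; apply/eqP; rewrite eq_le; apply/andP; split.
  by have := nrmD (x - y) y; rewrite subrK h add0r.
by have := nrmD (y - x) x; rewrite subrK nrm_distC h add0r.
Qed.

Lemma ip_null x y : nrm x = 0 -> b x y = 0.
Proof. by move=> h; have := cauchy_schwarz x y; rewrite h mul0r normr_le0 => /eqP. Qed.

Lemma ip_eqr z x y : nrm (x - y) = 0 -> b z x = b z y.
Proof.
move=> /ip_null-/(_ z); rewrite bC !ipE => /eqP; rewrite subr_eq0 => /eqP.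
by [].
Qed.

Lemma nrm_complete (u : nat -> V) :
  (forall e, 0 < e -> exists N, forall m n, (N <= m)%N -> (N <= n)%N ->
     nrm (u m - u n) <= e) ->
  exists l, forall e, 0 < e -> exists N, forall n, (N <= n)%N -> nrm (u n - l) <= e.
Proof.
move=> cu; have [|l ul] := ip_complete bH (u := u).
  move=> e e0; have [|N uN] := cu (Num.sqrt e); first by rewrite sqrtr_gt0.
  by exists N => m n Nm Nn; have := uN _ _ Nm Nn; rewrite ler_psqrt ?nnegrE// ltW.
exists l => e e0; have [|N uN] := ul (e ^+ 2); first by rewrite exprn_gt0.
exists N => n Nn; rewrite -(@ler_pXn2r _ 2) ?nnegrE ?nrm_ge0 ?(ltW e0)//.
by rewrite sqr_nrm; exact: uN.
Qed.

Definition linear_subspace (W : set V) := W 0 /\ forall a x y, W x -> W y -> W (a *: x + y).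

(** [W] need not be closed, so the projection [p] is only a limit of vectors of [W]. It is obtained
    from a minimising sequence for the distance to [h]. *)
Lemma orthogonal_projection (W : set V) (h : V) : linear_subspace W ->
  exists p, (forall e, 0 < e -> exists2 w, W w & nrm (w - p) <= e) /\
            (forall w, W w -> b w (h - p) = 0).
Proof.
move=> [W0 WL].
pose E := [set b (h - w) (h - w) | w in W].
have E0 : E !=set0 by exists (b (h - 0) (h - 0)); exists 0.
have Elb : lbound E 0 by move=> _ [w _ <-].
have infE : has_inf E by split => //; exists 0.
pose m := inf E.
have mle w : W w -> m <= b (h - w) (h - w).
  by move=> Ww; apply: ge_inf; [exists 0|exists w].
have ex n : exists w, W w /\ b (h - w) (h - w) <= m + n.+1%:R^-1.
  have [|_ [w Ww <-] /ltW h2] := @inf_adherent _ E n.+1%:R^-1 _ infE.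
    by rewrite invr_gt0.
  by exists w.
have [w /all_and2 [Ww wm]] := choice ex.
have inv_small e : 0 < e -> exists N, forall n, (N <= n)%N -> n.+1%:R^-1 <= e.
  move=> e0; have [N _ HN] := @near_infty_natSinv_lt R (PosNum e0).
  by exists N => n Nn; exact/ltW/HN.
have [|p wp] := nrm_complete (u := w).
  move=> e e0; have [|N HN] := inv_small (e ^+ 2 / 4).
    by rewrite divr_gt0// exprn_gt0.
  exists N => i j /HN Ni /HN Nj.
  rewrite -(@ler_pXn2r _ 2) ?nnegrE ?nrm_ge0 ?(ltW e0)// sqr_nrm.
  (* Parallelogram identity: the midpoint is no closer to [h] than the infimum, so [|w i - w j|^2]
     is at most [2 / (i + 1) + 2 / (j + 1)]. *)
  have := mle (2^-1 *: w i + (2^-1 *: w j + 0)) (WL _ _ _ (Ww i) (WL _ _ _ (Ww j) W0)).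
  have := wm i; have := wm j; rewrite addr0 !ipE.
  rewrite (bC (w i) h) (bC (w j) h) (bC (w j) (w i)).
  by clear -Ni Nj; clearbody m; move: Ni Nj; move: (i.+1%:R^-1) (j.+1%:R^-1) => ri rj *; lra.
exists p; split.
  by move=> e /wp [N HN]; exists (w N) => //; exact: HN.
(* Moving [w n] along [v] by [beta / c] gains at most the defect [1 / (n + 1)] of [w n]. The summand
   1 keeps [c] positive when [v] is null. *)
move=> v Wv; pose c := b v v + 1.
have c0 : 0 < c by rewrite ltr_wpDl// b_ge0.
have beta n : b v (h - w n) ^+ 2 <= c * n.+1%:R^-1.
  set beta := b v (h - w n); pose t := beta / c.
  have := mle _ (WL t _ _ Wv (Ww n)).
  have -> : h - (t *: v + w n) = (h - w n) - t *: v by rewrite opprD addrAC addrA.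
  rewrite (ipDl (h - w n)) !(ipDr _ (- (t *: v))) !(ipNl, ipNr, ipZl, ipZr).
  rewrite (bC (h - w n) v) -/beta.
  have := wm n => wn hh.
  have k1 : 2 * t * beta - t ^+ 2 * b v v <= n.+1%:R^-1.
    by clear -hh wn; clearbody m beta t; move: hh wn; move: (n.+1%:R^-1) => r *; lra.
  have tc : beta = t * c by rewrite /t divfK// gt_eqF.
  have k2 : c * t ^+ 2 <= 2 * t * beta - t ^+ 2 * b v v.
    by rewrite tc /c; have := b_ge0 v; nra.
  have -> : beta ^+ 2 = c * (c * t ^+ 2) by rewrite tc; ring.
  by rewrite ler_wpM2l ?(ltW c0)// (le_trans k2 k1).
apply/eqP; rewrite -normr_le0; apply/ler_addgt0Pl => e e0; rewrite addr0.
have [|N1 H1] := inv_small ((e / 2) ^+ 2 / c).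
  by rewrite divr_gt0// exprn_gt0// divr_gt0.
have [|N2 H2] := wp (e / 2 / c); first by rewrite !divr_gt0.
pose n := maxn N1 N2.
have -> : h - p = (h - w n) + (w n - p) by rewrite addrA subrK.
rewrite ipDr (le_trans (ler_normD _ _))// (splitr e) lerD//.
  rewrite -(@ler_pXn2r _ 2) ?nnegrE ?divr_ge0 ?(ltW e0)// real_normK ?num_real//.
  apply: (le_trans (beta n)); rewrite mulrC -ler_pdivlMr//.
  by apply: H1; exact: leq_maxl.
apply: (le_trans (cauchy_schwarz _ _)).
have nc : nrm v <= c.
  rewrite -(@ler_pXn2r _ 2) ?nnegrE ?nrm_ge0 ?(ltW c0)// sqr_nrm /c.
  by have := b_ge0 v; nra.
apply: (@le_trans _ _ (c * (e / 2 / c))); last by rewrite mulrC divfK// gt_eqF.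
by apply: ler_pM; rewrite ?nrm_ge0//; apply: H2; exact: leq_maxr.
Qed.

Lemma riesz_representation (l : V -> R) (C : R) :
  (forall a x y, l (a *: x + y) = a * l x + l y) ->
  (forall x, `|l x| <= C * nrm x) -> exists r, forall x, l x = b x r.
Proof.
move=> lL lC.
have l0 : l 0 = 0 by have := lL 1 0 0; rewrite scale1r addr0 mul1r => h; lra.
have [[h lh]|nl] := pselect (exists h, l h != 0); last first.
  exists 0 => x; rewrite ip0r; apply/eqP/negPn/negP => lx; apply: nl.
  by exists x.
have [|p [pW hp]] := @orthogonal_projection [set x | l x = 0] h.
  by split=> [//|a x y /= lx ly]; rewrite lL lx ly mulr0 addr0.
have lB x y : l (x - y) = l x - l y.
  by rewrite addrC -scaleN1r lL mulN1r addrC.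
(* [p] is only approximated by vectors of the kernel of [l]; boundedness of [l] makes that kernel
   closed. *)
have lp : l p = 0.
  apply/eqP; rewrite -normr_le0; apply/ler_addgt0Pl => e e0; rewrite addr0.
  have [|w /= lw wp] := pW (e / (`|C| + 1)); first by rewrite divr_gt0.
  rewrite -normrN -(add0r (- _)) -lw -lB (le_trans (lC _))//.
  apply: (@le_trans _ _ ((`|C| + 1) * (e / (`|C| + 1)))).
    apply: (@le_trans _ _ ((`|C| + 1) * nrm (w - p))).
      apply: ler_wpM2r; first exact: nrm_ge0.
      by rewrite (le_trans (ler_norm _))// lerDl.
    by apply: ler_wpM2l => //; exact: ltW.
  by rewrite mulrC divfK// gt_eqF.
set z := h - p in hp.
have lz : l z = l h by rewrite /z lB lp subr0.
have bz : b z z != 0.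
  apply/eqP => bz0; have := lC z; rewrite /nrm bz0 sqrtr0 mulr0 normr_le0 lz.
  by apply/negP.
exists ((l h / b z z) *: z) => x.
rewrite ipZr; have := hp (- (l x / l h) *: z + x).
rewrite /= lL lz mulNr divfK// addNr ip_linear// => /(_ erefl) bx.
have -> : b x z = l x / l h * b z z by lra.
by field; rewrite bz lh.
Qed.

End semi_hilbert.

(** * The uniform boundedness principle *)

Section uniform_boundedness.
Context (R : realType) (V : lmodType R) (b : V -> V -> R).
Hypothesis bH : semi_hilbert b.
Local Notation nrm := (nrm b).
Variable p : nat -> V -> R.
Hypothesis pD : forall n x y, p n (x + y) <= p n x + p n y.
Hypothesis pZ : forall n a x, p n (a *: x) = `|a| * p n x.
Hypothesis p_bounded : forall n, exists C, forall x, p n x <= C * nrm x.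

Let p_ge0 n x : 0 <= p n x.
Proof.
have pN : p n (- x) = p n x by rewrite -scaleN1r pZ normrN1 mul1r.
have := pD n x (- x); rewrite subrr pN -(scale0r 0) pZ normr0 mul0r => h; lra.
Qed.

(* [q n] is the operator norm of [p n]. *)
Let near_maximizer n : exists q, [/\ 0 <= q, forall x, p n x <= q * nrm x &
  forall r, 0 < r -> exists2 y, nrm y <= r & 2 / 3 * (r * q) <= p n y].
Proof.
have [C pC] := p_bounded n.
have n0 : nrm 0 = 0 by rewrite (nrm0 bH).
have p0 : p n 0 = 0 by rewrite -(scale0r 0) pZ normr0 mul0r.
pose E := [set p n x | x in [set x | nrm x <= 1]].
have supE : has_sup E.
  split; first by exists (p n 0), 0 => //=; rewrite n0.
  exists `|C| => _ [x /= x1 <-]; rewrite (le_trans (pC x))//.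
  rewrite (@le_trans _ _ (`|C| * nrm x))//.
    by rewrite ler_wpM2r ?nrm_ge0// ler_norm.
  by rewrite ler_piMr.
have supge x : nrm x <= 1 -> p n x <= sup E.
  by move=> x1; apply: ub_le_sup; [case: supE|exists x].
have q0 : 0 <= sup E by rewrite -p0 supge// n0.
exists (sup E); split => //.
  move=> x; have [x0|x0] := eqVneq (nrm x) 0.
    by rewrite x0 mulr0 (le_trans (pC x))// x0 mulr0.
  have xp : 0 < nrm x by rewrite lt_def x0 nrm_ge0.
  rewrite -ler_pdivrMr// mulrC.
  have -> : (nrm x)^-1 * p n x = p n ((nrm x)^-1 *: x).
    by rewrite pZ ger0_norm// invr_ge0 ltW.
  by rewrite supge// (nrmZ bH) ger0_norm ?invr_ge0 ?(ltW xp)// mulVf.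
move=> r r0; have [q1|q1] := eqVneq (sup E) 0.
  by exists 0; rewrite ?n0 ?(ltW r0)// q1 !mulr0.
have qp : 0 < sup E by rewrite lt_def q1.
have [|_ [y /= y1 <-] hy] := @sup_adherent _ E (sup E / 3) _ supE.
  by rewrite divr_gt0.
exists (r *: y).
  by rewrite (nrmZ bH) gtr0_norm// ler_piMr// ltW.
rewrite pZ gtr0_norm// mulrCA ler_wpM2l ?(ltW r0)//.
by move: hy; clearbody E; move: (sup E) => s *; lra.
Qed.

(* Sokal's gliding-hump proof: one of [x + y] and [x - y] has [p]-value at
   least [p y]. *)
Lemma uniform_boundedness :
  (forall x, exists B, forall n, p n x <= B) ->
  exists M, forall n x, p n x <= M * nrm x.
Proof.
move=> pb; have [q /all_and3 [q0 pq qmax]] := choice near_maximizer.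
have [[M qM]|nq] := pselect (exists M, forall n, q n <= M).
  exists M => n x; rewrite (le_trans (pq n x))//.
  by rewrite ler_wpM2r ?nrm_ge0.
have hk k : exists n, 4 ^+ k <= q n.
  apply: contrapT => h; apply: nq; exists (4 ^+ k) => n.
  by rewrite leNgt; apply/negP => /ltW ?; apply: h; exists n.
have [nk hnk] := choice hk.
have t0 k : 0 < (3^-1 : R) ^+ k by rewrite exprn_gt0.
have hy k : exists y, nrm y <= 3^-1 ^+ k /\
    2 / 3 * (3^-1 ^+ k * q (nk k)) <= p (nk k) y.
  by have [y] := qmax (nk k) _ (t0 k); exists y.
have [y /all_and2 [yn yp]] := choice hy.
pose F := fix F k := if k is k'.+1 then
  (if p (nk k) (y k) <= p (nk k) (F k' + y k) then F k' + y k else F k' - y k)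
  else 0.
have pF k : p (nk k.+1) (y k.+1) <= p (nk k.+1) (F k.+1).
  rewrite /=; case: ifPn => //; rewrite -ltNge => h.
  set z := y _; set P := p _.
  have : P (2 *: z) <= P (F k + z) + P (- (F k - z)).
    rewrite (le_trans _ (pD _ _ _))// (_ : 2 *: z = F k + z + - (F k - z))//.
    by rewrite scaler_nat mulr2n opprB (addrC z (- _)) addrACA subrr add0r.
  rewrite /P -scaleN1r !pZ normrN1 mul1r ger0_norm// -/P.
  by move: h; rewrite -/P -/z => *; lra.
have stepF k : nrm (F k.+1 - F k) <= 3^-1 ^+ k.+1.
  rewrite /=; case: ifPn => _; first by rewrite addrC addKr.
  by rewrite addrC addKr (nrmN bH).
have distF k j : nrm (F (k + j)%N - F k) <= 2^-1 * (3^-1 ^+ k - 3^-1 ^+ (k + j)).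
  elim: j => [|j IH]; first by rewrite addn0 !subrr mulr0 (nrm0 bH).
  rewrite addnS (le_trans (nrm_tri bH (F (k + j)%N) _ _))//.
  have := stepF (k + j)%N; move: IH; rewrite exprS.
  by move: (3^-1 ^+ k) (3^-1 ^+ (k + j)) => r s *; lra.
have distF' k j : (k <= j)%N -> nrm (F j - F k) <= 2^-1 * 3^-1 ^+ k.
  move=> /subnKC <-; rewrite (le_trans (distF _ _))// ler_wpM2l//.
  by rewrite lerBlDr lerDl ltW.
have small e : 0 < e -> exists N, (3^-1 : R) ^+ N <= e.
  move=> e0; have /cvgrPdist_le /(_ e e0) [N _ HN] :
    (3^-1 : R) ^+ n @[n --> \oo] --> (0 : R).
    by apply: cvg_expr; rewrite ger0_norm ?invr_ge0// invf_lt1// ltr1n.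
  exists N; have := HN N (leqnn N).
  by rewrite sub0r normrN ger0_norm// ltW.
have [|x Fx] := nrm_complete bH (u := F).
  move=> e /small [N HN]; exists N => m n Nm Nn.
  rewrite (le_trans (nrm_tri bH (F N) _ _))//.
  rewrite (nrm_distC bH (F N)).
  by have := distF' _ _ Nm; have := distF' _ _ Nn => *; lra.
have xF k : nrm (F k - x) <= 2^-1 * 3^-1 ^+ k.
  apply/ler_addgt0Pr => e e0; have [N HN] := Fx e e0.
  rewrite (le_trans (nrm_tri bH (F (maxn k N)) _ _))// lerD//.
    by rewrite (nrm_distC bH) distF'// leq_maxl.
  by rewrite HN// leq_maxr.
have [B xB] := pb x.
(* Here 1/6 is 2/3 - 1/2: the hump [y k.+1] contributes [2/3 * 3^-(k+1) * q], all later humps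
   together change the limit by at most [1/2 * 3^-(k+1)], and [q] is at least [4^(k+1)]. *)
suff h k : 1 / 6 * (4 / 3) ^+ k.+1 <= B.
  have [N] : exists N, 6 * B <= N%:R.
    by exists (Num.truncn (6 * B)).+1; exact/ltW/truncnS_gt.
  have bern k : k%:R * 3^-1 < (4 / 3 : R) ^+ k.
    elim: k => [|k IH]; first by rewrite mul0r expr0.
    rewrite exprS -natr1; have : 1 <= (4 / 3 : R) ^+ k.
      by rewrite exprn_ege1// ler_pdivlMr ?mul1r ?ler_nat.
    by move: IH; move: ((4 / 3) ^+ k) (k%:R) => r s *; lra.
  have := bern (3 * N).+1; have := h (3 * N)%N.
  have -> : (3 * N).+1%:R = 3 * N%:R + 1 :> R by rewrite -natrM natr1.
  by move: (_ ^+ _) (N%:R) => r s *; lra.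
have h1 := pF k; have h2 := yp k.+1; have h3 := xB (nk k.+1).
have h4 := pD (nk k.+1) x (F k.+1 - x); rewrite (addrC x) subrK in h4.
have h5 := le_trans (pq (nk k.+1) (F k.+1 - x)) (ler_wpM2l (q0 _) (xF k.+1)).
have h6 : (4 / 3 : R) ^+ k.+1 <= 3^-1 ^+ k.+1 * q (nk k.+1).
  by rewrite expr_div_n mulrC exprVn ler_wpM2l// invr_ge0 exprn_ge0.
clear -h1 h2 h3 h4 h5 h6; move: h1 h2 h3 h4 h5 h6.
move: (3^-1 ^+ k.+1) ((4 / 3) ^+ _) (q _) (p _ (y _)) => t r Q py.
move: (p _ x) (p _ (F k.+1)) (p _ (F k.+1 - x)) => px pFk pd *; lra.
Qed.

End uniform_boundedness.

(** * Symmetric operators commuting with multiplication by i *)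

Section module_expressions.
Context (R : comNzRingType) (V : lmodType R).

(** Syntax of linear combinations: equality of the coefficients of each atom, which [ring] can
    settle, implies equality of the vectors. It is a sufficient condition, since the atoms may be
    dependent. *)
Inductive mexp := MVar of nat | MZero | MAdd of mexp & mexp | MOpp of mexp
  | MScale of R & mexp.

Fixpoint meval (env : seq V) t : V := match t with
  | MVar n => nth 0 env n
  | MZero => 0
  | MAdd t u => meval env t + meval env u
  | MOpp t => - meval env t
  | MScale a t => a *: meval env t
  end.

Fixpoint mcoef t (i : nat) : R := match t with
  | MVar n => if n == i then 1 else 0
  | MZero => 0
  | MAdd t u => mcoef t i + mcoef u i
  | MOpp t => - mcoef t i
  | MScale a t => a * mcoef t i
  end.

Let meval_coef env t : meval env t = \sum_(i < size env) mcoef t i *: nth 0 env i.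
Proof.
elim: t => [n||t IHt u IHu|t IHt|a t IHt] /=.
- have [ns|ns] := ltnP n (size env).
    rewrite (bigD1 (Ordinal ns))//= eqxx scale1r big1 ?addr0// => i.
    by rewrite -val_eqE/= eq_sym => /negbTE ->; rewrite scale0r.
  rewrite nth_default// big1// => i _.
  by rewrite gtn_eqF ?scale0r// (leq_trans (ltn_ord i)).
- by rewrite big1// => i _; rewrite scale0r.
- by rewrite IHt IHu -big_split/=; apply: eq_bigr => i _; rewrite scalerDl.
- by rewrite IHt -sumrN; apply: eq_bigr => i _; rewrite scaleNr.
- by rewrite IHt scaler_sumr; apply: eq_bigr => i _; rewrite scalerA.
Qed.

Lemma module_eq env t u :
  foldr (fun i P => mcoef t i = mcoef u i /\ P) True (iota 0 (size env)) ->
  meval env t = meval env u.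
Proof.
move=> tu; rewrite !meval_coef; apply: eq_bigr => i _; congr (_ *: _).
have : (i : nat) \in iota 0 (size env) by rewrite mem_iota ltn_ord.
elim: iota tu => // j s IH /= [tuj tus]; rewrite inE => /predU1P[->//|].
exact: IH.
Qed.

End module_expressions.

Ltac mquote R env t :=
  let rec idx env n := lazymatch env with
    | t :: _ => constr:(@MVar R n)
    | _ :: ?s => idx s (S n)
    end in
  lazymatch t with
  | (?a + ?c)%R => let qa := mquote R env a in let qc := mquote R env c in constr:(@MAdd R qa qc)
  | (- ?a)%R => let qa := mquote R env a in constr:(@MOpp R qa)
  | (?k *: ?a)%R => let qa := mquote R env a in constr:(@MScale R k qa)
  | 0%R => constr:(@MZero R)
  | _ => idx env O
  end.

(* [env] lists the vectors to be taken as atoms. *)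
Ltac module_ring R env :=
  lazymatch goal with |- ?t = ?u =>
    let qt := mquote R env t in let qu := mquote R env u in
    apply: (@module_eq _ _ env qt qu); rewrite /=; repeat split; ring
  end.

(* [J] is multiplication by [i] on a complex space seen as a real one, so the
   orthogonal complement of [e] and [J e] is the complex one of [e]. *)
Section symmetric_operator.
Context (R : realType) (V : lmodType R) (b : V -> V -> R).
Hypothesis bH : semi_hilbert b.
Local Notation nrm := (nrm b).

Variable J : V -> V.
Hypothesis J_linear : forall a x y, J (a *: x + y) = a *: J x + J y.
Hypothesis JK : forall x, J (J x) = - x.
Hypothesis J_skew : forall x y, b (J x) y = - b x (J y).

Variable A : V -> V -> Prop.
Hypothesis A0 : A 0 0.
Hypothesis A_linear : forall a f g f' g',
  A f g -> A f' g' -> A (a *: f + f') (a *: g + g').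
Hypothesis A_J : forall f g, A f g -> A (J f) (J g).
Hypothesis A_sym : forall f g f' g', A f g -> A f' g' -> b f g' = b g f'.
Hypothesis A_ge0 : forall f g, A f g -> 0 <= b f g.
Hypothesis A_onto : forall h, exists f g, A f g /\ nrm (f + g - h) = 0.

Variable e : V.
Hypothesis e_gt0 : 0 < b e e.
Hypothesis A_e : A e 0.
Variable lam : R.
Hypothesis lam_gt0 : 0 < lam.
Hypothesis gap : forall f g, A f g -> b e f = 0 -> b (J e) f = 0 ->
  lam * b f f <= b f g.

Let bC := ipC bH.
Let ipE := (ipDl bH, ipDr bH, ipNl bH, ipNr bH, ipZl bH, ipZr bH).

Let J0 : J 0 = 0.
Proof. by have := J_linear (-1) 0 0; rewrite !scaleN1r !addNr. Qed.

Let JD x y : J (x + y) = J x + J y.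
Proof. by have := J_linear 1 x y; rewrite !scale1r. Qed.

Let JN x : J (- x) = - J x.
Proof. by have := J_linear (-1) x 0; rewrite !addr0 J0 addr0 !scaleN1r. Qed.

Let JZ a x : J (a *: x) = a *: J x.
Proof. by have := J_linear a x 0; rewrite J0 !addr0. Qed.

Let bJ x : b (J x) x = 0.
Proof. by have := J_skew x x; rewrite (bC x) => h; lra. Qed.

Let bJJ x y : b (J x) (J y) = b x y.
Proof. by rewrite J_skew JK (ipNr bH) opprK. Qed.

Let nrmJ x : nrm (J x) = nrm x.
Proof. by rewrite /nrm bJJ. Qed.

Let null_ge0 x : b x x <= 0 -> nrm x = 0.
Proof. by move=> h; rewrite /nrm ler0_sqrtr. Qed.

(** The vectors [e] and [J e] are orthogonal and have the same length, which explains the common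
    denominator. *)
Definition orthogonal_part x := x - ((b e x / b e e) *: e + (b (J e) x / b e e) *: J e).
Local Notation P := orthogonal_part.

Let e_neq0 : b e e != 0. Proof. by rewrite gt_eqF. Qed.

Lemma orthogonal_part_e x : b e (P x) = 0.
Proof. by rewrite !ipE (bC e (J e)) bJ; field. Qed.

Lemma orthogonal_part_Je x : b (J e) (P x) = 0.
Proof. by rewrite !ipE bJJ bJ; field. Qed.

Lemma pythagoras x :
  b x x = b (P x) (P x) + (b e x ^+ 2 + b (J e) x ^+ 2) / b e e.
Proof.
rewrite !ipE bJJ (bC e (J e)) bJ (bC x e) (bC x (J e)).
by field.
Qed.

Lemma orthogonal_part_id x : b e x = 0 -> b (J e) x = 0 -> P x = x.
Proof. by move=> h1 h2; rewrite /P h1 h2 mul0r !scale0r addr0 subr0. Qed.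

Lemma orthogonal_partB x y : P (x - y) = P x - P y.
Proof. by rewrite /P !ipE; module_ring R [:: x; y; e; J e]. Qed.

Lemma nrm_orthogonal_part x : nrm (P x) <= nrm x.
Proof.
by rewrite ler_wsqrtr// (pythagoras x) lerDl divr_ge0 ?addr_ge0 ?sqr_ge0// ltW.
Qed.

Let A_B f g f' g' : A f g -> A f' g' -> A (f - f') (g - g').
Proof. by move=> h h'; have := A_linear (-1) h' h; rewrite !scaleN1r ![- _ + _]addrC. Qed.

Lemma operator_orthogonal_part f g : A f g -> A (P f) g.
Proof.
move=> Afg; rewrite -[g]subr0; apply: A_B => //.
have AJe : A (J e) 0 by have := A_J A_e; rewrite J0.
have := A_linear (b e f / b e e) A_e (A_linear (b (J e) f / b e e) AJe A0).
by rewrite !(addr0, scaler0).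
Qed.

(** * Bounds for the resolvent *)

Section resolvent.
Variables x y : R.
Local Notation res f g := (g - (x *: f + y *: J f)).

(** Write [z = x + iy] and split [f] into its part [p] orthogonal to [e] and [J e] and its part [n]
    in their span. On [n] the operator [A - z] acts as [- z], whence the factor [x ^+ 2 + y ^+ 2].
    On [p], pairing with [J p] leaves only [- y |p|^2] by symmetry, and pairing with [p] gives at
    least [(lam - x) |p|^2] by the gap. The two images are orthogonal, so the smaller constant
    serves for [f]. *)
Lemma resolvent_lower_bound : y != 0 \/ (x < lam /\ x != 0) ->
  exists2 c, 0 < c & forall f g, A f g -> c * b f f <= b (res f g) (res f g).
Proof.
move=> xy.
have xy0 : 0 < x ^+ 2 + y ^+ 2.
  case: xy => [y0|[_ x0]].
    by rewrite ltr_wpDl ?sqr_ge0// exprn_even_gt0.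
  by rewrite ltr_wpDr ?sqr_ge0// exprn_even_gt0.
have [c0 [c0_gt0 c0P]] : exists c0, 0 < c0 /\ forall f g, A f g -> b e f = 0 ->
    b (J e) f = 0 -> c0 * b f f <= nrm f * nrm (res f g).
  case: xy => [y0|[xl x0]].
    exists `|y|; split => [|f g Afg _ _]; first by rewrite normr_gt0.
    rewrite -nrmJ; apply: le_trans (cauchy_schwarz bH _ _).
    have Jg : b (J f) g = 0.
      by have := A_sym Afg (A_J Afg); have := J_skew f g; rewrite (bC g) => *; lra.
    by rewrite !ipE bJJ bJ Jg mulr0 sub0r add0r normrN normrM (ger0_norm (ip_ge0 bH _)).
  exists (lam - x); split => [|f g Afg ef Jef]; first by rewrite subr_gt0.
  apply: le_trans (cauchy_schwarz bH _ _); apply: le_trans (ler_norm _).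
  have := gap Afg ef Jef; rewrite !ipE (bC f (J f)) bJ.
  by move: (b f f) (b f g) => *; nra.
pose c := Num.min (c0 ^+ 2) (x ^+ 2 + y ^+ 2).
exists c; first by rewrite lt_min xy0 exprn_gt0.
move=> f g Afg.
pose n := (b e f / b e e) *: e + (b (J e) f / b e e) *: J e.
have fE : f = P f + n by rewrite /P subrK.
have APf := operator_orthogonal_part Afg.
have Pe := orthogonal_part_e f; have PJe := orthogonal_part_Je f.
have fPE := pythagoras f; move: (P f) fE APf Pe PJe fPE => p fE APf Pe PJe fPE.
set w0 := res p g.
have wE : res f g = w0 - (x *: n + y *: J n).
  by rewrite /w0 fE JD; clearbody n; module_ring R [:: g; p; J p; n; J n].
have ge : b e g = 0 by rewrite (A_sym A_e Afg) (ip0l bH).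
have gJe : b (J e) g = 0.
  by have := A_sym (A_J A_e) Afg; rewrite J0 (ip0l bH).
have JPe : b e (J p) = 0 by have := J_skew e p; lra.
have w0e : b w0 e = 0 by rewrite bC !ipE ge Pe JPe !mulr0 addr0 subr0.
have w0Je : b w0 (J e) = 0 by rewrite bC !ipE gJe PJe bJJ Pe !mulr0 addr0 subr0.
have c0w := c0P _ _ APf Pe PJe; rewrite -/w0 in c0w; clearbody w0.
have w0n a a' : b w0 (a *: e + a' *: J e) = 0 by rewrite !ipE w0e w0Je !mulr0 addr0.
have JnE : x *: n + y *: J n =
    (x * (b e f / b e e) - y * (b (J e) f / b e e)) *: e +
    (x * (b (J e) f / b e e) + y * (b e f / b e e)) *: J e.
  by rewrite /n JD !JZ JK; module_ring R [:: e; J e].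
rewrite wE; set n' := x *: n + y *: J n.
have w0n' : b w0 n' = 0 by rewrite /n' JnE w0n.
have bn' : b n' n' = (x ^+ 2 + y ^+ 2) * b n n.
  by clearbody n; rewrite /n' !ipE bJJ (bC n) bJ; ring.
have bn : b n n = (b e f ^+ 2 + b (J e) f ^+ 2) / b e e.
  by rewrite /n !ipE bJJ (bC e (J e)) bJ; field.
have -> : b (w0 - n') (w0 - n') = b w0 w0 + (x ^+ 2 + y ^+ 2) * b n n.
  by rewrite -bn'; clearbody n'; rewrite !ipE (bC n') w0n'; ring.
rewrite fPE -bn mulrDr lerD//; last first.
  by rewrite ler_wpM2r ?(ip_ge0 bH)// ge_min lexx orbT.
rewrite (@le_trans _ _ (c0 ^+ 2 * b p p))//.
  by rewrite ler_wpM2r ?(ip_ge0 bH)// ge_min lexx.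
move: c0w; rewrite -!(sqr_nrm bH).
have := nrm_ge0 b p; have := nrm_ge0 b w0.
move: (nrm w0) (nrm p) => s r s0 r0.
rewrite le_eqVlt in r0; case/orP: r0 => [/eqP <-|r0].
  by move=> _; rewrite expr0n mulr0 sqr_ge0.
rewrite expr2 mulrCA ler_pM2l// => h.
by rewrite -exprMn; rewrite lerXn2r ?nnegrE ?mulr_ge0 ?(ltW r0) ?(ltW c0_gt0).
Qed.

End resolvent.

(* The range is dense because its orthogonal complement consists of
   eigenvectors for the conjugate of [x + iy], and closed by the lower bound. *)
Lemma resolvent_onto x y : y != 0 \/ (x < lam /\ x != 0) ->
  forall h, exists f g, A f g /\ nrm (g - (x *: f + y *: J f) - h) = 0.
Proof.
move=> xy h.
have [c c0 cP] := resolvent_lower_bound xy.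
have [|c' c'0 c'P] := @resolvent_lower_bound x (- y).
  by case: xy => [y0|?]; [left; rewrite oppr_eq0|right].
pose W := [set w | exists f g, A f g /\ w = g - (x *: f + y *: J f)].
have WS : linear_subspace W.
  rewrite /linear_subspace /W /=; split.
    by exists 0, 0; split => //; rewrite J0 !scaler0 addr0 subr0.
  move=> a _ _ [f [g [Afg ->]]] [f' [g' [Afg' ->]]].
  exists (a *: f + f'), (a *: g + g'); split; first exact: A_linear.
  by rewrite J_linear; module_ring R [:: f; g; f'; g'; J f; J f'].
have [p [pW hp]] := orthogonal_projection bH h WS.
have [k kE] : exists k, k = h - p by exists (h - p).
rewrite -kE in hp.
have res_ip f g : A f g -> b (f + g) k = b f ((1 + x) *: k - y *: J k).
  move=> Afg; have := hp _ (ex_intro _ f (ex_intro _ g (conj Afg erefl))).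
  by rewrite !ipE J_skew => *; lra.
(* [k] is orthogonal to the range but not known to lie in the domain. The solution [f1] of
   [(1 + A) f1 = (1 + conj z) k] does, and testing against the range of [1 + A] shows that [k - f1]
   is null; thus [A f1 = conj z f1] up to null vectors. *)
have [f1 [g1 [Afg1 fg1]]] := A_onto ((1 + x) *: k - y *: J k).
have f1k : nrm (k - f1) = 0.
  have [f [g [Afg fg]]] := A_onto (k - f1).
  apply: null_ge0; rewrite -(ip_eqr bH (k - f1) fg).
  rewrite (bC (k - f1)) (ipDr bH) (ipNr bH) (res_ip _ _ Afg).
  rewrite -(ip_eqr bH f fg1) !ipE (A_sym Afg Afg1).
  by move: (b f f1) (b g f1) => *; lra.
have f10 : nrm f1 = 0.
  apply: null_ge0; rewrite -(pmulr_rle0 _ c'0).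
  apply: (le_trans (c'P _ _ Afg1)); rewrite -(sqr_nrm bH).
  suff -> : nrm (g1 - (x *: f1 + - y *: J f1)) = 0 by rewrite expr0n.
  have -> : g1 - (x *: f1 + - y *: J f1) = (f1 + g1 - ((1 + x) *: k - y *: J k))
     + ((1 + x) *: (k - f1) - y *: J (k - f1)).
    by rewrite JD JN; module_ring R [:: f1; g1; k; J f1; J k].
  have := nrmB bH ((1 + x) *: (k - f1)) (y *: J (k - f1)).
  have := nrmD bH (f1 + g1 - ((1 + x) *: k - y *: J k))
    ((1 + x) *: (k - f1) - y *: J (k - f1)).
  rewrite fg1 !(nrmZ bH) nrmJ f1k !mulr0 addr0 add0r => h1 h2.
  by apply/eqP; rewrite eq_le nrm_ge0 (le_trans h1 h2).
have k0 : nrm k = 0 by rewrite (nrm_null bH f1k).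
have happrox r : 0 < r -> exists2 w, W w & nrm (w - h) <= r.
  move=> /pW [w Ww wp]; exists w => //.
  by rewrite (le_trans (nrm_tri bH p _ _))// (nrm_distC bH p) -kE k0 addr0.
have ex n : exists fg : V * V, A fg.1 fg.2 /\
    nrm (fg.2 - (x *: fg.1 + y *: J fg.1) - h) <= n.+1%:R^-1.
  have [|w [f [g [Afg ->]]] wh] := happrox n.+1%:R^-1; first by rewrite invr_gt0.
  by exists (f, g).
have [u /all_and2 [Au uh]] := choice ex.
pose f n := (u n).1; pose g n := (u n).2; pose w n := g n - (x *: f n + y *: J (f n)).
have wh r : 0 < r -> exists N, forall n, (N <= n)%N -> nrm (w n - h) <= r.
  move=> r0; have [N _ HN] := @near_infty_natSinv_lt R (PosNum r0).
  by exists N => n Nn; apply: (le_trans (uh n)); exact/ltW/HN.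
have [|f' ff'] := nrm_complete bH (u := f).
  move=> r r0; have [|N HN] := wh (Num.sqrt c * r / 2).
    by rewrite divr_gt0// mulr_gt0// sqrtr_gt0.
  exists N => m n Nm Nn.
  have wmn : nrm (w m - w n) <= Num.sqrt c * r.
    rewrite (le_trans (nrm_tri bH h _ _))// [leRHS]splitr lerD ?HN//.
    by rewrite (nrm_distC bH) HN.
  have := cP _ _ (A_B (Au m) (Au n)).
  have -> : (u m).2 - (u n).2 - (x *: ((u m).1 - (u n).1) + y *: J ((u m).1 - (u n).1))
     = w m - w n.
    rewrite /w /f /g JD JN.
    by module_ring R [:: (u m).1; (u n).1; (u m).2; (u n).2; J (u m).1; J (u n).1].
  rewrite -!(sqr_nrm bH) -/(f m) -/(f n) => h1.
  rewrite -(ler_pM2l (x := Num.sqrt c)) ?sqrtr_gt0//.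
  apply: le_trans wmn; rewrite -(@ler_pXn2r _ 2) ?nnegrE ?mulr_ge0 ?sqrtr_ge0 ?nrm_ge0//.
  by rewrite exprMn sqr_sqrtr// ltW.
pose g' := h + (x *: f' + y *: J f').
(* The limit pair [(f', g')] need not belong to the graph of [A]. The pair [(f2, g2)] does and has
   the same sum; symmetry, tested against the range of [1 + A], makes [f2 - f'] null. *)
have [f2 [g2 [Afg2 fg2]]] := A_onto (f' + g').
have gg' r : 0 < r -> exists N, forall n, (N <= n)%N -> nrm (f n - f') <= r /\
    nrm (g n - g') <= r.
  move=> r0; pose s := 1 + `|x| + `|y|.
  have s0 : 1 <= s by rewrite /s -addrA lerDl addr_ge0.
  have sp : 0 < s by rewrite (lt_le_trans ltr01).
  have [|N1 H1] := wh (r / 2); first by rewrite divr_gt0.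
  have [|N2 H2] := ff' (r / 2 / s); first by rewrite !divr_gt0.
  exists (maxn N1 N2) => n; rewrite geq_max => /andP[/H1 n1 /H2 n2].
  have n2' : nrm (f n - f') * s <= r / 2 by rewrite -ler_pdivlMr.
  split.
    rewrite (le_trans n2)// ler_pdivrMr// (le_trans (y := r))//.
      by rewrite ler_pdivrMr// ler_peMr ?ler1n// ltW.
    by rewrite ler_peMr// ltW.
  have -> : g n - g' = (w n - h) + (x *: (f n - f') + y *: J (f n - f')).
    by rewrite /w /g' JD JN; module_ring R [:: f n; g n; J (f n); h; f'; J f'].
  rewrite (le_trans (nrmD bH _ _))//.
  have := nrmD bH (x *: (f n - f')) (y *: J (f n - f')).
  rewrite !(nrmZ bH) nrmJ => h3.
  move: n1 n2' h3; rewrite /s; move: (nrm (f n - f')) (nrm_ge0 b (f n - f')).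
  move: (nrm (w n - h)) (nrm (_ + _)) => *; lra.
have f2f' : nrm (f2 - f') = 0.
  have [phi [gam [Aphi phigam]]] := A_onto (f2 - f').
  apply: null_ge0; apply/ler_addgt0Pl => r r0; rewrite addr0.
  rewrite -(ip_eqr bH (f2 - f') phigam) (bC (f2 - f')).
  pose K := nrm (phi + gam) + nrm phi + nrm phi + 1.
  have K0 : 0 < K by rewrite ltr_wpDl ?addr_ge0 ?nrm_ge0.
  have [|N /(_ N (leqnn N)) [fN gN]] := gg' (r / K); first by rewrite divr_gt0.
  have -> : b (phi + gam) (f2 - f') =
      b (phi + gam) (f N - f') - b phi (f N - f') - b phi (g N - g').
    have := ip_eqr bH phi fg2; have := A_sym Aphi Afg2; have := A_sym Aphi (Au N).
    rewrite -/(f N) -/(g N) !ipE => *; lra.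
  have h1 := le_trans (ler_norm _) (cauchy_schwarz bH (phi + gam) (f N - f')).
  have h2 := le_trans (ler_norm _) (cauchy_schwarz bH (- phi) (f N - f')).
  have h3 := le_trans (ler_norm _) (cauchy_schwarz bH (- phi) (g N - g')).
  rewrite (nrmN bH) (ipNl bH) in h2; rewrite (nrmN bH) (ipNl bH) in h3.
  apply: (@le_trans _ _ ((nrm (phi + gam) + nrm phi + nrm phi) * (r / K))).
    have := ler_wpM2l (nrm_ge0 b (phi + gam)) fN.
    have := ler_wpM2l (nrm_ge0 b phi) fN.
    have := ler_wpM2l (nrm_ge0 b phi) gN.
    move: h1 h2 h3; rewrite !mulrDl.
    by move: (r / K) (b _ _) (b _ _) (b _ _) => *; lra.
  by rewrite mulrCA ler_piMr ?(ltW r0)// ler_pdivrMr// mul1r lerDl.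
exists f2, g2; split => //.
have -> : g2 - (x *: f2 + y *: J f2) - h = (f2 + g2 - (f' + g'))
    - (f2 - f') - (x *: (f2 - f') + y *: J (f2 - f')).
  by rewrite /g' JD JN; module_ring R [:: f2; g2; J f2; h; f'; J f'].
apply/eqP; rewrite eq_le nrm_ge0 andbT.
have h1 := nrmB bH (f2 + g2 - (f' + g') - (f2 - f')) (x *: (f2 - f') + y *: J (f2 - f')).
have h2 := nrmB bH (f2 + g2 - (f' + g')) (f2 - f').
have h3 := nrmD bH (x *: (f2 - f')) (y *: J (f2 - f')).
rewrite !(nrmZ bH) nrmJ f2f' !mulr0 addr0 in h3.
rewrite fg2 f2f' addr0 in h2.
by rewrite (le_trans h1)// -[leRHS]addr0 lerD.
Qed.

(** A residual orthogonal to the domain is [f + g] with [A f g], up to a null vector. Pairing with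
    [f] gives [|f|^2 + b f g = 0], so [f] is null, and the hypothesis, that [A] respects null
    classes, makes [g] null as well. *)
Lemma operator_dense : (forall f g, A f g -> nrm f = 0 -> nrm g = 0) ->
  forall h r, 0 < r -> exists f g, A f g /\ nrm (f - h) <= r.
Proof.
move=> A_null h r r0; pose W := [set f | exists g, A f g].
have WS : linear_subspace W.
  split; first by exists 0.
  move=> a f f' [g Afg] [g' Afg']; exists (a *: g + g'); exact: A_linear.
have [p [pW hp]] := orthogonal_projection bH h WS.
have [k kE] : exists k, k = h - p by exists (h - p).
rewrite -kE in hp.
have [f [g [Afg fg]]] := A_onto k.
have f0 : nrm f = 0.
  apply: null_ge0; have := hp f (ex_intro _ g Afg).
  by rewrite -(ip_eqr bH f fg) (ipDr bH); have := A_ge0 Afg => *; lra.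
have k0 : nrm k = 0.
  apply/eqP; rewrite eq_le nrm_ge0 andbT -(nrm_null bH fg).
  by rewrite (le_trans (nrmD bH _ _))// f0 (A_null _ _ Afg f0) addr0.
have [w [g' Awg] wp] := pW r r0; exists w, g'; split => //.
by rewrite (le_trans (nrm_tri bH p _ _))// (nrm_distC bH p) -kE k0 addr0.
Qed.

(** * Contraction of the semigroup generated by [- A] *)

Section semigroup.
Variable S : R -> V -> V.
Hypothesis S_linear : forall t a x y, 0 <= t ->
  nrm (S t (a *: x + y) - (a *: S t x + S t y)) = 0.
Hypothesis S_bounded : forall t, 0 <= t -> exists M, forall x, nrm (S t x) <= M * nrm x.
Hypothesis S_0 : forall x, nrm (S 0 x - x) = 0.
Hypothesis S_add : forall s t x, 0 <= s -> 0 <= t ->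
  nrm (S (s + t) x - S s (S t x)) = 0.
Hypothesis S_cont : forall x r, 0 < r -> exists2 d, 0 < d &
  forall t, 0 < t -> t < d -> nrm (S t x - x) <= r.
Hypothesis S_gen : forall f g, A f g <-> forall r, 0 < r -> exists2 d, 0 < d &
  forall t, 0 < t -> t < d -> nrm (t^-1 *: (S t f - f) + g) <= r.

Let nrm_eq x y : nrm (x - y) = 0 -> nrm x = nrm y.
Proof. by move=> h; exact: (nrm_null bH h). Qed.

Let S_null t x : 0 <= t -> nrm x = 0 -> nrm (S t x) = 0.
Proof.
move=> /S_bounded [M SM] x0; apply/eqP; rewrite eq_le nrm_ge0 andbT.
by rewrite (le_trans (SM x))// x0 mulr0.
Qed.

Let S00 t : 0 <= t -> nrm (S t 0) = 0.
Proof. by move=> t0; apply: S_null; rewrite ?(nrm0 bH). Qed.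

Let null_add x y : nrm x = 0 -> nrm y = 0 -> nrm (x + y) = 0.
Proof.
move=> x0 y0; apply/eqP; rewrite eq_le nrm_ge0 andbT.
by rewrite (le_trans (nrmD bH _ _))// x0 y0 addr0.
Qed.

Let null_scale a x : nrm x = 0 -> nrm (a *: x) = 0.
Proof. by move=> x0; rewrite (nrmZ bH) x0 mulr0. Qed.

Let null_tri z x y : nrm (x - z) = 0 -> nrm (z - y) = 0 -> nrm (x - y) = 0.
Proof. by move=> h1 h2; have := null_add h1 h2; rewrite addrA subrK. Qed.

Let SZ t a x : 0 <= t -> nrm (S t (a *: x) - a *: S t x) = 0.
Proof.
move=> t0; have := S_linear a x 0 t0; rewrite addr0 => h.
apply: null_tri h _; have -> : a *: S t x + S t 0 - a *: S t x = S t 0.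
  by module_ring R [:: S t x; S t 0].
exact: S00.
Qed.

Let S_B t x y : 0 <= t -> nrm (S t (x - y) - (S t x - S t y)) = 0.
Proof.
move=> t0; have := S_linear (-1) y x t0.
by rewrite !scaleN1r (addrC (- y)) (addrC (- S t y)).
Qed.

(* Strong continuity at 0 makes [S (tk k) x] bounded for every [x], along any
   sequence tending to 0. *)
Lemma semigroup_locally_bounded : exists d M, [/\ 0 < d, 0 <= M &
  forall t x, 0 <= t -> t <= d -> nrm (S t x) <= M * nrm x].
Proof.
apply: contrapT => nbd.
have ex (k : nat) : exists t : R, [/\ 0 <= t, t <= k.+1%:R^-1 &
    exists x, k%:R * nrm x < nrm (S t x)].
  apply: contrapT => h; apply: nbd; exists k.+1%:R^-1, k%:R; split => //.
  move=> t x t0 tk; rewrite leNgt; apply/negP => hx; apply: h; exists t.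
  by split => //; exists x.
have [tk /all_and3 [tk0 tk1 tkx]] := choice ex.
have [| |n|x|M HM] := @uniform_boundedness R V b bH (fun k x => nrm (S (tk k) x)).
- move=> n x y; have := S_linear 1 x y (tk0 n); rewrite !scale1r => /nrm_eq ->.
  exact: nrmD.
- by move=> n a x; rewrite (nrm_eq (SZ a x (tk0 n))) (nrmZ bH).
- exact: S_bounded.
- have [d d0 Hd] := S_cont x ltr01.
  have [N _ HN] := @near_infty_natSinv_lt R (PosNum d0).
  exists (\sum_(i < N) nrm (S (tk i) x) + (nrm x + 1)) => n.
  have [nN|Nn] := ltnP n N.
    rewrite (bigD1 (Ordinal nN))//= -addrA lerDl !addr_ge0 ?nrm_ge0//.
    by rewrite sumr_ge0// => i _; exact: nrm_ge0.
  rewrite (@le_trans _ _ (nrm x + 1))//; last first.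
    by rewrite lerDr sumr_ge0// => i _; exact: nrm_ge0.
  have := tk0 n; rewrite le_eqVlt => /predU1P[<-|tp].
    by rewrite (nrm_eq (S_0 x)) lerDl.
  have := Hd _ tp (le_lt_trans (tk1 n) (HN n Nn)).
  by have := nrmD bH (S (tk n) x - x) x; rewrite subrK => *; lra.
- pose k := (Num.truncn M).+1; have [x] := tkx k.
  apply/negP; rewrite -leNgt (le_trans (HM k x))// ler_wpM2r ?nrm_ge0//.
  exact/ltW/truncnS_gt.
Qed.

Let S_comm s t x : 0 <= s -> 0 <= t -> nrm (S s (S t x) - S t (S s x)) = 0.
Proof.
move=> s0 t0; apply: (null_tri (z := S (s + t) x)).
  by rewrite (nrm_distC bH) S_add.
by rewrite (addrC s) S_add.
Qed.

Lemma semigroup_operator t f g : 0 <= t -> A f g -> A (S t f) (S t g).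
Proof.
move=> t0 /S_gen Afg; apply/S_gen => r r0.
have [M SM] := S_bounded t0.
have [|d d0 Hd] := Afg (r / (`|M| + 1)); first by rewrite divr_gt0.
exists d => // s s0 sd.
have -> : nrm (s^-1 *: (S s (S t f) - S t f) + S t g) =
    nrm (S t (s^-1 *: (S s f - f) + g)).
  apply/esym/nrm_eq; apply: null_tri (S_linear _ _ _ t0) _.
  have -> : s^-1 *: S t (S s f - f) + S t g -
      (s^-1 *: (S s (S t f) - S t f) + S t g) =
      s^-1 *: (S t (S s f - f) - (S t (S s f) - S t f)) +
      s^-1 *: (S t (S s f) - S s (S t f)).
    by module_ring R [:: S t (S s f - f); S s (S t f); S t f; S t (S s f); S t g].
  by rewrite null_add// null_scale// ?S_B ?S_comm// ltW.
rewrite (le_trans (SM _))//; apply: (@le_trans _ _ ((`|M| + 1) * (r / (`|M| + 1)))).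
  apply: (@le_trans _ _ ((`|M| + 1) * nrm (s^-1 *: (S s f - f) + g))).
    by rewrite ler_wpM2r ?nrm_ge0// (le_trans (ler_norm _))// lerDl.
  by rewrite ler_wpM2l ?Hd// ltW.
by rewrite mulrC divfK// gt_eqF.
Qed.

Let inv_small (d : R) : 0 < d -> exists N : nat, N.+1%:R^-1 < d.
Proof.
move=> d0; have [N _ HN] := @near_infty_natSinv_lt R (PosNum d0).
by exists N; have := HN N (leqnn N).
Qed.

Section contraction.
Variables d M : R.
Hypothesis M_ge0 : 0 <= M.
Hypothesis SM : forall t x, 0 <= t -> t <= d -> nrm (S t x) <= M * nrm x.

(* Implicit Euler: [S s f] is [(1 + hA) (S (s + h) f)] up to [o(h)]. *)
Lemma implicit_euler_step s h f g r : 0 <= s -> s <= d -> 0 < h ->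
  nrm (h^-1 *: (S h f - f) + S h g) <= r ->
  nrm (S (s + h) f + h *: S (s + h) g - S s f) <= M * (h * r).
Proof.
move=> s0 sd h0 hr; have h0' := ltW h0.
have -> : nrm (S (s + h) f + h *: S (s + h) g - S s f) =
    nrm (S s (h *: (h^-1 *: (S h f - f) + S h g))).
  apply: nrm_eq.
  have -> : h *: (h^-1 *: (S h f - f) + S h g) = h *: S h g + (S h f - f).
    by rewrite scalerDr scalerA divff ?gt_eqF// scale1r addrC.
  have -> : S (s + h) f + h *: S (s + h) g - S s f - S s (h *: S h g + (S h f - f))
    = - (S s (h *: S h g + (S h f - f)) - (h *: S s (S h g) + S s (S h f - f)))
      - (S s (S h f - f) - (S s (S h f) - S s f))
      + (S (s + h) f - S s (S h f)) + h *: (S (s + h) g - S s (S h g)).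
    move: (S s (h *: S h g + (S h f - f))) (S s (S h f - f)) => u v.
    by module_ring R [:: u; v; S (s + h) f; S (s + h) g; S s f; S s (S h g); S s (S h f)].
  apply: null_add; last by rewrite null_scale// S_add.
  apply: null_add; last by rewrite S_add.
  by rewrite null_add// (nrmN bH) ?S_linear ?S_B.
rewrite (le_trans (SM _ s0 sd))// (nrmZ bH) gtr0_norm//.
by rewrite ler_wpM2l// ler_wpM2l.
Qed.

(** The step size depends only on the behaviour of [S h f] and [S h g] near [h = 0]: a step starting
    at time [s] is the image under [S s] of the step starting at 0, which costs the factor [M].
    Hence one [h] serves all [k]. *)
Lemma implicit_euler f g t r : A f g -> 0 < t -> t <= d -> 0 < r ->
  exists n : nat, exists h, [/\ 0 < h, n%:R * h = t &
   forall k, (k < n)%N -> nrm (S (k.+1%:R * h) f + h *: S (k.+1%:R * h) g - S (k%:R * h) f)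
     <= M * (h * r)].
Proof.
move=> Afg t0 td r0.
have r20 : 0 < r / 2 by rewrite divr_gt0.
have [d1 d10 H1] := (S_gen f g).1 Afg _ r20.
have [d2 d20 H2] := S_cont g r20.
have [|N HN] := @inv_small (Num.min d1 d2 / t).
  by rewrite divr_gt0// lt_min d10.
have hlt : t / N.+1%:R < Num.min d1 d2.
  by rewrite mulrC -ltr_pdivlMr.
have h0 : 0 < t / N.+1%:R by rewrite divr_gt0.
exists N.+1, (t / N.+1%:R); split => //.
  by rewrite mulrC divfK.
move=> k kN; rewrite -natr1 mulrDl mul1r.
apply: implicit_euler_step => //.
- by rewrite mulr_ge0// ltW.
- apply: le_trans td; rewrite mulrCA ler_piMr ?(ltW t0)// ler_pdivrMr//.
  by rewrite mul1r ler_nat ltnW.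
- move: hlt; rewrite lt_min => /andP[l1 l2].
  set h := t / _ in h0 l1 l2 *.
  have -> : h^-1 *: (S h f - f) + S h g =
    (h^-1 *: (S h f - f) + g) + (S h g - g).
    by module_ring R [:: S h f; f; S h g; g].
  by rewrite (le_trans (nrmD bH _ _))// [leRHS]splitr lerD ?H1 ?H2.
Qed.

(** Formally the derivative of [b v (S t f)] is [- b v (A (S t f)) = 0]. Here each Euler step
    changes the value by its error alone, and the errors add up to at most [r]. *)
Lemma semigroup_preserves v f g t : (forall f g, A f g -> b v g = 0) ->
  A f g -> 0 < t -> t <= d -> b v (S t f) = b v f.
Proof.
move=> vA Afg t0 td; apply/eqP; rewrite -subr_eq0 -normr_le0.
apply/ler_addgt0Pl => r r0; rewrite addr0.
pose K := nrm v * M * t + 1.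
have K0 : 0 < K by rewrite ltr_wpDl// !mulr_ge0 ?nrm_ge0 ?(ltW t0).
have [|n [h [h0 nh step]]] := @implicit_euler f g t (r / K) Afg t0 td.
  by rewrite divr_gt0.
have rK0 : 0 < r / K by rewrite divr_gt0.
suff H k : (k <= n)%N -> `|b v (S (k%:R * h) f) - b v f| <=
    k%:R * (nrm v * (M * (h * (r / K)))).
  rewrite -nh (le_trans (H n (leqnn n)))//.
  have -> : n%:R * (nrm v * (M * (h * (r / K)))) = (nrm v * M * (n%:R * h)) * (r / K).
    by ring.
  rewrite nh mulrCA ler_piMr ?(ltW r0)// ler_pdivrMr// mul1r.
  by rewrite lerDl.
elim: k => [_|k IH kn].
  by rewrite mul0r -(ipNr bH) -(ipDr bH) (bC v) (ip_null bH)// normr0 mul0r.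
rewrite -[in leRHS]natr1 mulrDl mul1r.
have -> : b v (S (k.+1%:R * h) f) - b v f =
   (b v (S (k%:R * h) f) - b v f) +
   b v (S (k.+1%:R * h) f + h *: S (k.+1%:R * h) g - S (k%:R * h) f).
  have := vA _ _ (@semigroup_operator (k.+1%:R * h) f g (mulr_ge0 (ler0n _ _) (ltW h0)) Afg).
  by rewrite !ipE => ->; ring.
rewrite (le_trans (ler_normD _ _))// lerD ?IH ?(ltnW kn)//.
by rewrite (le_trans (cauchy_schwarz bH _ _))// ler_wpM2l ?nrm_ge0// step.
Qed.

Let e_range f g : A f g -> b e g = 0.
Proof. by move=> Afg; rewrite (A_sym A_e Afg) (ip0l bH). Qed.

Let Je_range f g : A f g -> b (J e) g = 0.
Proof. by move=> Afg; have := A_sym (A_J A_e) Afg; rewrite J0 (ip0l bH). Qed.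

Lemma accretive h f g : 0 < h -> A f g -> b e f = 0 -> b (J e) f = 0 ->
  (1 + h * lam) * nrm f <= nrm (f + h *: g).
Proof.
move=> h0 Afg ef Jef; have := gap Afg ef Jef => gapf.
have := le_trans (ler_norm _) (cauchy_schwarz bH f (f + h *: g)).
rewrite !ipE -(sqr_nrm bH) => cs; rewrite -(sqr_nrm bH) in gapf.
have := nrm_ge0 b f; have := nrm_ge0 b (f + h *: g).
move: (nrm f) (nrm (_ + _)) (b f g) cs gapf => u v w cs gapf v0.
rewrite le_eqVlt => /predU1P[<-|u0]; first by rewrite mulr0.
rewrite -(ler_pM2l u0); apply: le_trans cs.
have : h * (lam * u ^+ 2) <= h * w by rewrite ler_wpM2l// ltW.
by move: (h * w) => *; lra.
Qed.

Lemma semigroup_contraction f g t : A f g -> b e f = 0 -> b (J e) f = 0 ->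
  0 < t -> t <= d -> (1 + t * lam) * nrm (S t f) <= nrm f.
Proof.
move=> Afg ef Jef t0 td; apply/ler_addgt0Pl => r r0.
pose K := (1 + t * lam) * t * M + 1.
have K0 : 0 < K by rewrite ltr_wpDl// !mulr_ge0 ?addr_ge0 ?mulr_ge0 ?(ltW t0) ?(ltW lam_gt0).
have rK0 : 0 < r / K by rewrite divr_gt0.
have [n [h [h0 nh step]]] := @implicit_euler f g t (r / K) Afg t0 td rK0.
pose q := M * (h * (r / K)).
have q0 : 0 <= q by apply: mulr_ge0 => //; apply: mulr_ge0; exact: ltW.
have hl0 : 0 < h * lam by rewrite mulr_gt0.
(* The linear factor [1 + k h lam] stands in for [(1 + h lam)^k], which is at least as large; it
   already forces strict contraction. Each step adds the error [q], amplified by at most the current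
   factor. *)
suff H k : (k <= n)%N -> (1 + k%:R * h * lam) * nrm (S (k%:R * h) f) <=
    nrm f + (1 + k%:R * h * lam) * (k%:R * q).
  have := H n (leqnn n); rewrite nh => /le_trans; apply.
  rewrite addrC lerD2r.
  have -> : (1 + t * lam) * (n%:R * q) = ((1 + t * lam) * (n%:R * h) * M) * (r / K).
    by rewrite /q; ring.
  by rewrite nh mulrCA ler_piMr ?(ltW r0)// ler_pdivrMr// mul1r lerDl.
elim: k => [_|k IH kn].
  by rewrite !mul0r mulr0 !addr0 mul1r (nrm_eq (S_0 f)).
have khle : k.+1%:R * h <= d.
  by rewrite (le_trans _ td)// -nh ler_wpM2r ?(ltW h0)// ler_nat.
have kh0 : 0 < k.+1%:R * h by rewrite mulr_gt0.
have ASk := semigroup_operator (ltW kh0) Afg.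
have ek : b e (S (k.+1%:R * h) f) = 0.
  by rewrite (semigroup_preserves e_range Afg).
have Jek : b (J e) (S (k.+1%:R * h) f) = 0.
  by rewrite (semigroup_preserves Je_range Afg).
have acc := accretive h0 ASk ek Jek.
have := nrmD bH (S (k.+1%:R * h) f + h *: S (k.+1%:R * h) g - S (k%:R * h) f)
  (S (k%:R * h) f); rewrite subrK.
have := step k kn; rewrite -/q; have := IH (ltnW kn); move: acc.
have := nrm_ge0 b (S (k.+1%:R * h) f).
rewrite -(natr1 k) mulrDl mul1r.
have := ler0n R k.
move: (nrm (S (k%:R * h) f)) (nrm (S (k%:R * h + h) f)) (nrm (_ + _)) (nrm (_ - _)) (nrm f).
have : 0 <= k%:R * h * lam by rewrite !mulr_ge0// ltW.
have -> : (k%:R * h + h) * lam = k%:R * h * lam + h * lam by ring.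
clearbody q; move: (k%:R * h * lam) => a a0.
move: (k%:R : R) (h * lam) hl0 => K' c c0 u v w z F K'0 v0 h1 h2 h3 h4.
have s1 : (1 + c) * v <= u + q by lra.
have s2 : (1 + a) * ((1 + c) * v) <= (1 + a) * (u + q).
  by rewrite ler_wpM2l// addr_ge0.
have s3 : (1 + (a + c)) * v <= (1 + a) * ((1 + c) * v).
  have acv : 0 <= a * c * v by rewrite !mulr_ge0// ltW.
  by move: acv; rewrite !(mulrDl, mulrDr, mul1r, mulr1) mulrA => *; lra.
have s4 : 0 <= c * ((K' + 1) * q) by rewrite !mulr_ge0 ?addr_ge0// ltW.
by move: s1 s2 s3 s4 h2; rewrite !(mulrDl, mulrDr, mul1r, mulr1) => *; lra.
Qed.

End contraction.

(** The difference quotients of a null [f] are null, so their limit [- g] is null too. *)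
Let A_null : forall f g, A f g -> nrm f = 0 -> nrm g = 0.
Proof.
move=> f g /S_gen Afg f0; apply/eqP; rewrite eq_le nrm_ge0 andbT.
apply/ler_addgt0Pl => r /Afg [d d0 Hd]; rewrite addr0.
have := Hd (d / 2); rewrite divr_gt0// ltr_pdivrMr// ltr_pMr// ltr1n => /(_ isT isT).
apply: le_trans; rewrite le_eqVlt; apply/orP; left; apply/eqP/esym/nrm_eq.
rewrite addrK null_scale// null_add ?(nrmN bH)//.
by apply: S_null => //; rewrite divr_ge0// ltW.
Qed.

(** The estimate is known for orthogonal data in the domain and for times up to [d]. Density of the
    domain and the local bound [M] extend it to all orthogonal data, the semigroup law to all times.
    Applying [orthogonal_part] keeps the approximants both orthogonal and in the domain. *)
Theorem semigroup_strictly_contractive t : 0 < t -> exists c, [/\ 0 <= c, c < 1 &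
  forall h, b e h = 0 -> b (J e) h = 0 -> nrm (S t h) <= c * nrm h].
Proof.
move=> t0; have [d [M [d0 M0 SM]]] := semigroup_locally_bounded.
have approx h r : b e h = 0 -> b (J e) h = 0 -> 0 < r ->
    exists f g, [/\ A f g, b e f = 0, b (J e) f = 0 & nrm (f - h) <= r].
  move=> eh Jeh r0; have [f [g [Afg fh]]] := operator_dense A_null h r0.
  exists (P f), g; split; [exact: operator_orthogonal_part|
    exact: orthogonal_part_e|exact: orthogonal_part_Je|].
  rewrite -[in X in nrm X](orthogonal_part_id eh Jeh) -orthogonal_partB.
  by rewrite (le_trans (nrm_orthogonal_part _)).
have S_sub s f h : 0 <= s -> s <= d -> nrm (S s f - S s h) <= M * nrm (f - h).
  move=> s0 sd; have := S_B f h s0; rewrite (nrm_distC bH) => /nrm_eq.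
  by move=> h1; rewrite (le_trans _ (SM s (f - h) s0 sd))//; have := nrm_eq (S_B f h s0) => ->.
have small s h : 0 < s -> s <= d -> b e h = 0 -> b (J e) h = 0 ->
    [/\ b e (S s h) = 0, b (J e) (S s h) = 0 & (1 + s * lam) * nrm (S s h) <= nrm h].
  move=> s0 sd eh Jeh; have s0' := ltW s0.
  have pres v : (forall f g, A f g -> b v g = 0) ->
      (forall f, b e f = 0 -> b (J e) f = 0 -> b v f = 0) -> b v (S s h) = 0.
    move=> vA vf; apply/eqP; rewrite -normr_le0.
    apply/ler_addgt0Pl => r r0; rewrite addr0.
    pose K := nrm v * M + 1.
    have K0 : 0 < K by rewrite ltr_wpDl// mulr_ge0// nrm_ge0.
    have [|f [g [Afg ef Jef fh]]] := approx h (r / K) eh Jeh.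
      by rewrite divr_gt0.
    have := semigroup_preserves M0 SM vA Afg s0 sd.
    rewrite (vf f ef Jef) => Sf0.
    have -> : b v (S s h) = - b v (S s f - S s h) by rewrite !ipE Sf0; ring.
    rewrite normrN (le_trans (cauchy_schwarz bH _ _))//.
    apply: (@le_trans _ _ (nrm v * (M * (r / K)))).
      rewrite ler_wpM2l ?nrm_ge0// (le_trans (S_sub _ _ _ s0' sd))//.
      by rewrite ler_wpM2l.
    by rewrite mulrA mulrCA ler_piMr ?(ltW r0)// ler_pdivrMr// mul1r lerDl.
  split.
  - apply: pres => // f g Afg; by rewrite (A_sym A_e Afg) (ip0l bH).
  - apply: pres => // f g Afg.
    by have := A_sym (A_J A_e) Afg; rewrite J0 (ip0l bH).
  - apply/ler_addgt0Pl => r r0.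
    pose K := 1 + (1 + s * lam) * M.
    have sl0 : 0 <= 1 + s * lam by rewrite addr_ge0 ?mulr_ge0 ?(ltW s0) ?(ltW lam_gt0).
    have K0 : 0 < K by rewrite ltr_wpDr// mulr_ge0.
    have [|f [g [Afg ef Jef fh]]] := approx h (r / K) eh Jeh.
      by rewrite divr_gt0.
    have h1 := semigroup_contraction M0 SM Afg ef Jef s0 sd.
    have h2 : nrm (S s h) <= nrm (S s f) + M * (r / K).
      have := nrm_tri bH (S s f) (S s h) 0; rewrite !subr0 => /le_trans; apply.
      rewrite addrC lerD2l (nrm_distC bH) (le_trans (S_sub _ _ _ s0' sd))//.
      by rewrite ler_wpM2l.
    have h3 : nrm f <= nrm h + r / K.
      have := nrm_tri bH h f 0; rewrite !subr0 => /le_trans; apply.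
      by rewrite addrC lerD2l.
    rewrite (le_trans (ler_wpM2l sl0 h2))// mulrDr.
    rewrite (le_trans (lerD h1 (lexx _)))// (le_trans (lerD h3 (lexx _)))//.
    rewrite [leRHS]addrC -addrA lerD2l mulrA -[X in X + _]mul1r -mulrDl -/K.
    by rewrite mulrC divfK// gt_eqF.
have [N HN] := inv_small (divr_gt0 d0 t0).
(* The time [t] is cut into [N + 1] pieces of length at most [d]. Each contracts by [c], and
   [c ^+ N.+1 <= c] is enough. *)
pose s := t / N.+1%:R.
have s0 : 0 < s by rewrite divr_gt0.
have sd : s <= d by rewrite ltW// /s mulrC -ltr_pdivlMr.
have sl0 : 1 < 1 + s * lam by rewrite ltrDl mulr_gt0.
have sl1 : 0 < 1 + s * lam by rewrite (lt_trans ltr01).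
pose c := (1 + s * lam)^-1.
have c0 : 0 < c by rewrite invr_gt0.
have c1 : c < 1 by rewrite invf_lt1.
exists c; split; [exact: ltW|by []|move=> h eh Jeh].
have iter k : [/\ b e (S (k%:R * s) h) = 0, b (J e) (S (k%:R * s) h) = 0 &
    nrm (S (k%:R * s) h) <= c ^+ k * nrm h].
  elim: k => [|k [IHe IHJ IHn]].
    rewrite mul0r expr0 mul1r (nrm_eq (S_0 h)); split => //.
      by rewrite (ip_eqr bH e (S_0 h)).
    by rewrite (ip_eqr bH (J e) (S_0 h)).
  have ks0 : 0 <= k%:R * s by rewrite mulr_ge0// ltW.
  rewrite -natr1 mulrDl mul1r (addrC (_ * s)).
  have [h1 h2 h3] := small s _ s0 sd IHe IHJ.
  rewrite !(ip_eqr bH _ (S_add h (ltW s0) ks0)) (nrm_eq (S_add h (ltW s0) ks0)).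
  split => //; rewrite exprS -mulrA ler_pdivlMl//.
  exact: le_trans h3 IHn.
have [_ _] := iter N.+1; rewrite /s mulrC divfK// => /le_trans; apply.
by rewrite ler_wpM2r ?nrm_ge0// exprS ler_piMr ?(ltW c0)// exprn_ile1// ltW.
Qed.

End semigroup.
End symmetric_operator.

(** * The space L2 as a real Hilbert space *)

Section subspace_type.
Context (R : realType) (V : lmodType R).

(** Both the square-integrable functions and the form domain are instances; as module types of their
    own they can carry a [semi_hilbert] structure. *)
Record subspace_pred := SubspacePred {
  subspace_of :> V -> Prop;
  _ : linear_subspace subspace_of }.

Variable W : subspace_pred.

Definition in_subspace : {pred V} := fun x => `[< W x >].

Lemma in_subspace_submod : submod_closed in_subspace.
Proof.
have [P0 PL] : linear_subspace W by case: W.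
split; first exact/asboolP.
by move=> a x y /asboolP Px /asboolP Py; apply/asboolP; exact: PL.
Qed.

HB.instance Definition _ := GRing.isSubmodClosed.Build R V in_subspace in_subspace_submod.

Definition subspace_type := {x : V | in_subspace x}.
HB.instance Definition _ := SubChoice.on subspace_type.
HB.instance Definition _ := [SubChoice_isSubLmodule of subspace_type by <:].

Definition subspace_sub (x : V) (Wx : W x) : subspace_type := exist _ x (asboolT Wx).

Lemma subspaceP (x : subspace_type) : W (val x).
Proof. by apply/asboolP; exact: valP x. Qed.

End subspace_type.

Section complex_parts.
Context (R : realType).
Implicit Types (z w : R[i]) (a : R).
Local Notation Re := (@complex.Re _).
Local Notation Im := (@complex.Im _).

Lemma normc_sqr z : normc z ^+ 2 = Re z ^+ 2 + Im z ^+ 2.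
Proof. by case: z => x y /=; rewrite sqr_sqrtr// addr_ge0 ?sqr_ge0. Qed.

Lemma Re_conjM z w : Re (conjc z * w) = Re z * Re w + Im z * Im w.
Proof. by case: z w => [x y] [x' y'] /=; ring. Qed.

Lemma Im_conjM z w : Im (conjc z * w) = Re z * Im w - Im z * Re w.
Proof. by case: z w => [x y] [x' y'] /=; ring. Qed.

Lemma cReD z w : Re (z + w) = Re z + Re w. Proof. by case: z w => [x y] []. Qed.
Lemma cImD z w : Im (z + w) = Im z + Im w. Proof. by case: z w => [x y] []. Qed.
Lemma cReN z : Re (- z) = - Re z. Proof. by case: z. Qed.
Lemma cImN z : Im (- z) = - Im z. Proof. by case: z. Qed.
Lemma cReZ a (z : Rcomplex R) : Re (a *: z) = a * Re z. Proof. by case: z. Qed.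
Lemma cImZ a (z : Rcomplex R) : Im (a *: z) = a * Im z. Proof. by case: z. Qed.
Lemma cReM z w : Re (z * w) = Re z * Re w - Im z * Im w.
Proof. by case: z w => [x y] []. Qed.
Lemma cImM z w : Im (z * w) = Re z * Im w + Im z * Re w.
Proof. by case: z w => [x y] [x' y']. Qed.

End complex_parts.

Section Ltwo.
Context d (T : measurableType d) (R : realType) (mu : {measure set T -> \bar R}).
Local Notation Re := (@complex.Re _).
Local Notation Im := (@complex.Im _).
Implicit Types f g : T -> Rcomplex R.

Lemma Lfun2P (u : T -> R) : u \in Lfun mu 2%:E <->
  measurable_fun setT u /\ (\int[mu]_x (u x ^+ 2)%:E < +oo)%E.
Proof.
split=> [u2|[mu' iu]].
  have /integrableP[_] := Lfun2_integrable_sqr u2.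
  under eq_integral do rewrite /= ger0_norm ?sqr_ge0//.
  by split => //; move: u2; rewrite inE => /andP[] /[!inE].
rewrite inE; apply/andP; split; first by rewrite inE.
rewrite inE/= /finite_norm unlock poweR_lty//=.
by under eq_integral do rewrite powR_mulrn// real_normK ?num_real//.
Qed.

(** The squared modulus, written as a polynomial in the two parts so that measurability and limits
    are immediate. *)
Definition sqn (z : R[i]) : R := Re z ^+ 2 + Im z ^+ 2.

Lemma sqn_ge0 z : 0 <= sqn z. Proof. by rewrite addr_ge0 ?sqr_ge0. Qed.

Definition cmeasurable f := measurable_fun setT (Re \o f) /\ measurable_fun setT (Im \o f).

Lemma cmeasurable_sqn f : cmeasurable f -> measurable_fun setT (fun x => sqn (f x)).
Proof. by move=> [mR mI]; apply: measurable_funD; apply: measurable_funX. Qed.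

Lemma L2P f : L2 mu f <-> cmeasurable f /\ (\int[mu]_x (sqn (f x))%:E < +oo)%E.
Proof.
split=> [[/Lfun2P[mR iR] /Lfun2P[mI iI]]|[[mR mI] iRI]].
  split => //; under eq_integral do rewrite /sqn EFinD.
  rewrite ge0_integralD//.
  - by rewrite lte_add_pinfty.
  - by move=> x _; rewrite lee_fin sqr_ge0.
  - by apply/measurable_EFinP; exact: measurable_funX.
  - by move=> x _; rewrite lee_fin sqr_ge0.
  - by apply/measurable_EFinP; exact: measurable_funX.
split; apply/Lfun2P; split => //; apply: le_lt_trans iRI; apply: ge0_le_integral => //.
- by move=> x _; rewrite lee_fin sqr_ge0.
- by apply/measurable_EFinP; exact: measurable_funX.
- by apply/measurable_EFinP; exact: cmeasurable_sqn.
- by move=> x _; rewrite lee_fin /sqn lerDl sqr_ge0.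
- by move=> x _; rewrite lee_fin sqr_ge0.
- by apply/measurable_EFinP; exact: measurable_funX.
- by apply/measurable_EFinP; exact: cmeasurable_sqn.
- by move=> x _; rewrite lee_fin /sqn lerDr sqr_ge0.
Qed.

Lemma L2_subspace : linear_subspace (L2 mu : (T -> Rcomplex R) -> Prop).
Proof.
have lfun0 : (fun x : T => 0 : R) \in Lfun mu 2%:E.
  apply/Lfun2P; split => //; under eq_integral do rewrite expr0n/=.
  by rewrite integral0.
have lfunL a (u v : T -> R) : u \in Lfun mu 2%:E -> v \in Lfun mu 2%:E ->
    (fun x => a * u x + v x) \in Lfun mu 2%:E.
  move=> hu hv; have [_] := Lfun_submod_closed mu (lee1n 2).
  by move=> /(_ a u v hu hv).
split; first by split.
move=> a f g [fR fI] [gR gI]; split.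
  have -> : (fun x => Re ((a *: f + g) x)) = (fun x => a * Re (f x) + Re (g x)).
    by apply/funext => x; rewrite cReD cReZ.
  exact: lfunL.
have -> : (fun x => Im ((a *: f + g) x)) = (fun x => a * Im (f x) + Im (g x)).
  by apply/funext => x; rewrite cImD cImZ.
exact: lfunL.
Qed.

Lemma L2_integrable f g : L2 mu f -> L2 mu g ->
  mu.-integrable setT (EFin \o (fun x => Re (conjc (f x) * g x))) /\
  mu.-integrable setT (EFin \o (fun x => Im (conjc (f x) * g x))).
Proof.
have ii (u v : T -> R) : u \in Lfun mu 2%:E -> v \in Lfun mu 2%:E ->
    mu.-integrable setT (fun x => (u x * v x)%:E).
  by move=> hu hv; have /Lfun1_integrable := Lfun2_mul_Lfun1 hu hv.
move=> [fR fI] [gR gI]; split.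
  apply: (@eq_integrable _ _ _ mu _ measurableT
    ((fun x => (Re (f x) * Re (g x))%:E) \+ (fun x => (Im (f x) * Im (g x))%:E))%E).
    by move=> x _ /=; rewrite Re_conjM EFinD.
  by apply: integrableD => //; exact: ii.
apply: (@eq_integrable _ _ _ mu _ measurableT
  ((fun x => (Re (f x) * Im (g x))%:E) \- (fun x => (Im (f x) * Re (g x))%:E))%E).
  by move=> x _ /=; rewrite Im_conjM EFinB.
by apply: integrableB => //; exact: ii.
Qed.

Definition ip f g : R := Re (inner mu f g).

Lemma ip_RintegralE f g : ip f g = \int[mu]_x Re (conjc (f x) * g x). Proof. by []. Qed.

Lemma ipC_L2 f g : ip f g = ip g f.
Proof. by rewrite !ip_RintegralE; apply: eq_Rintegral => x _; rewrite !Re_conjM; ring. Qed.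

Lemma ip_linear_L2 a f g h : L2 mu f -> L2 mu g -> L2 mu h ->
  ip (a *: f + g) h = a * ip f h + ip g h.
Proof.
move=> Lf Lg Lh; have [i1 _] := L2_integrable Lf Lh; have [i2 _] := L2_integrable Lg Lh.
have ia : mu.-integrable setT (EFin \o (fun x => a * Re (conjc (f x) * h x))).
  have := integrableZl (mu := mu) measurableT a i1.
  by apply: eq_integrable => // x _ /=; rewrite EFinM.
rewrite !ip_RintegralE -RintegralZl// -RintegralD//.
apply: eq_Rintegral => x _; rewrite !Re_conjM.
by rewrite cReD cImD cReZ cImZ; ring.
Qed.

Lemma ip_sqn f : ip f f = \int[mu]_x sqn (f x).
Proof. by apply: eq_Rintegral => x _; rewrite Re_conjM /sqn !expr2. Qed.

Lemma ip_sqnE f : L2 mu f -> (ip f f)%:E = (\int[mu]_x (sqn (f x))%:E)%E.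
Proof.
move=> /L2P[_ fi]; rewrite ip_sqn /Rintegral fineK//.
by rewrite ge0_fin_numE// integral_ge0// => x _; rewrite lee_fin sqn_ge0.
Qed.

Lemma l2normE f : l2norm mu f = nrm ip f.
Proof.
rewrite /l2norm /nrm ip_sqn; congr Num.sqrt.
by apply: eq_Rintegral => x _; rewrite normc_sqr.
Qed.

End Ltwo.

(** * Almost-everywhere limits and completeness of L2 *)

Section limits.
Context d (T : measurableType d) (R : realType) (mu : {measure set T -> \bar R}).

Lemma fatou_ae (g : nat -> T -> R) (g' : T -> R) (e : \bar R) :
  (forall n, measurable_fun setT (g n)) -> measurable_fun setT g' ->
  (forall n x, 0 <= g n x) -> (forall x, 0 <= g' x) ->
  {ae mu, forall x, g n x @[n --> \oo] --> g' x} ->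
  (forall n, (\int[mu]_x (g n x)%:E <= e)%E) -> (\int[mu]_x (g' x)%:E <= e)%E.
Proof.
move=> mg mg' g0 g'0 gg' ge.
pose h n x := (g n x)%:E.
have mh n : measurable_fun setT (h n) by exact/measurable_EFinP.
have h0 n x : setT x -> (0 <= h n x)%E by rewrite lee_fin.
have liminf0 x : (0 <= limn_einf (h ^~ x))%E.
  rewrite limn_einf_lim (cvg_lim _ (cvg_einfs_sup (u := h ^~ x)))//.
  apply: ereal_sup_ge; exists (einfs (h ^~ x) 0%N); first by exists 0%N.
  by apply: le_ereal_inf_tmp => _ [n _ <-]; rewrite lee_fin.
apply: (@le_trans _ _ (\int[mu]_x limn_einf (h ^~ x))%E).
  apply: ae_ge0_le_integral => //.
  - by move=> x _; rewrite lee_fin.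
  - exact/measurable_EFinP.
  - apply: measurableT_comp => //; apply: measurable_fun_limn_esup => n.
    exact: measurableT_comp.
  - apply: filterS gg' => x gx _; suff -> : limn_einf (h ^~ x) = (g' x)%:E by [].
    have : h ^~ x @ \oo --> (g' x)%:E.
      by apply: cvg_EFin => //; exact: nearW.
    by move=> /cvg_limn_einf_sup[].
apply: (le_trans (fatou mu measurableT mh h0)).
rewrite limn_einf_lim (cvg_lim _ (cvg_einfs_sup (u := _)))//.
apply: ge_ereal_sup => _ [n _ <-]; apply: le_trans (ge n).
by apply: ereal_inf_lbound; exists n => /=.
Qed.

(** The increments are at most [sqrt C * (1 / sqrt 2)^k], so the telescoping series is dominated by
    a geometric one. *)
Lemma cvg_fast_increments (a : nat -> R) (C : R) :
  (forall k, 2 ^+ k * (a k.+1 - a k) ^+ 2 <= C) -> cvgn a.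
Proof.
move=> aC; have C0 : 0 <= C by rewrite (le_trans _ (aC 0%N))// mulr_ge0 ?sqr_ge0.
have -> : a = (fun n => a 0%N + series (telescope a) n).
  by apply/funext => n; rewrite -eq_sum_telescope.
apply: is_cvgD; first exact: is_cvg_cst.
apply: normed_cvg; pose r : R := (Num.sqrt 2)^-1.
apply: (@series_le_cvg _ _ (geometric (Num.sqrt C) r)) => [n|n|n|].
- exact: normr_ge0.
- by rewrite /geometric/= mulr_ge0 ?sqrtr_ge0// exprn_ge0// invr_ge0 sqrtr_ge0.
- rewrite /telescope /geometric/= /r exprVn ler_pdivlMr ?exprn_gt0 ?sqrtr_gt0//.
  rewrite -(@ler_pXn2r _ 2) ?nnegrE ?mulr_ge0 ?exprn_ge0 ?sqrtr_ge0 ?normr_ge0//.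
  rewrite exprMn real_normK ?num_real// sqr_sqrtr// -exprM mulnC exprM sqr_sqrtr//.
  by rewrite mulrC.
- apply: is_cvg_geometric_series; rewrite ger0_norm ?invr_ge0 ?sqrtr_ge0//.
  by rewrite invf_lt1 ?sqrtr_gt0// -[ltLHS]sqrtr1 ltr_sqrt// ltr1n.
Qed.

Local Notation Re := (@complex.Re _).
Local Notation Im := (@complex.Im _).

Definition ae_cvg (u : nat -> T -> R[i]) (l : T -> R[i]) :=
  {ae mu, forall x, Re (u n x) @[n --> \oo] --> Re (l x) /\
                    Im (u n x) @[n --> \oo] --> Im (l x)}.

Local Notation ip := (ip mu).

Definition L2_cauchy (u : nat -> T -> Rcomplex R) := forall e, 0 < e ->
  exists N, forall m n, (N <= m)%N -> (N <= n)%N -> ip (u m - u n) (u m - u n) <= e.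

Lemma L2B f g : L2 mu f -> L2 mu g -> L2 mu ((f : T -> Rcomplex R) - g).
Proof.
move=> Lf Lg; have [_ L] := L2_subspace mu.
by have := L (-1) _ _ Lg Lf; rewrite scaleN1r addrC.
Qed.

(* Along a subsequence with [|d_k|^2 <= 4^-k] for the increments, the series
   of the [2^k |d_k|^2] is integrable, hence finite a.e. *)
Lemma L2_cauchy_subsequence (u : nat -> T -> Rcomplex R) :
  (forall n, L2 mu (u n)) -> L2_cauchy u ->
  exists (s : nat -> nat) (l : T -> Rcomplex R),
    [/\ forall k, (k <= s k)%N, cmeasurable l & ae_cvg (fun k => u (s k)) l].
Proof.
move=> Lu cu.
have four0 k : 0 < (4^-1 : R) ^+ k by rewrite exprn_gt0.
have [N HN] := choice (fun k => cu _ (four0 k)).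
(* A single formula guarantees [s k >= k], [s k >= N k] and [s k.+1 >= N k]; the last two put both
   indices of the increment [dl k] beyond [N k]. *)
pose s k := (k + \sum_(i < k.+1) N i)%N.
have sk k : (k <= s k)%N by exact: leq_addr.
have Ns k : (N k <= s k)%N.
  by rewrite /s big_ord_recr/= (leq_trans (leq_addl _ _) (leq_addl _ _)).
have Ns' k : (N k <= s k.+1)%N.
  rewrite /s big_ord_recr/= (leq_trans _ (leq_addl _ _))//.
  by rewrite (leq_trans _ (leq_addr _ _))// big_ord_recr/= leq_addl.
pose dl k := u (s k.+1) - u (s k).
have Ldl k : L2 mu (dl k) by exact: L2B.
have dle k : (\int[mu]_x (sqn (dl k x))%:E <= ((4^-1) ^+ k)%:E)%E.
  by rewrite -ip_sqnE// lee_fin HN.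
pose G k x := (2 ^+ k * sqn (dl k x))%:E.
have mdl k : measurable_fun setT (fun x => sqn (dl k x)).
  by have /L2P[mk _] := Ldl k; exact: cmeasurable_sqn.
have mG k : measurable_fun setT (G k).
  by apply/measurable_EFinP; exact: measurable_funM.
have G0 k x : (0 <= G k x)%E by rewrite lee_fin mulr_ge0 ?sqn_ge0.
have Gint k : (\int[mu]_x G k x <= ((2^-1) ^+ k)%:E)%E.
  rewrite /G; under eq_integral do rewrite EFinM.
  rewrite ge0_integralZl//; last 2 first.
  - exact/measurable_EFinP.
  - by move=> x _; rewrite lee_fin sqn_ge0.
  apply: (@le_trans _ _ ((2 ^+ k)%:E * ((4^-1) ^+ k)%:E)%E).
    by rewrite lee_wpmul2l ?lee_fin ?exprn_ge0.
  by rewrite -EFinM lee_fin -exprMn (_ : 2 / 4 = 2^-1 :> R)//; field.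
pose S x := (\sum_(k <oo) G k x)%E.
have mS : measurable_fun setT S by exact: ge0_emeasurable_sum.
have S0 x : (0 <= S x)%E by exact: nneseries_ge0.
have Sint : (\int[mu]_x S x < +oo)%E.
  rewrite integral_nneseries//.
  apply: (@le_lt_trans _ _ 2%:E); last exact: ltry.
  apply: lime_le; first by apply: is_cvg_nneseries => k _ _; exact: integral_ge0.
  apply: nearW => n; apply: (@le_trans _ _ (\sum_(0 <= k < n) ((2^-1) ^+ k)%:E)%E).
    by apply: lee_sum => k _; exact: Gint.
  rewrite sumEFin lee_fin.
  have -> : \sum_(0 <= k < n) (2^-1 : R) ^+ k = 2 - 2 * (2^-1) ^+ n.
    elim: n => [|n IH]; first by rewrite big_nil expr0; ring.
    by rewrite big_nat_recr//= IH exprS; field.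
  by rewrite gerBl mulr_ge0// exprn_ge0// invr_ge0.
pose E := [set x | (S x < +oo)%E].
have mE : measurable E.
  by rewrite -[E]setTI; apply: emeasurable_fun_infty_o.
have aeE : {ae mu, forall x, E x}.
  have SI : mu.-integrable setT S.
    apply/integrableP; split => //.
    by under eq_integral do rewrite gee0_abs//.
  apply: filterS (integrable_ae measurableT SI) => x /(_ I) /fin_numPlt.
  by move=> /andP[].
have cvE (p : R[i] -> R) x : (forall z w, p (z + w) = p z + p w) ->
    (forall z, p (- z) = - p z) -> (forall z, p z ^+ 2 <= sqn z) ->
    E x -> cvgn (fun k => p (u (s k) x)).
  move=> pD pN psq Ex.
  have Sfin : S x \is a fin_num by rewrite ge0_fin_numE.
  apply: (@cvg_fast_increments _ (fine (S x))) => k.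
  rewrite -lee_fin fineK//; apply: (@le_trans _ _ (G k x)).
    rewrite lee_fin ler_wpM2l ?exprn_ge0//.
    by rewrite -pN -pD psq.
  rewrite (le_trans _ (nneseries_lim_ge k.+1 _))//.
  by rewrite big_nat_recr//= leeDr// sume_ge0.
have lim_part (p : R[i] -> R) : (forall k, measurable_fun setT (p \o u (s k))) ->
    (forall x, E x -> cvgn (fun k => p (u (s k) x))) ->
    exists2 l : T -> R, measurable_fun setT l &
      forall x, E x -> p (u (s k) x) @[k --> \oo] --> l x.
  (* Cutting off outside [E] makes the sequence converge everywhere, so that its limit is a
     measurable function on the whole space. *)
  move=> mp cp; pose h k x := \1_E x * p (u (s k) x).
  exists (fun x => limn (h ^~ x)).
    apply: (@measurable_fun_cvg _ _ _ _ h).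
      by move=> k; apply: measurable_funM => //; exact: mp.
    move=> x _; have [Ex|nEx] := pselect (E x).
      have hE : h ^~ x = (fun k => p (u (s k) x)).
        by apply/funext => k; rewrite /h indicE mem_set// mul1r.
      by rewrite hE; exact: cp.
    have hE : h ^~ x = (fun k => 0).
      by apply/funext => k; rewrite /h indicE memNset// mul0r.
    by rewrite hE; exact: is_cvg_cst.
  move=> x Ex.
  have hE : h ^~ x = (fun k => p (u (s k) x)).
    by apply/funext => k; rewrite /h indicE mem_set// mul1r.
  by rewrite hE; exact: cp.
have mu' k : cmeasurable (u (s k)) by have /L2P[] := Lu (s k).
have [lR mlR clR] : exists2 l : T -> R, measurable_fun setT l &
    forall x, E x -> Re (u (s k) x) @[k --> \oo] --> l x.
  apply: lim_part => [k|x]; first by case: (mu' k).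
  apply: cvE => [||z]; [exact: cReD|exact: cReN|by rewrite lerDl sqr_ge0].
have [lI mlI clI] : exists2 l : T -> R, measurable_fun setT l &
    forall x, E x -> Im (u (s k) x) @[k --> \oo] --> l x.
  apply: lim_part => [k|x]; first by case: (mu' k).
  apply: cvE => [||z]; [exact: cImD|exact: cImN|by rewrite lerDr sqr_ge0].
exists s, (fun x => lR x +i* lI x); split => //.
by apply: filterS aeE => x Ex; split; [exact: clR|exact: clI].
Qed.

Lemma cmeasurableB f g : cmeasurable f -> cmeasurable g ->
  cmeasurable ((f : T -> Rcomplex R) - g).
Proof.
move=> [fR fI] [gR gI]; split.
  have -> : Re \o (f - g) = (Re \o f) \- (Re \o g).
    by apply/funext => x /=; rewrite cReD cReN.
  exact: measurable_funB.
have -> : Im \o (f - g) = (Im \o f) \- (Im \o g).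
  by apply/funext => x /=; rewrite cImD cImN.
exact: measurable_funB.
Qed.

Lemma cvg_sqnB (v : nat -> Rcomplex R) (l z : Rcomplex R) :
  Re (v n) @[n --> \oo] --> Re l -> Im (v n) @[n --> \oo] --> Im l ->
  sqn (z - v n) @[n --> \oo] --> sqn (z - l).
Proof.
move=> vR vI; rewrite /sqn !cReD !cReN !cImD !cImN.
under eq_fun do rewrite cReD cReN cImD cImN.
by apply: cvgD; apply: (@cvgM _ _ _ _ _ _ _ _ _) => //; apply: cvgB => //; exact: cvg_cst.
Qed.

(** Fatou's lemma along the subsequence bounds [|u n - l|] by the Cauchy estimate. The a.e. limit
    [l] is an argument rather than a conclusion, so that the limit of gradients can be prescribed to
    be the gradient of a limit already found. *)
Lemma L2_limit (u : nat -> T -> Rcomplex R) (s : nat -> nat) (l : T -> Rcomplex R) :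
  (forall n, L2 mu (u n)) -> L2_cauchy u -> (forall k, (k <= s k)%N) ->
  cmeasurable l -> ae_cvg (fun k => u (s k)) l ->
  L2 mu l /\ forall e, 0 < e -> exists N, forall n, (N <= n)%N ->
    ip (u n - l) (u n - l) <= e.
Proof.
move=> Lu cu sk ml ul.
have mu' k : cmeasurable (u k) by have /L2P[] := Lu k.
have bound e : 0 < e -> exists N, forall n, (N <= n)%N ->
    (\int[mu]_x (sqn ((u n - l) x))%:E <= e%:E)%E.
  move=> e0; have [N HN] := cu e e0; exists N => n Nn.
  apply: (@fatou_ae (fun k x => sqn ((u n - u (s (k + N)%N)) x))).
  - by move=> k; apply/cmeasurable_sqn/cmeasurableB.
  - exact/cmeasurable_sqn/cmeasurableB.
  - by move=> k x; exact: sqn_ge0.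
  - by move=> x; exact: sqn_ge0.
  - apply: filterS ul => x [uR uI].
    have h := cvg_sqnB (z := u n x) uR uI.
    by rewrite -(cvg_shiftn N) in h.
  - move=> k; rewrite -ip_sqnE; last exact: L2B.
    by rewrite lee_fin HN// (leq_trans _ (sk _))// leq_addl.
have L2ul : exists n, L2 mu (u n - l).
  have [N HN] := bound 1 ltr01; exists N; apply/L2P; split; first exact: cmeasurableB.
  by rewrite (le_lt_trans (HN N (leqnn N)))// ltry.
have Ll : L2 mu l.
  have [n Ln] := L2ul; have := L2B (Lu n) Ln.
  by rewrite opprB addrC subrK.
split => // e /bound [N HN]; exists N => n Nn.
by rewrite -lee_fin ip_sqnE ?HN//; exact: L2B.
Qed.

Definition L2_pred := SubspacePred (L2_subspace mu).
Definition L2_type := subspace_type L2_pred.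

Lemma L2_val (x : L2_type) : L2 mu (val x).
Proof. exact: (subspaceP (W := L2_pred) x). Qed.

Definition L2_ip (x y : L2_type) := ip (val x) (val y).

Lemma L2_semi_hilbert : semi_hilbert L2_ip.
Proof.
split=> [x y|a x y z|x|u cu].
- exact: ipC_L2.
- by apply: ip_linear_L2; exact: L2_val.
- by rewrite /L2_ip ip_sqn; apply: Rintegral_ge0 => t _; exact: sqn_ge0.
- have Lu n : L2 mu (val (u n)) by exact: L2_val.
  have [s [l [sk ml ul]]] := L2_cauchy_subsequence Lu cu.
  have [Ll lim] := L2_limit Lu cu sk ml ul.
  by exists (subspace_sub (W := L2_pred) Ll).
Qed.

End limits.

(** * The form and its operator *)

Section multiplication_by_i.
Context d (T : measurableType d) (R : realType) (mu : {measure set T -> \bar R}).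
Local Notation Re := (@complex.Re _).
Local Notation Im := (@complex.Im _).
Implicit Types f g : T -> Rcomplex R.
Local Notation ip := (ip mu).

Definition imul f : T -> Rcomplex R := fun x => - Im (f x) +i* Re (f x).

Lemma ip_imull f g : ip (imul f) g = Im (inner mu f g).
Proof. by apply: eq_Rintegral => x _; rewrite Re_conjM Im_conjM /=; ring. Qed.

Lemma L2_imul f : L2 mu f -> L2 mu (imul f).
Proof.
move=> /L2P[[mR mI] fi]; apply/L2P; split.
  by split => //=; exact: measurableT_comp.
rewrite (eq_integral (fun x => (sqn (f x))%:E))// => x _.
by rewrite /sqn /= sqrrN addrC.
Qed.

Lemma imul_linear a f g : imul (a *: f + g) = a *: imul f + imul g.
Proof.
apply/funext => x; rewrite /imul.
change ((a *: f + g) x) with (a *: f x + g x).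
change ((a *: _ + _) x) with (a *: ((- Im (f x) +i* Re (f x)) : Rcomplex R) +
  (- Im (g x) +i* Re (g x))).
by case: (f x) => f1 f2; case: (g x) => g1 g2; congr Complex; rewrite /= ?opprD ?mulrN.

Qed.

Lemma imulK f : imul (imul f) = - f.
Proof.
apply/funext => x; rewrite /imul /=; change ((- f) x) with (- f x).
by case: (f x).
Qed.

Lemma ip_imul_skew f g : L2 mu f -> L2 mu g -> ip (imul f) g = - ip f (imul g).
Proof.
move=> Lf Lg; have [_ i1] := L2_integrable Lf Lg.
rewrite -mulN1r -RintegralZl//=; last first.
  have [+ _] := L2_integrable Lf (L2_imul Lg).
  by [].
by apply: eq_Rintegral => x _; rewrite !Re_conjM /=; ring.
Qed.

Lemma ip_ge0_L2 f : 0 <= ip f f.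
Proof. by rewrite ip_sqn; apply: Rintegral_ge0 => t _; exact: sqn_ge0. Qed.

(** The real and imaginary parts are the real inner products of [f] and [imul f] with [g];
    Cauchy-Schwarz for each gives the crude factor 2. *)
Lemma normc_inner f g : L2 mu f -> L2 mu g ->
  normc (inner mu f g) <= 2 * l2norm mu g * l2norm mu f.
Proof.
move=> Lf Lg; have bH := L2_semi_hilbert mu.
have cs h : L2 mu h -> `|ip h g| <= l2norm mu h * l2norm mu g.
  move=> Lh; rewrite !l2normE.
  exact: (cauchy_schwarz bH (subspace_sub (W := L2_pred mu) Lh)
    (subspace_sub (W := L2_pred mu) Lg)).
have h1 := cs f Lf; have h2 := cs _ (L2_imul Lf).
have l2i : l2norm mu (imul f) = l2norm mu f.
  congr Num.sqrt; apply: eq_Rintegral => x _.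
  by rewrite !normc_sqr /= sqrrN addrC.
rewrite l2i ip_imull in h2.
have : normc (inner mu f g) <= `|Re (inner mu f g)| + `|Im (inner mu f g)|.
  rewrite -(@ler_pXn2r _ 2) ?nnegrE ?addr_ge0//; last first.
    by case: (inner _ _ _) => ? ?; exact: sqrtr_ge0.
  rewrite normc_sqr -(real_normK (num_real (Re _))) -(real_normK (num_real (Im _))).
  rewrite sqrrD lerD2r lerDl.
  by rewrite mulrn_wge0// mulr_ge0.
move: h1 h2; rewrite /ip; move: (normc _) (l2norm _ _) (l2norm _ _) => *; nra.
Qed.

End multiplication_by_i.

Section product_negligible.
Context d (T : measurableType d) (R : realType) (mu : {sigma_finite_measure set T -> \bar R}).

Lemma ae_product (P : T -> Prop) : {ae mu, forall x, P x} ->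
  {ae (mu \x mu)%E, forall p : T * T, P p.1 /\ P p.2}.
Proof.
move=> [N [mN N0 NP]].
exists ((N `*` setT) `|` (setT `*` N)); split.
- by apply: measurableU; exact: measurableX.
- have e1 : (mu \x mu)%E (N `*` setT) = 0%E.
    by transitivity (mu N * mu setT)%E; [exact: product_measure1E|rewrite N0 mul0e].
  have e2 : (mu \x mu)%E (setT `*` N) = 0%E.
    by transitivity (mu setT * mu N)%E; [exact: product_measure1E|rewrite N0 mule0].
  apply/eqP; rewrite eq_le measure_ge0 andbT.
  apply: (@le_trans _ _ ((mu \x mu)%E (N `*` setT) + (mu \x mu)%E (setT `*` N))%E).
    by apply: measureU2; exact: measurableX.
  by rewrite e1 e2 adde0.
- move=> [x y] /= /not_andP[nP|nP]; [left|right]; split => //; exact: NP.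
Qed.

End product_negligible.

(** * The form and its closedness *)

Section forms.
Context d (T : measurableType d) (R : realType).
Variable mu : {sigma_finite_measure set T -> \bar R}.
Variable k : T -> T -> R.
Hypothesis k_ge0 : forall u v, 0 <= k u v.
Hypothesis k_measurable : measurable_fun setT (fun p : T * T => k p.1 p.2).
Local Notation Re := (@complex.Re _).
Local Notation Im := (@complex.Im _).
Local Notation mu2 := (mu \x mu)%E.
Implicit Types (f g : T -> Rcomplex R).

(* The form is [1/2] of the inner product of the gradients. *)
Definition gradient f : T * T -> Rcomplex R :=
  fun p => Num.sqrt (k p.1 p.2) *: (f p.1 - f p.2 : Rcomplex R).

Lemma Re_gradient f p : Re (gradient f p) = Num.sqrt (k p.1 p.2) * (Re (f p.1) - Re (f p.2)).
Proof. by rewrite /gradient cReZ cReD cReN. Qed.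

Lemma Im_gradient f p : Im (gradient f p) = Num.sqrt (k p.1 p.2) * (Im (f p.1) - Im (f p.2)).
Proof. by rewrite /gradient cImZ cImD cImN. Qed.

Lemma complexP (z w : R[i]) : Re z = Re w -> Im z = Im w -> z = w.
Proof. by case: z w => [a b] [a' b'] /= -> ->. Qed.

Lemma gradient_linear a f g : gradient (a *: f + g) = a *: gradient f + gradient g.
Proof.
apply/funext => p; apply: complexP.
  by rewrite !(cReD, cReZ, cReN); ring.
by rewrite !(cImD, cImZ, cImN); ring.
Qed.

Lemma gradient_imul f : gradient (imul f) = imul (gradient f).
Proof.
apply/funext => p; apply: complexP.
  by rewrite Re_gradient /= Im_gradient; ring.
by rewrite Im_gradient /= Re_gradient.
Qed.

Lemma cmeasurable_gradient f : cmeasurable f -> cmeasurable (gradient f).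
Proof.
move=> [mR mI].
have ms : measurable_fun setT (fun p : T * T => Num.sqrt (k p.1 p.2)).
  apply: measurableT_comp k_measurable.
  by apply: continuous_measurable_fun; exact: sqrt_continuous.
split.
  rewrite (_ : _ \o _ = fun p : T * T => Num.sqrt (k p.1 p.2) * (Re (f p.1) - Re (f p.2))).
    apply: measurable_funM => //; apply: measurable_funB.
      exact: (measurableT_comp mR measurable_fst).
    exact: (measurableT_comp mR measurable_snd).
  by apply/funext => p; exact: Re_gradient.
rewrite (_ : _ \o _ = fun p : T * T => Num.sqrt (k p.1 p.2) * (Im (f p.1) - Im (f p.2))).
  apply: measurable_funM => //; apply: measurable_funB.
    exact: (measurableT_comp mI measurable_fst).
  exact: (measurableT_comp mI measurable_snd).
by apply/funext => p; exact: Im_gradient.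
Qed.

Lemma sqn_gradient f p : sqn (gradient f p) = k p.1 p.2 * normc (f p.1 - f p.2) ^+ 2.
Proof.
rewrite /sqn Re_gradient Im_gradient normc_sqr !(cReD, cImD, cReN, cImN) !exprMn.
by rewrite sqr_sqrtr//; ring.
Qed.

Lemma form_domainP f : form_domain mu k f <-> L2 mu f /\ L2 mu2 (gradient f).
Proof.
have E : (\int[mu2]_p (k p.1 p.2 * normc (f p.1 - f p.2) ^+ 2)%:E =
    \int[mu2]_p (sqn (gradient f p))%:E)%E.
  by apply: eq_integral => p _; rewrite sqn_gradient.
split=> [[Lf fi]|[Lf /L2P[_ fi]]]; split => //; last by rewrite E.
apply/L2P; split; last by rewrite -E.
by apply: cmeasurable_gradient; case/L2P: Lf.
Qed.

Lemma dformE f g : dform mu k f g = (2^-1)%:C * inner mu2 (gradient f) (gradient g).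
Proof.
congr (_ * Complex _ _); apply: eq_Rintegral => p _.
  rewrite Re_conjM Re_gradient Im_gradient Re_gradient Im_gradient.
  rewrite (cReM (k p.1 p.2)%:C) /= Re_conjM !(cReD, cImD, cReN, cImN).
  by rewrite mul0r subr0 -{1}(sqr_sqrtr (k_ge0 p.1 p.2)); ring.
rewrite Im_conjM Re_gradient Im_gradient Re_gradient Im_gradient.
rewrite (cImM (k p.1 p.2)%:C) /= Im_conjM !(cReD, cImD, cReN, cImN).
by rewrite mul0r addr0 -{1}(sqr_sqrtr (k_ge0 p.1 p.2)); ring.
Qed.

Definition dip f g := 2^-1 * ip mu2 (gradient f) (gradient g).

Lemma Re_dform f g : Re (dform mu k f g) = dip f g.
Proof. by rewrite dformE cReM /= mul0r subr0. Qed.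

Lemma Im_dform f g : Im (dform mu k f g) = dip (imul f) g.
Proof. by rewrite dformE cImM /= mul0r addr0 /dip gradient_imul ip_imull. Qed.

Local Notation dom := (form_domain mu k).

Lemma form_domain_subspace : linear_subspace (dom : (T -> Rcomplex R) -> Prop).
Proof.
split.
  apply/form_domainP; split; first by case: (L2_subspace mu).
  have -> : gradient 0 = 0.
    by have := gradient_linear (-1) 0 0; rewrite !scaleN1r !addNr.
  by case: (L2_subspace mu2).
move=> a f g /form_domainP[Lf Gf] /form_domainP[Lg Gg]; apply/form_domainP; split.
  by case: (L2_subspace mu) => _; exact.
by rewrite gradient_linear; case: (L2_subspace mu2) => _; exact.
Qed.

Definition form_pred := SubspacePred form_domain_subspace.
Definition form_type := subspace_type form_pred.

Lemma form_val (x : form_type) : dom (val x).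
Proof. exact: (subspaceP (W := form_pred) x). Qed.

Definition form_ip (x y : form_type) := dip (val x) (val y) + ip mu (val x) (val y).

Lemma dip_linear a f g h : dom f -> dom g -> dom h ->
  dip (a *: f + g) h = a * dip f h + dip g h.
Proof.
move=> /form_domainP[_ Gf] /form_domainP[_ Gg] /form_domainP[_ Gh].
by rewrite /dip gradient_linear ip_linear_L2//; ring.
Qed.

Lemma dipC f g : dip f g = dip g f.
Proof. by rewrite /dip ipC_L2. Qed.

Lemma dip_ge0 f : 0 <= dip f f.
Proof. by rewrite mulr_ge0// ip_ge0_L2. Qed.

Lemma dip_imul_skew f g : dom f -> dom g -> dip (imul f) g = - dip f (imul g).
Proof.
move=> /form_domainP[_ Gf] /form_domainP[_ Gg].
by rewrite /dip !gradient_imul ip_imul_skew// mulrN.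
Qed.

Lemma form_domain_imul f : dom f -> dom (imul f).
Proof.
move=> /form_domainP[Lf Gf]; apply/form_domainP; split; first exact: L2_imul.
by rewrite gradient_imul; exact: L2_imul.
Qed.

(** Completeness is the closedness of the form. A Cauchy sequence has an a.e. convergent
    subsequence; off a null set of the product the gradients converge along the same subsequence to
    the gradient of its limit, which must then be their L2 limit. *)
Lemma form_semi_hilbert : semi_hilbert form_ip.
Proof.
split=> [x y|a x y z|x|u cu].
- by rewrite /form_ip dipC ipC_L2.
- have [[Lx _] [Ly _] [Lz _]] := And3 (form_val x) (form_val y) (form_val z).
  rewrite /form_ip dip_linear ?ip_linear_L2//; try exact: form_val.
  by ring.
- by rewrite addr_ge0 ?dip_ge0 ?ip_ge0_L2.
pose v n := val (u n).
have Lv n : L2 mu (v n) by case: (form_val (u n)).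
have Gv n : L2 mu2 (gradient (v n)) by have /form_domainP[] := form_val (u n).
have gB f g : gradient (f - g) = gradient f - gradient g.
  have -> : f - g = (-1) *: g + f by rewrite scaleN1r addrC.
  by rewrite gradient_linear scaleN1r addrC.
have cv : L2_cauchy mu v.
  move=> e /cu[N HN]; exists N => m n Nm Nn; apply: le_trans (HN m n Nm Nn).
  by rewrite lerDr dip_ge0.
have cG : L2_cauchy mu2 (fun n => gradient (v n)).
  move=> e e0; have [|N HN] := cu (e / 2); first by rewrite divr_gt0.
  exists N => m n Nm Nn; have := HN m n Nm Nn.
  have : 0 <= ip mu (v m - v n) (v m - v n) by exact: ip_ge0_L2.
  rewrite /form_ip /dip -gB -/(v m) -/(v n).
  change (val (u m - u n)) with (v m - v n).
  by move: (ip mu2 _ _) (ip mu _ _) => *; lra.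
have [s [l [sk ml vl]]] := L2_cauchy_subsequence Lv cv.
have [Ll liml] := L2_limit Lv cv sk ml vl.
have Gl : ae_cvg mu2 (fun n => gradient (v (s n))) (gradient l).
  apply: filterS (ae_product vl) => p [[R1 I1] [R2 I2]].
  split.
    rewrite Re_gradient; under eq_fun do rewrite Re_gradient.
    by apply: cvgM; [exact: cvg_cst|exact: cvgB].
  rewrite Im_gradient; under eq_fun do rewrite Im_gradient.
  by apply: cvgM; [exact: cvg_cst|exact: cvgB].
have [LGl limG] := L2_limit Gv cG sk (cmeasurable_gradient ml) Gl.
have Dl : dom l by apply/form_domainP.
exists (subspace_sub (W := form_pred) Dl) => e e0.
have [N2 H2] := limG e e0.
have e20 : 0 < e / 2 by rewrite divr_gt0.
have [N1 H1] := liml _ e20.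
exists (maxn N1 N2) => n; rewrite geq_max => /andP[/H1 n1 /H2 n2].
rewrite /form_ip /dip; change (val (u n - _)) with (v n - l).
by rewrite gB; move: n1 n2; move: (ip mu2 _ _) (ip mu _ _) => *; lra.
Qed.

End forms.

Lemma cvg_at_right0P (R : realType) (F : R -> R) : (forall t, 0 <= F t) ->
  F t @[t --> 0^'+] --> (0 : R) <->
  (forall r, 0 < r -> exists2 d, 0 < d & forall t, 0 < t -> t < d -> F t <= r).
Proof.
move=> F0; split=> [/cvgrPdist_le FF r /FF|FF].
  move=> [d /= d0 H]; exists d => // t t0 td.
  have := H t; rewrite /= sub0r normrN gtr0_norm// => /(_ td t0).
  by rewrite sub0r normrN ger0_norm.
apply/cvgrPdist_le => r /FF[d d0 H]; exists d => //= t.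
rewrite /ball_ /= sub0r normrN => td t0.
by rewrite sub0r normrN ger0_norm// H// -[t]gtr0_norm.
Qed.

Section null_classes.
Context d (T : measurableType d) (R : realType) (mu : {measure set T -> \bar R}).
Local Notation Re := (@complex.Re _).
Local Notation Im := (@complex.Im _).

Lemma L2_nullP (x y : L2_type mu) :
  nrm (@L2_ip _ _ _ mu) (x - y) = 0 <-> val x = val y %[ae mu].
Proof.
pose f := val x - val y.
have Lf : L2 mu f by exact: (L2_val (x - y)).
have mf : measurable_fun setT (fun t => (sqn (f t))%:E).
  by apply/measurable_EFinP/cmeasurable_sqn; case/L2P: Lf.
have sq0 (z w : R[i]) : sqn (z - w) = 0 <-> z = w.
  split=> [|->]; last by rewrite subrr /sqn /= expr0n addr0.
  rewrite /sqn !cReD !cImD !cReN !cImN => /eqP.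
  rewrite paddr_eq0 ?sqr_ge0// !sqrf_eq0 !subr_eq0 => /andP[/eqP h1 /eqP h2].
  exact: complexP.
have absE : (\int[mu]_t `|(sqn (f t))%:E| = (nrm (@L2_ip _ _ _ mu) (x - y) ^+ 2)%:E)%E.
  rewrite (sqr_nrm (L2_semi_hilbert mu)) /L2_ip ip_sqnE//.
  by apply: eq_integral => t _; rewrite gee0_abs// lee_fin sqn_ge0.
split=> [h|h].
  have /(ae_eq_integral_abs mu measurableT mf) : (\int[mu]_t `|(sqn (f t))%:E| = 0)%E.
    by rewrite absE h expr0n.
  move=> h0; apply: filterS h0 => t + _ => /(_ I) [] /sq0.
  by [].
have /(ae_eq_integral_abs mu measurableT mf) : ae_eq mu setT (fun t => (sqn (f t))%:E) (cst 0%E).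
  by apply: filterS h => t ht _; congr EFin; apply/sq0; exact: ht.
rewrite absE => -[] /eqP.
by rewrite sqrf_eq0 => /eqP.
Qed.

End null_classes.

(** * The self-adjoint operator of the form *)

Section form_operator_theory.
Context d (T : measurableType d) (R : realType).
Variable mu : {sigma_finite_measure set T -> \bar R}.
Variable k : T -> T -> R.
Hypothesis k_ge0 : forall u v, 0 <= k u v.
Hypothesis k_measurable : measurable_fun setT (fun p : T * T => k p.1 p.2).
Local Notation Re := (@complex.Re _).
Local Notation Im := (@complex.Im _).
Local Notation dom := (form_domain mu k).
Local Notation ip := (ip mu).
Local Notation dip := (dip mu k).
Local Notation b := (@L2_ip _ _ _ mu).
Local Notation H := (L2_type mu).
Implicit Types (f g : T -> Rcomplex R) (x y : H).

Let bH : semi_hilbert b. Proof. exact: L2_semi_hilbert. Qed.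

Definition L2_sub f (Lf : L2 mu f) : H := subspace_sub (W := L2_pred mu) Lf.

(** The real identity for [phi] and for [imul phi] gives both parts of the complex one. The
    continuity constant in the operator domain then follows from the square integrability of [f] and
    [g]. *)
Lemma form_operatorP f g : form_operator mu k f g <->
  [/\ dom f, L2 mu g & forall phi, dom phi -> ip phi g = dip phi f].
Proof.
split=> [[[df _] Lg fg]|[df Lg fg]].
  split => // phi dphi; have := fg phi dphi.
  by rewrite /Defs.form addrK -(Re_dform mu k_ge0) => <-.
have innerE phi : dom phi -> inner mu phi g = dform mu k phi f.
  move=> dphi; apply: complexP; first by rewrite (Re_dform mu k_ge0) -fg.
  by rewrite (Im_dform mu k_ge0) -fg ?ip_imull//; exact: form_domain_imul.
split => //; last by move=> phi dphi; rewrite /Defs.form addrK innerE.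
split => //; exists (2 * l2norm mu g + 2 * l2norm mu f) => phi dphi.
rewrite /Defs.form -(innerE phi dphi) (le_trans (le_normcD _ _))// mulrDl.
by case: dphi => Lphi _; case: df => Lf _; rewrite lerD ?normc_inner.
Qed.

Definition form_rel x y := form_operator mu k (val x) (val y).

Definition imul_L2 x : H := L2_sub (L2_imul (L2_val x)).

Lemma imul_L2_linear a x y : imul_L2 (a *: x + y) = a *: imul_L2 x + imul_L2 y.
Proof. by apply: val_inj; exact: imul_linear. Qed.

Lemma imul_L2K x : imul_L2 (imul_L2 x) = - x.
Proof. by apply: val_inj; exact: imulK. Qed.

Lemma imul_L2_skew x y : b (imul_L2 x) y = - b x (imul_L2 y).
Proof. by apply: ip_imul_skew; exact: L2_val. Qed.

Lemma form_rel_linear a x y x' y' : form_rel x y -> form_rel x' y' ->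
  form_rel (a *: x + x') (a *: y + y').
Proof.
move=> /form_operatorP[dx Ly xy] /form_operatorP[dx' Ly' xy'].
apply/form_operatorP; split.
- by case: (form_domain_subspace mu k_ge0 k_measurable) => _; exact.
- by case: (L2_subspace mu) => _; exact.
move=> phi dphi; have [Lphi _] := dphi.
rewrite ipC_L2 ip_linear_L2// ipC_L2 xy// (ipC_L2 mu (val y')) xy'//.
by rewrite [RHS]dipC dip_linear// !(dipC mu k _ phi).
Qed.

Lemma form_rel0 : form_rel 0 0.
Proof.
apply/form_operatorP; split; first by case: (form_domain_subspace mu k_ge0 k_measurable).
  by case: (L2_subspace mu).
move=> phi dphi; have d0 : dom (0 : T -> Rcomplex R).
  by case: (form_domain_subspace mu k_ge0 k_measurable).
have := dip_linear k_ge0 k_measurable (-1) d0 d0 dphi; rewrite scaleN1r addNr.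
rewrite [X in _ = X -> _](_ : _ = 0); last by ring.
move=> h; rewrite dipC h.
have L0 : L2 mu (0 : T -> Rcomplex R) by case: (L2_subspace mu).
have [Lphi _] := dphi.
have := ip_linear_L2 (-1) L0 L0 Lphi; rewrite scaleN1r addNr ipC_L2 => h'.
by move: h'; move: (ip _ _) => *; lra.
Qed.

Lemma form_rel_imul x y : form_rel x y -> form_rel (imul_L2 x) (imul_L2 y).
Proof.
move=> /form_operatorP[dx Ly xy]; apply/form_operatorP; split.
- exact: form_domain_imul.
- exact: L2_imul.
move=> phi dphi; have [Lphi _] := dphi; have dip' := form_domain_imul k_ge0 k_measurable dphi.
have h1 := ip_imul_skew Lphi Ly; have h2 := dip_imul_skew k_ge0 k_measurable dphi dx.
have h3 := xy _ dip'.
change (ip phi (imul (val y)) = dip phi (imul (val x))).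
by move: h1 h2 h3; move: (ip _ _) (ip _ _) (dip _ _) (dip _ _) => *; lra.
Qed.

Lemma form_rel_dip x y x' y' : form_rel x y -> form_rel x' y' ->
  b x y' = dip (val x) (val x').
Proof. by move=> /form_operatorP[dx _ _] /form_operatorP[_ _]; apply. Qed.

Lemma form_rel_sym x y x' y' : form_rel x y -> form_rel x' y' -> b x y' = b y x'.
Proof.
move=> xy xy'; rewrite (form_rel_dip xy xy') (ipC bH y).
by rewrite (form_rel_dip xy' xy) dipC.
Qed.

Lemma form_rel_ge0 x y : form_rel x y -> 0 <= b x y.
Proof. by move=> xy; rewrite (form_rel_dip xy xy) dip_ge0. Qed.

(* [h - r] with [r] representing [phi |-> (phi, h)] in the form domain. *)
Lemma form_rel_onto h : exists x y, form_rel x y /\ nrm b (x + y - h) = 0.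
Proof.
have QH := form_semi_hilbert mu k_ge0 k_measurable.
pose q := @form_ip _ _ _ mu _ k_ge0 k_measurable.
pose E := form_type mu k_ge0 k_measurable.
have Ev (x : E) : dom (val x) := form_val x.
pose l (x : E) := ip (val x) (val h).
have [| |r lr] := @riesz_representation R E q QH l (nrm b h).
- by move=> a x y; rewrite /l ip_linear_L2//; [case: (Ev x)|case: (Ev y)|exact: L2_val].
- move=> x; have [Lx _] := Ev x.
  rewrite mulrC (le_trans (cauchy_schwarz bH (L2_sub Lx) h))// ler_wpM2r ?nrm_ge0//.
  by rewrite ler_wsqrtr// /q /form_ip lerDr dip_ge0.
have [Lr _] := Ev r.
exists (L2_sub Lr), (h - L2_sub Lr); split; last first.
  by rewrite (addrC (L2_sub Lr)) subrK subrr (nrm0 bH).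
apply/form_operatorP; split; [exact: Ev|exact: (L2_val (h - L2_sub Lr))|].
move=> phi dphi; have [Lphi _] := dphi.
have := lr (subspace_sub (W := form_pred mu k_ge0 k_measurable) dphi).
rewrite /l /q /form_ip /= => h1.
have h2 := ipDr bH h (- L2_sub Lr) (L2_sub Lphi); rewrite (ipNr bH) in h2.
move: h1 h2; rewrite /L2_ip /=.
by move: (ip _ _) (ip _ _) (ip _ _) (dip _ _) => *; lra.
Qed.

Hypothesis mu_fin : (mu setT < +oo)%E.
Hypothesis mu_gt0 : (0 < mu setT)%E.

Lemma L2_cst (c : R[i]) : L2 mu (cst c).
Proof.
apply/L2P; split; first by split; exact: measurable_cst.
have -> : (\int[mu]_x (sqn (cst c x))%:E = \int[mu]_x cst (sqn c)%:E x)%E by [].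
by rewrite (integral_cst mu measurableT) lte_mul_pinfty// lee_fin sqn_ge0.
Qed.

Definition L2_one : H := L2_sub (L2_cst 1).

Lemma form_rel_cst (c : R[i]) : form_operator mu k (cst c) (cst 0).
Proof.
have g0 : gradient k (cst c) = 0.
  by apply/funext => p; apply: complexP; rewrite ?Re_gradient ?Im_gradient subrr mulr0.
have L0 : L2 (mu \x mu)%E (0 : _ -> Rcomplex R) by case: (L2_subspace (mu \x mu)%E).
apply/form_operatorP; split; last 1 first.
- move=> phi dphi; have [Lphi Gphi] := (form_domainP mu k_ge0 k_measurable phi).1 dphi.
  rewrite /dip g0.
  have -> : ip phi (cst 0) = 0 by exact: (ip0r bH (L2_sub Lphi)).
  rewrite [X in _ * X](_ : _ = 0) ?mulr0//.
  exact: (ip0r (L2_semi_hilbert (mu \x mu)%E)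
    (subspace_sub (W := L2_pred (mu \x mu)%E) Gphi)).
- by apply/form_domainP => //; rewrite g0; split => //; exact: L2_cst.
- exact: L2_cst.
Qed.

Lemma L2_one_gt0 : 0 < b L2_one L2_one.
Proof.
rewrite -lte_fin /L2_ip ip_sqnE; last exact: L2_cst.
have -> : (\int[mu]_x (sqn (val L2_one x))%:E = \int[mu]_x cst 1%:E x)%E.
  by apply: eq_integral => x _; rewrite /sqn /= expr1n expr0n addr0.
by rewrite (integral_cst mu measurableT) mul1e.
Qed.

Variable lam : R.
Hypothesis lam_gt0 : 0 < lam.
Hypothesis gap : forall f, dom f -> ip (cst 1) f = 0 -> ip (imul (cst 1)) f = 0 ->
  lam * ip f f <= dip f f.

Local Notation L := (form_operator mu k).

Let gap_rel x y : form_rel x y -> b L2_one x = 0 -> b (imul_L2 L2_one) x = 0 ->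
  lam * b x x <= b x y.
Proof.
move=> xy h1 h2; rewrite (form_rel_dip xy xy); apply: gap => //.
by case/form_operatorP: xy.
Qed.

Let one_rel : form_rel L2_one 0. Proof. exact: form_rel_cst. Qed.

Lemma form_operator_nonneg : nonneg_operator mu L.
Proof.
move=> f g /form_operatorP[df Lg fg].
(* The order of [R[i]] compares only numbers with equal imaginary parts, so the inner product must
   also be shown to be real. *)
rewrite lecE; apply/andP; split; last first.
  by change (0 <= ip f g); rewrite fg// dip_ge0.
have -> : Im (inner mu f g) = dip (imul f) f.
  by rewrite -ip_imull fg//; exact: form_domain_imul.
apply/eqP; have := dip_imul_skew k_ge0 k_measurable df df.
by rewrite [in RHS](dipC mu k f); move: (dip _ _) => *; rewrite /=; lra.
Qed.

Lemma form_operator_kernel f : operator_kernel L f -> exists c : R[i], f = cst c %[ae mu].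
Proof.
move=> Lf0; have Lf : L2 mu f by case: Lf0 => -[[]].
pose x := L2_sub Lf.
have x0 : form_rel x 0 by exact: Lf0.
pose P := orthogonal_part b imul_L2 L2_one x.
have P0 := operator_orthogonal_part b imul_L2_linear form_rel0 form_rel_linear
  form_rel_imul one_rel x0.
have Pe := orthogonal_part_e bH imul_L2_skew L2_one_gt0 x.
have PJ := orthogonal_part_Je bH imul_L2K imul_L2_skew L2_one_gt0 x.
have := gap_rel P0 Pe PJ; rewrite (ip0r bH) pmulr_rle0// => nP.
have /L2_nullP ae : nrm b (P - 0) = 0 by rewrite subr0 /nrm ler0_sqrtr.
(* [imul_L2 L2_one] is the constant [i], so the two real coefficients of the projection are the
   parts of the constant sought. *)
pose c : Rcomplex R := (b L2_one x / b L2_one L2_one) +i*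
  (b (imul_L2 L2_one) x / b L2_one L2_one).
exists c; apply: filterS ae => t /(_ I) Pt _.
have /eqP : f t - ((b L2_one x / b L2_one L2_one) *: (1 : Rcomplex R) +
    (b (imul_L2 L2_one) x / b L2_one L2_one) *: ((- 0 +i* 1) : Rcomplex R)) = 0.
  exact: Pt.
rewrite subr_eq0 => /eqP ->.
by apply: complexP; rewrite ?cReD ?cImD ?cReZ ?cImZ /=; ring.
Qed.

Lemma form_operator_spectrum : spectrum mu L `<=`
  [set z | z = 0 \/ exists a : R, lam <= a /\ z = a%:C].
Proof.
move=> z; rewrite /spectrum /=; apply: contra_notP => nz.
have zE : complex.Im z != 0 \/ (complex.Re z < lam /\ complex.Re z != 0).
  have [Iz|Iz] := eqVneq (complex.Im z) 0; [right|by left].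
  have zR : z = (complex.Re z)%:C by apply: complexP.
  split.
    rewrite ltNge; apply/negP => lz; apply: nz; right.
    by exists (complex.Re z).
  apply/eqP => rz; apply: nz; left; rewrite zR rz.
  by [].
have resE (x y : H) : val (y - (complex.Re z *: x + complex.Im z *: imul_L2 x)) =
    (fun t => val y t - z * val x t).
  apply/funext => t; change (val (y - _) t) with
    (val y t - (complex.Re z *: (val x t : Rcomplex R) +
      complex.Im z *: ((- Im (val x t) +i* Re (val x t)) : Rcomplex R))).
  apply: complexP; rewrite !(cReD, cImD, cReN, cImN, cReZ, cImZ, cReM, cImM)/=; ring.
split=> [h Lh|].
  have [x [y [xy xyh]]] := resolvent_onto bH imul_L2_linear imul_L2K imul_L2_skew
    form_rel0 form_rel_linear form_rel_imul form_rel_sym form_rel_onto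
    L2_one_gt0 one_rel gap_rel zE (L2_sub Lh).
  exists (val x), (val y); split => //.
  by move/L2_nullP : xyh; rewrite resE.
have [c c0 cP] := resolvent_lower_bound bH imul_L2_linear imul_L2K imul_L2_skew
    form_rel0 form_rel_linear form_rel_imul form_rel_sym
    L2_one_gt0 one_rel gap_rel zE.
exists (Num.sqrt c^-1) => f g fg.
have [df Lg _] := fg; have Lf : L2 mu f by case: df => -[].
have := cP (L2_sub Lf) (L2_sub Lg) fg.
have := resE (L2_sub Lf) (L2_sub Lg).
set w := _ - _ => wE; rewrite [fun _ => _](_ : _ = val w) ?wE//.
rewrite -ler_pdivlMl// => h.
rewrite !l2normE /nrm -sqrtrM ?invr_ge0 ?(ltW c0)//.
by apply: ler_wsqrtr; rewrite -wE.
Qed.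

(** * Transfer of the contraction to functions *)

Section semigroup.
Variable S : R -> (T -> R[i]) -> (T -> R[i]).
Hypothesis S_exp : is_semigroup_exp mu L S.

(** The default 0 can occur only for [t < 0], where nothing is assumed of [S]. *)
Definition S_L2 (t : R) (x : H) : H :=
  if pselect (L2 mu (S t (val x))) is left Lx then L2_sub Lx else 0.

Lemma S_L2E t x : 0 <= t -> val (S_L2 t x) = S t (val x).
Proof.
move=> t0; rewrite /S_L2; case: pselect => // nL; exfalso; apply: nL.
by case: S_exp => /(_ t t0)[+ _ _] _ _ _ _; apply; exact: L2_val.
Qed.

Lemma scaleC_real (a : R) (z : Rcomplex R) : (a%:C * z : R[i]) = a *: z.
Proof. by apply: complexP; rewrite ?cReM ?cImM ?cReZ ?cImZ/=; ring. Qed.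

Lemma l2norm_val x : l2norm mu (val x) = nrm b x.
Proof. by rewrite l2normE. Qed.

Let nrmF_ge0 (F : R -> T -> R[i]) t : 0 <= l2norm mu (F t).
Proof. exact: sqrtr_ge0. Qed.

Lemma form_operator_semigroup t : 0 < t ->
  (opnorm_on mu (orthocompl mu (operator_kernel L)) (S t) < 1)%E.
Proof.
move=> t0; have [S1 S2 S3 S4 S5] := S_exp.
have [||||||c [c0 c1 cP]] := semigroup_strictly_contractive bH imul_L2_linear
  imul_L2K imul_L2_skew form_rel0 form_rel_linear form_rel_imul form_rel_sym
  form_rel_ge0 form_rel_onto L2_one_gt0 one_rel lam_gt0 gap_rel (S := S_L2) _ _ _ _ _ _ t0.
- move=> s a x y s0; apply/L2_nullP.
  have [_ + _] := S1 s s0 => /(_ a%:C _ _ (L2_val x) (L2_val y)).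
  rewrite S_L2E//; change (val (a *: S_L2 s x + S_L2 s y)) with
    (a *: val (S_L2 s x) + val (S_L2 s y)).
  rewrite !S_L2E//.
  have eqf (f g : T -> Rcomplex R) : (fun t => a%:C * f t + g t) = a *: f + g.
    by apply/funext => u; rewrite scaleC_real.
  rewrite !eqf => h; apply: filterS h => u + _ => /(_ I) ->.
  by rewrite scaleC_real.
- move=> s s0; have [_ _ [M SM]] := S1 s s0; exists M => x.
  by have := SM _ (L2_val x); rewrite -S_L2E// !l2norm_val.
- move=> x; apply/L2_nullP; rewrite S_L2E//.
  by apply: S2; exact: L2_val.
- move=> s r x s0 r0; apply/L2_nullP; rewrite !S_L2E ?addr_ge0//.
  by apply: S3 => //; exact: L2_val.
- move=> x; have /(cvg_at_right0P (nrmF_ge0 _)) h := S4 _ (L2_val x).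
  move=> r /h[dl dl0 hd]; exists dl => // s s0 sd; have := hd s s0 sd.
  by rewrite -l2norm_val -(S_L2E x (ltW s0)).
- move=> x y; rewrite /form_rel S5.
  have eqn s : 0 < s -> l2norm mu (fun u => (s^-1)%:C * (S s (val x) u - val x u) + val y u) =
      nrm b (s^-1 *: (S_L2 s x - x) + y).
    move=> s0; rewrite -l2norm_val -(S_L2E x (ltW s0)); congr l2norm.
    by apply/funext => u; rewrite scaleC_real.
  split=> [[_ _ /(cvg_at_right0P (nrmF_ge0 _)) h] r /h[dl dl0 hd]|h].
    by exists dl => // s s0 sd; rewrite -eqn// hd.
  split; [exact: L2_val|exact: L2_val|apply/(cvg_at_right0P (nrmF_ge0 _)) => r /h].
  by move=> [dl dl0 hd]; exists dl => // s s0 sd; rewrite eqn// hd.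
apply: (@le_lt_trans _ _ c%:E); last by rewrite lte_fin.
apply: ge_ereal_sup => _ [f [[_ fort] Lf f1] <-]; rewrite lee_fin.
(* One complex orthogonality relation, to the constant 1, yields both real ones, to 1 and to [i]. *)
have f0 := fort _ (form_rel_cst 1).
have e1 : b L2_one (L2_sub Lf) = 0 by rewrite /L2_ip /ip f0.
have e2 : b (imul_L2 L2_one) (L2_sub Lf) = 0 by rewrite /L2_ip ip_imull f0.
have := cP _ e1 e2; rewrite -!l2norm_val S_L2E ?(ltW t0)// => /le_trans; apply.
by rewrite ler_piMr.
Qed.

End semigroup.

End form_operator_theory.

(** * A criterion for the Poincare inequality *)

Section poincare.
Context d (T : measurableType d) (R : realType).
Variable mu : {sigma_finite_measure set T -> \bar R}.
Variable k : T -> T -> R.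
Hypothesis k_ge0 : forall u v, 0 <= k u v.
Hypothesis k_measurable : measurable_fun setT (fun p : T * T => k p.1 p.2).
Hypothesis mu_fin : (mu setT < +oo)%E.
Local Notation Re := (@complex.Re _).
Local Notation Im := (@complex.Im _).
Local Notation mu2 := (mu \x mu)%E.

(** [C] is the core where [k] is bounded below, and [g u w] the intensity of the jump from [u] to
    [w], a density with respect to [mu]. The comparisons with [k] are restricted to distinct points
    because [K3] vanishes on the diagonal by the convention for division by 0; there [|f u - f v|]
    vanishes too. *)
Variables (C : set T) (g : T -> T -> R) (K c : R).
Hypothesis C_measurable : measurable C.
Hypothesis C_gt0 : (0 < mu C)%E.
Hypothesis g_ge0 : forall u w, 0 <= g u w.
Hypothesis g_measurable : measurable_fun setT (fun p : T * T => g p.1 p.2).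
Hypothesis K_gt0 : 0 < K.
Hypothesis c_gt0 : 0 < c.
Hypothesis g_out : forall u, ~ C u -> (1 <= \int[mu]_w (g u w)%:E)%E.
Hypothesis g_in : forall w, (\int[mu]_u (g u w)%:E <= (4^-1)%:E)%E.
Hypothesis g_le : forall u w, u <> w -> g u w <= K * k u w.
Hypothesis k_center : forall u v, C u -> C v -> u <> v -> c <= k u v.

Section function.
Variable f : T -> Rcomplex R.
Hypothesis Lf : L2 mu f.

Let D u v := sqn (f u - f v).
Let E := (\int[mu2]_p (k p.1 p.2 * D p.1 p.2)%:E)%E.

Let D_ge0 u v : 0 <= D u v. Proof. exact: sqn_ge0. Qed.

Let Dxx u : D u u = 0.
Proof. by rewrite /D subrr /sqn/= expr0n/= addr0. Qed.

Let D_tri u v w : D u v <= 2 * D u w + 2 * D w v.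
Proof.
rewrite /D /sqn !(cReD, cImD, cReN, cImN).
move: (Re (f u)) (Re (f v)) (Re (f w)) (Im (f u)) (Im (f v)) (Im (f w)) => a1 a2 a3 b1 b2 b3.
have := sqr_ge0 (a1 - a3 - (a3 - a2)); have := sqr_ge0 (b1 - b3 - (b3 - b2)).
nra.
Qed.

Let mf : cmeasurable f. Proof. by case/L2P: Lf. Qed.

Let D_measurable : measurable_fun setT (fun p : T * T => D p.1 p.2).
Proof.
have [mR mI] := mf.
have dif (h : T -> R) : measurable_fun setT h ->
    measurable_fun setT (fun p : T * T => (h p.1 - h p.2) ^+ 2).
  move=> mh; apply: measurable_funX; apply: measurable_funB.
    exact: (measurableT_comp mh measurable_fst).
  exact: (measurableT_comp mh measurable_snd).
rewrite (_ : (fun p => _) = fun p : T * T =>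
  (Re (f p.1) - Re (f p.2)) ^+ 2 + (Im (f p.1) - Im (f p.2)) ^+ 2); last first.
  by apply/funext => p; rewrite /D /sqn !(cReD, cImD, cReN, cImN).
by apply: measurable_funD; [exact: (dif _ mR)|exact: (dif _ mI)].
Qed.

Let D_measurable1 v : measurable_fun setT (fun u => D u v).
Proof. exact: (measurableT_comp D_measurable (measurable_pair2 v)). Qed.

Let ind := \1_C : T -> R.

Let ind_ge0 u : 0 <= ind u. Proof. by rewrite /ind indicE. Qed.

Let mind : measurable_fun setT ind. Proof. exact: measurable_indic. Qed.

Let I v := (\int[mu]_u (D u v)%:E)%E.
Let A v := (\int[mu]_u (ind u * D u v)%:E)%E.

Let I_ge0 v : (0 <= I v)%E.
Proof. by apply: integral_ge0 => u _; rewrite lee_fin. Qed.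

Let A_ge0 v : (0 <= A v)%E.
Proof. by apply: integral_ge0 => u _; rewrite lee_fin mulr_ge0. Qed.

Let E_ge0 : (0 <= E)%E.
Proof. by apply: integral_ge0 => u _; rewrite lee_fin mulr_ge0. Qed.

Let mgD v : measurable_fun setT (fun p : T * T => (g p.1 p.2 * D p.1 v)%:E).
Proof.
apply/measurable_EFinP; apply: measurable_funM => //.
exact: (measurableT_comp (D_measurable1 v) measurable_fst).
Qed.

Let mgD' v : measurable_fun setT (fun p : T * T => (g p.1 p.2 * D p.2 v)%:E).
Proof.
apply/measurable_EFinP; apply: measurable_funM => //.
exact: (measurableT_comp (D_measurable1 v) measurable_snd).
Qed.

Let mkD : measurable_fun setT (fun p : T * T => (k p.1 p.2 * D p.1 p.2)%:E).
Proof. by apply/measurable_EFinP; exact: measurable_funM. Qed.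

(** Integrating over the starting point first leaves only the total intensity into the endpoint, on
    which [D p.2 v] depends. *)
Let jump_back v : (\int[mu2]_p (g p.1 p.2 * D p.2 v)%:E <= (4^-1)%:E * I v)%E.
Proof.
rewrite (fubini_tonelli1 (m1 := mu) (m2 := mu) _ (mgD' v)); last first.
  by move=> p; rewrite lee_fin mulr_ge0.
rewrite (fubini_tonelli (m1 := mu) (m2 := mu) _ (mgD' v)); last first.
  by move=> p; rewrite lee_fin mulr_ge0.
rewrite /fubini_G /= /I -ge0_integralZl//; last 2 first.
- by apply/measurable_EFinP.
- by move=> u _; rewrite lee_fin.
apply: ge0_le_integral => //.
- by move=> w _; apply: integral_ge0 => u _; rewrite lee_fin mulr_ge0.
- apply: (measurable_fun_fubini_tonelli_G (m1 := mu) _ (mgD' v)).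
  by move=> p; rewrite lee_fin mulr_ge0.
- by apply/measurable_EFinP; exact: measurable_funM.
move=> w _; under eq_integral do rewrite EFinM.
rewrite ge0_integralZr//; last 3 first.
- apply/measurable_EFinP.
  exact: (measurableT_comp g_measurable (measurable_pair2 w)).
- by move=> u _; rewrite lee_fin.
- by rewrite lee_fin.
by rewrite lee_wpmul2r ?lee_fin.
Qed.

(* [D u v <= 2 D u w + 2 D w v], averaged over the jump [u -> w]. *)
Let tail_bound v : (I v <= A v + ((2 * K)%:E * E + (2^-1)%:E * I v))%E.
Proof.
pose G u := (\int[mu]_w (g u w * D u v)%:E)%E.
have G_ge0 u : (0 <= G u)%E by apply: integral_ge0 => w _; rewrite lee_fin mulr_ge0.
have mG : measurable_fun setT G.
  apply: (measurable_fun_fubini_tonelli_F (m2 := mu) _ (mgD v)).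
  by move=> p; rewrite lee_fin mulr_ge0.
apply: (@le_trans _ _ (\int[mu]_u ((ind u * D u v)%:E + G u))%E).
  apply: ge0_le_integral => //.
  - by move=> u _; rewrite lee_fin.
  - exact/measurable_EFinP.
  - apply: emeasurable_funD => //; apply/measurable_EFinP; exact: measurable_funM.
  move=> u _; have [Cu|nCu] := pselect (C u).
    by rewrite /ind indicE mem_set// mul1r leeDl.
  rewrite /ind indicE memNset// mul0r add0e /G.
  under eq_integral do rewrite EFinM.
  rewrite ge0_integralZr//; last 3 first.
  - apply/measurable_EFinP; exact: (measurableT_comp g_measurable (measurable_pair1 u)).
  - by move=> w _; rewrite lee_fin.
  - by rewrite lee_fin.
  by rewrite -[leLHS]mul1e lee_wpmul2r ?lee_fin// g_out.
rewrite ge0_integralD//; last 2 first.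
- by move=> u _; rewrite lee_fin mulr_ge0.
- by apply/measurable_EFinP; exact: measurable_funM.
rewrite leeD2l//.
have -> : (\int[mu]_u G u = \int[mu2]_p (g p.1 p.2 * D p.1 v)%:E)%E.
  rewrite (fubini_tonelli1 (m1 := mu) (m2 := mu) _ (mgD v))//.
  by move=> p; rewrite lee_fin mulr_ge0.
apply: (@le_trans _ _ (\int[mu2]_p ((2 * K)%:E * (k p.1 p.2 * D p.1 p.2)%:E +
    2%:E * (g p.1 p.2 * D p.2 v)%:E))%E).
  apply: ge0_le_integral => //.
  - by move=> p _; rewrite lee_fin mulr_ge0.
  - by apply: emeasurable_funD; apply: measurable_funeM.
  move=> [u w] _ /=; rewrite -!EFinM -EFinD lee_fin.
  have [->|/eqP uw] := eqVneq u w.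
    rewrite Dxx !mulr0 add0r ler_peMl ?mulr_ge0//.
    by rewrite ler1n.
  have h1 := ler_wpM2l (g_ge0 u w) (D_tri u v w).
  have h2 := ler_wpM2r (D_ge0 u w) (g_le uw).
  move: h1 h2; rewrite mulrDr.
  by move: (D u w) (D u v) (D w v) (g u w) (k u w) => *; lra.
rewrite ge0_integralD//; last 4 first.
- by move=> p _; rewrite mule_ge0 ?lee_fin ?mulr_ge0// ltW.
- exact: measurable_funeM.
- by move=> p _; rewrite mule_ge0 ?lee_fin ?mulr_ge0.
- exact: measurable_funeM.
rewrite ge0_integralZl//; last 2 first.
- by move=> p _; rewrite lee_fin mulr_ge0.
- by rewrite lee_fin mulr_ge0// ltW.
rewrite leeD2l// ge0_integralZl//; last first.
  by move=> p _; rewrite lee_fin mulr_ge0.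
have -> : (2^-1 : R)%:E = (2%:E * (4^-1)%:E)%E by rewrite -EFinM; congr EFin; field.
by rewrite -muleA lee_wpmul2l.
Qed.

Let center_bound : (\int[mu]_v ((ind v)%:E * A v) <= (c^-1)%:E * E)%E.
Proof.
have mF : measurable_fun setT (fun p : T * T => (ind p.1 * ind p.2 * D p.1 p.2)%:E).
  apply/measurable_EFinP; apply: measurable_funM => //; apply: measurable_funM.
    exact: (measurableT_comp mind measurable_fst).
  exact: (measurableT_comp mind measurable_snd).
have F0 (p : T * T) : (0 <= (ind p.1 * ind p.2 * D p.1 p.2)%:E)%E.
  by rewrite lee_fin !mulr_ge0.
have -> : (\int[mu]_v ((ind v)%:E * A v) =
    \int[mu2]_p (ind p.1 * ind p.2 * D p.1 p.2)%:E)%E.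
  rewrite (fubini_tonelli1 (m1 := mu) (m2 := mu) _ mF)//.
  rewrite (fubini_tonelli (m1 := mu) (m2 := mu) _ mF)//.
  apply: eq_integral => v _; rewrite /fubini_G /= /A -ge0_integralZl//.
  - by apply: eq_integral => u _; rewrite -EFinM mulrA (mulrC (ind v)).
  - by apply/measurable_EFinP; exact: measurable_funM.
  - by move=> u _; rewrite lee_fin mulr_ge0.
  - by rewrite lee_fin.
rewrite /E -ge0_integralZl//; last 2 first.
- by move=> p _; rewrite lee_fin mulr_ge0.
- by rewrite lee_fin invr_ge0 ltW.
apply: ge0_le_integral => //; first exact: measurable_funeM.
move=> [u v] _ /=; rewrite -EFinM lee_fin.
have [->|/eqP uv] := eqVneq u v; first by rewrite Dxx !mulr0.
rewrite mulrA ler_wpM2r//.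
rewrite /ind !indicE; have [Cu|nCu] := pselect (C u); last first.
  by rewrite (memNset nCu) mul0r mulr_ge0// invr_ge0 ltW.
have [Cv|nCv] := pselect (C v); last first.
  by rewrite (memNset nCv) mulr0 mulr_ge0// invr_ge0 ltW.
by rewrite !mem_set// mulr1 ler_pdivlMl// mulr1 k_center.
Qed.

Hypothesis f1 : ip mu (cst 1) f = 0.
Hypothesis fi : ip mu (imul (cst 1)) f = 0.

(** The constant [f v] is a real combination of 1 and [i], hence orthogonal to [f], and the squared
    norm of [f - f v] is the sum of the two squared norms. Finiteness is what allows [I v / 2] to be
    moved to the other side. *)
Let I_lower v : ((ip mu f f)%:E <= I v)%E /\ (I v < +oo)%E.
Proof.
have Lc := L2_cst mu_fin (f v).
have bH := L2_semi_hilbert mu.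
have Lfc : L2 mu (f - cst (f v)) by exact: L2B.
have IE : I v = (ip mu (f - cst (f v)) (f - cst (f v)))%:E by rewrite ip_sqnE.
rewrite IE ltry lee_fin; split=> //.
have fc : ip mu f (cst (f v)) = 0.
  have -> : cst (f v) = Re (f v) *: (cst 1 : T -> Rcomplex R) +
      Im (f v) *: imul (cst 1).
    apply/funext => t; apply: complexP.
      by rewrite cReD !cReZ/=; ring.
    by rewrite cImD !cImZ/=; ring.
  rewrite ipC_L2 ip_linear_L2//; last 2 first.
  - exact: L2_cst.
  - by have [_ L] := L2_subspace mu; have [L0 _] := L2_subspace mu;
    have := L (Im (f v)) _ _ (L2_imul (L2_cst mu_fin 1)) L0; rewrite addr0.
  have [L0 _] := L2_subspace mu.
  have := ip_linear_L2 (Im (f v)) (L2_imul (L2_cst mu_fin 1)) L0 Lf.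
  rewrite addr0 => ->; rewrite f1 fi.
  have -> : ip mu 0 f = 0 by exact: (ip0l bH (L2_sub Lf)).
  by rewrite !mulr0 !addr0.
pose x := L2_sub Lf; pose y := L2_sub Lc.
have -> : ip mu (f - cst (f v)) (f - cst (f v)) = L2_ip (x - y) (x - y) by [].
have bxx : L2_ip x x = ip mu f f by [].
have bxy : L2_ip x y = 0 by [].
have := ip_ge0 bH y.
rewrite !(ipDl bH, ipDr bH, ipNl bH, ipNr bH) (ipC bH y x) bxx bxy.
by move: (L2_ip y y) (ip mu f f) => *; lra.
Qed.

(** Absorbing half of [I v] in [tail_bound] gives [|f|^2 <= 2 A v + 4 K E] for every [v].
    Integrating over [v] in [C] makes [center_bound] applicable to [A], whence [2 / c], and
    multiplies the other terms by [mu C]. *)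
Lemma poincare_function : ((fine (mu C) * ip mu f f)%:E <=
  (2 / c + 4 * K * fine (mu C))%:E * E)%E.
Proof.
have [Einf|Efin] := eqVneq E +oo%E.
  rewrite Einf gt0_muley ?leey// lte_fin ltr_wpDr ?divr_gt0//.
  by rewrite !mulr_ge0 ?(ltW K_gt0) ?fine_ge0.
have CT : (mu C <= mu setT)%E by rewrite le_measure ?inE.
have Cfin : mu C \is a fin_num by rewrite ge0_fin_numE ?(le_lt_trans CT).
have Efin' : E \is a fin_num by rewrite ge0_fin_numE// lt_neqAle Efin leey.
have bound v : ((ip mu f f)%:E <= 2%:E * A v + (4 * K)%:E * E)%E.
  have [In Ifin] := I_lower v; apply: (le_trans In).
  have Ifin' : I v \is a fin_num by rewrite ge0_fin_numE.
  have := tail_bound v.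
  case: (A v) (A_ge0 v) => [a|_|//]; last first.
    by move=> _; rewrite -(fineK Efin') -EFinM gt0_muley// addye// leey.
  move=> _; rewrite -(fineK Ifin') -(fineK Efin') -!EFinM -!EFinD !lee_fin.
  by move: (fine (I v)) (fine E) => *; lra.
have mA : measurable_fun setT A.
  apply: (measurable_fun_fubini_tonelli_G (m1 := mu) (fun p => (ind p.1 * D p.1 p.2)%:E)).
    apply/measurable_EFinP; apply: measurable_funM => //.
    exact: (measurableT_comp mind measurable_fst).
  by move=> p; rewrite lee_fin mulr_ge0.
have int_ind (a : R) : 0 <= a -> (\int[mu]_v ((ind v)%:E * a%:E) = mu C * a%:E)%E.
  move=> a0; rewrite ge0_integralZr//; last 2 first.
  - exact/measurable_EFinP.
  - by move=> v _; rewrite lee_fin.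
  by rewrite /ind integral_indic// setIT.
have ipf0 : 0 <= ip mu f f by exact: ip_ge0_L2.
have -> : ((fine (mu C) * ip mu f f)%:E = \int[mu]_v ((ind v)%:E * (ip mu f f)%:E))%E.
  by rewrite int_ind// EFinM fineK.
pose b := 4 * K * fine E.
have b0 : 0 <= b by rewrite !mulr_ge0 ?(ltW K_gt0) ?fine_ge0.
have bE : b%:E = ((4 * K)%:E * E)%E by rewrite -[in RHS](fineK Efin') -EFinM.
apply: (@le_trans _ _ (\int[mu]_v (2%:E * ((ind v)%:E * A v) + (ind v)%:E * b%:E))%E).
  apply: ge0_le_integral => //.
  - by move=> v _; rewrite mule_ge0 ?lee_fin.
  - by apply: emeasurable_funM => //; exact/measurable_EFinP.
  - apply: emeasurable_funD; last by apply: emeasurable_funM => //; exact/measurable_EFinP.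
    by apply: measurable_funeM; apply: emeasurable_funM => //; exact/measurable_EFinP.
  move=> v _; rewrite muleCA -ge0_muleDr ?mule_ge0 ?lee_fin//.
  rewrite lee_wpmul2l ?lee_fin//; apply: (le_trans (bound v)).
  by rewrite bE.
rewrite ge0_integralD//; last 4 first.
- by move=> v _; rewrite !mule_ge0 ?lee_fin.
- by apply: measurable_funeM; apply: emeasurable_funM => //; exact/measurable_EFinP.
- by move=> v _; rewrite mule_ge0 ?lee_fin.
- by apply: emeasurable_funM => //; exact/measurable_EFinP.
rewrite ge0_integralZl//; last 2 first.
- by apply: emeasurable_funM => //; exact/measurable_EFinP.
- by move=> v _; rewrite mule_ge0 ?lee_fin.
rewrite int_ind//.
apply: (@le_trans _ _ (2%:E * ((c^-1)%:E * E) + mu C * b%:E)%E).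
  by rewrite leeD2r// lee_wpmul2l.
rewrite -(fineK Cfin) -(fineK Efin') -!EFinM -!EFinD lee_fin /b.
by rewrite [leRHS](_ : _ = 2 * (c^-1 * fine E) + fine (mu C) * (4 * K * fine E))//; ring.
Qed.

End function.

Lemma poincare_criterion : exists2 lam, 0 < lam & forall f : T -> Rcomplex R,
  form_domain mu k f -> ip mu (cst 1) f = 0 -> ip mu (imul (cst 1)) f = 0 ->
  lam * ip mu f f <= dip mu k f f.
Proof.
have CT : (mu C <= mu setT)%E by rewrite le_measure ?inE.
have Cfin : mu C \is a fin_num by rewrite ge0_fin_numE ?(le_lt_trans CT).
have m0 : 0 < fine (mu C) by rewrite fine_gt0// C_gt0 -ge0_fin_numE.
pose B := 2 / c + 4 * K * fine (mu C).
have B0 : 0 < B by rewrite addr_gt0 ?divr_gt0 ?mulr_gt0.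
(* The 2 is the factor [1/2] in the form: the double integral bounded above is twice [dip]. *)
exists (fine (mu C) / (2 * B)); first by rewrite divr_gt0// mulr_gt0.
move=> f df f1 fi; have [Lf Gf] := (form_domainP mu k_ge0 k_measurable f).1 df.
have := poincare_function Lf f1 fi.
have -> : (\int[mu \x mu]_p (k p.1 p.2 * sqn (f p.1 - f p.2))%:E =
    (2 * dip mu k f f)%:E)%E.
  rewrite /dip mulrA divff// mul1r ip_sqnE//; apply: eq_integral => p _.
  by rewrite sqn_gradient// normc_sqr.
rewrite -/B -EFinM lee_fin => h.
rewrite mulrAC ler_pdivrMr ?mulr_gt0//.
by rewrite [leRHS](_ : _ = B * (2 * dip mu k f f))//; ring.
Qed.

End poincare.

(** * The measure nu and the kernels *)

Section nu_integral.
Context (R : realType).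
Local Notation leb := (@lebesgue_measure R).
Import HBNNSimple.

Let nu_nnsfun (s : {nnsfun measurableTypeR R >-> R}) :
  (\int[@nu R]_x (s x)%:E = \int[leb]_x ((s x)%:E * (nu_density x)%:E))%E.
Proof.
have mrho : measurable_fun setT (fun x : R => (nu_density x)%:E).
  by apply/measurable_EFinP; exact: measurable_nu_density.
have rho0 (x : R) : (0 <= (nu_density x)%:E)%E by rewrite lee_fin nu_density_ge0.
rewrite integralT_nnsfun sintegralE.
have E1 (x : R) : ((s x)%:E * (nu_density x)%:E =
    \sum_(r \in range s) (r%:E * ((\1_(s @^-1` [set r]) x)%:E * (nu_density x)%:E)))%E.
  rewrite [in LHS]fimfunE -fsumEFin// ge0_mule_fsuml.
    by apply: eq_fsbigr => r _; rewrite EFinM muleA.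
  by move=> r; rewrite EFinM nnfun_muleindic_ge0.
under [RHS]eq_integral do rewrite E1.
have mi (r : R) : measurable_fun setT (fun x : R =>
    ((\1_(s @^-1` [set r]) x)%:E * (nu_density x)%:E)%E).
  apply: emeasurable_funM => //; apply/measurable_EFinP.
  apply: measurable_indic; have := @measurable_funPT _ _ _ _ s measurableT _ (measurable_set1 r).
  by rewrite setTI.
rewrite ge0_integral_fsum//; last 2 first.
- by move=> r; apply: measurable_funeM; exact: mi.
- by move=> r x _; rewrite muleA mule_ge0//; exact: nnfun_muleindic_ge0.
apply: eq_fsbigr => r; rewrite inE => -[z _ <-].
rewrite ge0_integralZl//; [|exact: mi|by move=> x _; rewrite mule_ge0// lee_fin
  |by rewrite lee_fin].
congr (_ * _)%E.
transitivity (\int[leb]_(w in s @^-1` [set s z]) (nu_density w)%:E)%E; first by [].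
rewrite [LHS]integral_mkcond; apply: eq_integral => x _.
rewrite patchE indicE; case: ifPn => xs; first by rewrite mul1e.
by rewrite mul0e.
Qed.

(** Simple functions first, where the identity is the definition of [nu] on level sets; then
    monotone convergence on both sides. *)
Lemma integral_nu (h : measurableTypeR R -> \bar R) :
  measurable_fun setT h -> (forall x, 0 <= h x)%E ->
  (\int[@nu R]_x h x = \int[leb]_x (h x * (nu_density x)%:E))%E.
Proof.
move=> mh h0.
have mrho : measurable_fun setT (fun x : measurableTypeR R => (nu_density x)%:E).
  by apply/measurable_EFinP; exact: measurable_nu_density.
have rho0 (x : R) : (0 <= (nu_density x)%:E)%E by rewrite lee_fin nu_density_ge0.
pose g := nnsfun_approx measurableT mh.
have gh x : (g n x)%:E @[n --> \oo] --> h x by exact: cvg_nnsfun_approx.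
have ndg x : {homo (fun n => (g n x)%:E) : n m / (n <= m)%N >-> (n <= m)%E}.
  move=> n m nm; rewrite lee_fin.
  by have /lefP := nd_nnsfun_approx measurableT mh nm; exact.
have mg n : measurable_fun setT (fun x : measurableTypeR R => (g n x)%:E).
  by apply/measurable_EFinP; exact: measurable_funPT.
have g0 n x : (0 <= (g n x)%:E)%E by rewrite lee_fin; exact: fun_ge0.
transitivity (limn (fun n => \int[@nu R]_x (g n x)%:E)%E).
  rewrite -monotone_convergence//.
  by apply: eq_integral => x _; apply/esym/cvg_lim => //; exact: gh.
transitivity (limn (fun n => \int[leb]_x ((g n x)%:E * (nu_density x)%:E))%E).
  by apply: congr_lim; apply/funext => n; exact: (nu_nnsfun (g n)).
rewrite -monotone_convergence//.
- apply: eq_integral => x _; apply/cvg_lim => //.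
  by apply: cvgeZr => //; exact: gh.
- by move=> n; exact: emeasurable_funM.
- by move=> n x _; rewrite mule_ge0.
- by move=> x _ n m nm; rewrite lee_wpmul2r//; exact: ndg.
Qed.

End nu_integral.

(** * Exponential bounds for the density and the kernels *)

Section bounds.
Context (R : realType).
Implicit Types (u v w x y : R).

(** The softplus function, close to [exp u] at minus infinity and to [u] at plus infinity; these two
    regimes govern the two tails. *)
Definition ell u : R := ln (1 + expR u).

Lemma one_expR_gt0 u : 0 < 1 + expR u.
Proof. by rewrite addr_gt0// expR_gt0. Qed.

Lemma ell_gt0 u : 0 < ell u.
Proof. by rewrite ln_gt0// ltrDl expR_gt0. Qed.

Lemma ell_leP u y : (ell u <= y) = (1 + expR u <= expR y).
Proof.
by rewrite /ell -{1}(expRK y) ler_ln ?posrE ?expR_gt0 ?one_expR_gt0.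
Qed.

Lemma ell_geP u y : (y <= ell u) = (expR y <= 1 + expR u).
Proof.
by rewrite /ell -{1}(expRK y) ler_ln ?posrE ?expR_gt0 ?one_expR_gt0.
Qed.

Lemma ell_homo u v : u <= v -> ell u <= ell v.
Proof. by move=> uv; rewrite ler_ln ?posrE ?one_expR_gt0// lerD2l ler_expR. Qed.

Lemma ell_ge u : u <= ell u.
Proof. by rewrite ell_geP lerDr. Qed.

Lemma ell_le u : 0 <= u -> ell u <= u + 1.
Proof.
move=> u0; rewrite ell_leP expRD.
have h1 : 1 <= expR u by rewrite -expR0 ler_expR.
have h2 : 1 + 1 <= expR 1 :> R by exact: expR_ge1Dx.
by move: (expR u) (expR 1) h1 h2 => a e *; nra.
Qed.

Lemma ell_le_exp u : ell u <= expR u.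
Proof. by rewrite ell_leP expR_ge1Dx. Qed.

(** With [x = exp u] in ]0, 1] this is [exp (x / 2) <= 1 + x], which follows from
    [exp (- x / 2) >= 1 - x / 2] and [1 / (1 - x / 2) <= 1 + x]. *)
Lemma ell_ge_exp u : u <= 0 -> expR u / 2 <= ell u.
Proof.
move=> u0; rewrite ell_geP.
have e1 : expR u <= 1 by rewrite -expR0 ler_expR.
have e0 := expR_gt0 u; move: (expR u) e0 e1 => x x0 x1.
have h := expR_ge1Dx (- (x / 2)).
have -> : expR (x / 2) = (expR (- (x / 2)))^-1 by rewrite expRN invrK.
have hq : 0 < 1 + - (x / 2) by lra.
apply: (@le_trans _ _ (1 + - (x / 2))^-1).
  by rewrite lef_pV2 ?posrE ?expR_gt0.
by rewrite -[leLHS]div1r ler_pdivrMr//; nra.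
Qed.

(** Through [lnell] the powers of [ell] turn into exponentials, and estimates of products into
    linear inequalities between exponents. *)
Definition lnell u : R := ln (ell u).

Lemma ellE u : ell u = expR (lnell u).
Proof. by rewrite lnK// posrE ell_gt0. Qed.

Lemma lnell_le u : lnell u <= u.
Proof. by rewrite -ler_expR -ellE ell_le_exp. Qed.

Lemma lnell_ge_neg u : u <= 0 -> u - 1 <= lnell u.
Proof.
move=> u0; rewrite -ler_expR -ellE (le_trans _ (ell_ge_exp u0))//.
rewrite expRD ler_pM2l ?expR_gt0// expRN lef_pV2 ?posrE ?expR_gt0//.
exact: expR_ge1Dx.
Qed.

Lemma lnell_ge0 u : 1 <= u -> 0 <= lnell u.
Proof.
move=> u1; rewrite -ler_expR -ellE expR0 (le_trans u1)//; exact: ell_ge.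
Qed.

(** With slope 1/20 the factor [ell ^ (5/2)] of the density costs [u / 8] in the exponent, half of
    the [u / 4] that a jump gains on the right. The summand [ln 20] compensates for that slope in
    [exp x >= 1 + x]. *)
Definition lnell_const : R := 1 + ln 20.

Lemma lnell_const_ge1 : 1 <= lnell_const.
Proof. by rewrite lerDl ln_ge0// ler1n. Qed.

(* [ln (u + 1) <= u / 20 + lnell_const]: the logarithm is dominated by any slope. *)
Lemma lnell_le_pos u : 0 <= u -> lnell u <= u / 20 + lnell_const.
Proof.
move=> u0; rewrite -ler_expR -ellE (le_trans (ell_le u0))//.
rewrite /lnell_const addrA expRD lnK ?posrE//.
by have := expR_ge1Dx (u / 20 + 1); move: (expR _) => *; lra.
Qed.

Lemma nu_densityE u : nu_density u = expR (- u + 5 / 2 * lnell u).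
Proof. by rewrite /nu_density /powR gt_eqF ?ell_gt0// expRD. Qed.

Lemma nu_density_gt0 u : 0 < nu_density u.
Proof. by rewrite nu_densityE expR_gt0. Qed.

Lemma nu_density_le u : nu_density u <= expR (5 / 2 * lnell_const) * expR (- (1 / 2) * `|u|).
Proof.
have c1 := lnell_const_ge1.
rewrite nu_densityE -expRD ler_expR.
have [u0|u0] := leP 0 u.
  by rewrite ger0_norm//; have := lnell_le_pos u0; lra.
by rewrite ltr0_norm//; have := lnell_le u; lra.
Qed.

(** On the right a jump raises the density 8 times once [u / 8 >= 3 + 5/2 * lnell_const], that is,
    from [24 + 20 * lnell_const] on. The remaining 36 is slack and brings the constant to at least
    80. *)
Definition tail_start : R := 60 + 20 * lnell_const.
Local Notation N := tail_start.

Lemma tail_start_ge : 80 <= N.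
Proof. by have := lnell_const_ge1; rewrite /N; lra. Qed.

(** Multiplying the bounds on [w] by [u] covers both signs of [u] by polynomial inequalities, which
    also makes measurability easy. *)
Definition jump u w := (N < `|u|) && (u ^+ 2 / 2 <= w * u <= 3 / 4 * u ^+ 2).

Lemma jumpP u w : jump u w ->
  (N < u /\ u / 2 <= w <= 3 / 4 * u) \/ (u < - N /\ 3 / 4 * u <= w <= u / 2).
Proof.
have N0 := tail_start_ge.
move=> /andP[uN /andP[h1 h2]]; have [u0|u0] := leP 0 u.
  rewrite ger0_norm// in uN; left; split => //.
  have up : 0 < u by lra.
  by apply/andP; split; rewrite -(ler_pM2r up); nra.
rewrite ltr0_norm// in uN; right; split; first by lra.
by apply/andP; split; rewrite -(ler_nM2r u0); nra.
Qed.

Lemma expR3_ge8 : 8 <= expR 3 :> R.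
Proof.
have -> : (3 : R) = 1 + (1 + 1) by ring.
rewrite !expRD; have h : 1 + 1 <= expR 1 :> R by exact: expR_ge1Dx.
by move: (expR 1) h => e *; nra.
Qed.

(** Since [8 <= exp 3], a gain of 3 in the exponent suffices. On the right it comes from
    [exp (- u)], whose gain outweighs the loss in [ell ^ (5/2)]; on the left the density behaves
    like [exp (3 u / 2)]. *)
Lemma jump_density u w : jump u w -> 8 * nu_density u <= nu_density w.
Proof.
have c1 := lnell_const_ge1.
move=> /jumpP h; rewrite !nu_densityE.
apply: (@le_trans _ _ (expR (3 + (- u + 5 / 2 * lnell u)))).
  by rewrite [leRHS]expRD ler_pM2r ?expR_gt0// expR3_ge8.
rewrite ler_expR; case: h => [[uN /andP[w1 w2]]|[uN /andP[w1 w2]]].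
  have u0 : 0 <= u by move: uN; rewrite /N; lra.
  have := lnell_le_pos u0; have w0 : 1 <= w by move: uN; rewrite /N; lra.
  by have := lnell_ge0 w0; move: uN; rewrite /N; lra.
have := lnell_le u; have w0 : w <= 0 by move: uN; rewrite /N; lra.
by have := lnell_ge_neg w0; move: uN; rewrite /N; lra.
Qed.

(** * The nonsingular part of the kernels *)

Section kernels.
Variables nbar : R.
Hypothesis nbar_gt0 : 0 < nbar.

(* [K3] without its singular factor [1 / (1 - exp (- |u - v|))]. *)
Definition K0 u v : R := 4 * nbar * expR (- (3 / 2) * (lnell u + lnell v)) *
  (expR (- `|u - v|) / (1 + expR (- Num.min u v) + expR (- Num.max u v))) *
  (2 + expR (Num.max u v)).

Lemma K3E u v : K3 nbar u v = K0 u v / (1 - expR (- `|u - v|)).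
Proof.
rewrite /K3 /K0 -!mulrA; congr (_ * (_ * (_ * _))).
rewrite /powR gt_eqF ?mulr_gt0 ?ell_gt0// lnM ?posrE ?ell_gt0//.
Qed.

Lemma denom_gt0 u v : 0 < 1 + expR (- Num.min u v) + expR (- Num.max u v).
Proof. by rewrite !addr_gt0 ?expR_gt0. Qed.

Lemma K0_gt0 u v : 0 < K0 u v.
Proof.
by rewrite /K0 !mulr_gt0 ?expR_gt0 ?invr_gt0 ?denom_gt0 ?addr_gt0 ?expR_gt0.
Qed.

(** The constant 24 comes from the right tail. There [exp (- (u - w)) * exp u] cancels the
    [exp (- w)] of the density, the denominator is at most 3, and [24 * 4 / 3 = 32] remains in front
    of [ell w / ell u ^ (3/2)]. Since [ell u >= 1], this ratio is at least [w / (u + 1)^2 >= (u / 2)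
    / (2 u)^2 = 1 / (8 u)]. In the left tail the product is bounded below by a constant, which
    exceeds [4 / |u|]. *)
Lemma jump_kernel u w : jump u w -> 4 / `|u| <= 24 / nbar * (nu_density w * K0 u w).
Proof.
move=> /jumpP; case=> [[uN /andP[w1 w2]]|[uN /andP[w1 w2]]].
  have u80 : 80 < u by apply: le_lt_trans uN; exact: tail_start_ge.
  have wu : w <= u by lra.
  have u0 : 0 < u by lra.
  have w0 : 0 < w by lra.
  have u1 : 1 <= u by lra.
  have uw0 : 0 <= u - w by lra.
  rewrite gtr0_norm//.
  rewrite /K0 nu_densityE min_r// max_l// ger0_norm//.
  set a := lnell u; set b := lnell w.
  have a0 : 0 <= a by exact: lnell_ge0.
  have eb : w <= expR b by rewrite -ellE ell_ge.
  have ea : expR a <= u + 1 by rewrite -ellE ell_le// ltW.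
  have num : expR w <= expR (- (u - w)) * (2 + expR u).
    rewrite mulrDr -expRD (_ : - (u - w) + u = w); last by ring.
    by rewrite lerDr mulr_ge0 ?expR_ge0.
  have den : 1 + expR (- w) + expR (- u) <= 3.
    have e1 : expR (- w) <= 1 by rewrite -expR0 ler_expR oppr_le0 ltW.
    have e2 : expR (- u) <= 1 by rewrite -expR0 ler_expR oppr_le0 ltW.
    by clear -e1 e2; lra.
  have den0 : 0 < 1 + expR (- w) + expR (- u) by rewrite !addr_gt0 ?expR_gt0.
  have key : expR w / 3 <= expR (- (u - w)) / (1 + expR (- w) + expR (- u)) * (2 + expR u).
    rewrite mulrAC ler_pM ?expR_ge0 ?invr_ge0//.
    by rewrite lef_pV2 ?posrE.
  have -> : 24 / nbar * (expR (- w + 5 / 2 * b) *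
     (4 * nbar * expR (- (3 / 2) * (a + b)) *
      (expR (- (u - w)) / (1 + expR (- w) + expR (- u))) * (2 + expR u))) =
     96 * (expR (- w + 5 / 2 * b) * expR (- (3 / 2) * (a + b))) *
     (expR (- (u - w)) / (1 + expR (- w) + expR (- u)) * (2 + expR u)).
    by field; rewrite !gt_eqF.
  apply: (le_trans _ (ler_wpM2l _ key)); last by rewrite !mulr_ge0 ?expR_ge0.
  rewrite [leRHS](_ : _ = 32 * expR (- (3 / 2) * a + b)); last first.
    rewrite (_ : - (3 / 2) * a + b = (- w + 5 / 2 * b + - (3 / 2) * (a + b)) + w); last by field.
    by rewrite -expRD [in RHS]expRD; field.
  set s := expR (- (3 / 2) * a + b).
  have s0 : 0 < s by exact: expR_gt0.
  have ws : w <= s * (u + 1) ^+ 2.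
    apply: (le_trans eb); apply: (@le_trans _ _ (s * expR a ^+ 2)).
      by rewrite expr2 /s -!expRD ler_expR; clear -a0; clearbody a b; lra.
    by rewrite ler_wpM2l ?(ltW s0)// lerXn2r ?nnegrE ?expR_ge0// addr_ge0// ltW.
  rewrite ler_pdivrMr// -(ler_pM2r u0).
  have : s * (u + 1) ^+ 2 <= s * (2 * u) ^+ 2.
    by rewrite ler_wpM2l ?(ltW s0)// lerXn2r ?nnegrE//; clear -u1 u0; lra.
  clear -ws w1 s0 u1 u0; clearbody s => h.
  have h1 : u / 2 <= s * (2 * u) ^+ 2 by rewrite (le_trans w1)// (le_trans ws).
  have h2 : u / 2 <= s * u * 4 * u by move: h1; rewrite expr2; lra.
  by clear -h2; lra.
have u80 : u < - 80 by have := tail_start_ge; lra.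
have uw : u <= w by lra.
rewrite ltr0_norm; last by lra.
rewrite /K0 nu_densityE min_l// max_r// ler0_norm; last by lra.
set a := lnell u; set b := lnell w.
have au : a <= u by exact: lnell_le.
have bw : w - 1 <= b by apply: lnell_ge_neg; lra.
have num : 2 * expR (u - w) <= expR (- - (u - w)) * (2 + expR w).
  by rewrite opprK mulrC ler_wpM2l ?expR_ge0// lerDl expR_ge0.
have den : 1 + expR (- u) + expR (- w) <= 3 * expR (- u).
  have e1 : 1 <= expR (- u) by rewrite -expR0 ler_expR; lra.
  have e2 : expR (- w) <= expR (- u) by rewrite ler_expR; lra.
  lra.
have key : 2 / 3 * expR (2 * u - w) <=
    expR (- - (u - w)) / (1 + expR (- u) + expR (- w)) * (2 + expR w).
  have -> : 2 / 3 * expR (2 * u - w) = 2 * expR (u - w) / (3 * expR (- u)).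
    rewrite (_ : 2 * u - w = (u - w) + u); last by ring.
    by rewrite [in LHS]expRD expRN; field; rewrite gt_eqF ?expR_gt0.
  rewrite [leRHS]mulrAC ler_pM ?mulr_ge0 ?expR_ge0 ?invr_ge0 ?mulr_ge0 ?expR_ge0//.
  by rewrite lef_pV2 ?posrE ?mulr_gt0 ?expR_gt0.
have -> : 24 / nbar * (expR (- w + 5 / 2 * b) *
   (4 * nbar * expR (- (3 / 2) * (a + b)) *
    (expR (- - (u - w)) / (1 + expR (- u) + expR (- w))) * (2 + expR w))) =
   96 * (expR (- w + 5 / 2 * b) * expR (- (3 / 2) * (a + b))) *
   (expR (- - (u - w)) / (1 + expR (- u) + expR (- w)) * (2 + expR w)).
  by field; rewrite !gt_eqF.
apply: (le_trans _ (ler_wpM2l _ key)); last by rewrite !mulr_ge0 ?expR_ge0.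
rewrite -expRD.
have -> : 96 * expR (- w + 5 / 2 * b + - (3 / 2) * (a + b)) * (2 / 3 * expR (2 * u - w)) =
    64 * expR ((- w + 5 / 2 * b + - (3 / 2) * (a + b)) + (2 * u - w)).
  by rewrite [in RHS]expRD; field.
have e2 : 2^-1 <= expR (- (1 / 2)) :> R by have := expR_ge1Dx (- (1 / 2) : R); lra.
have e1 : 4^-1 <= expR (- 1) :> R.
  have -> : - 1 = - (1 / 2) + - (1 / 2) :> R by field.
  by rewrite expRD; move: (expR _) e2 => *; nra.
(* By [a <= u] and [b >= w - 1] the exponent is at least [u / 2 - w - 1], and [w <= u / 2] makes
   this at least -1. *)
apply: (@le_trans _ _ (64 * expR (- 1))); last by rewrite ler_pM2l// ler_expR; lra.
apply: (@le_trans _ _ 1).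
  by rewrite ler_pdivrMr; lra.
by move: (expR _) e1 => *; lra.
Qed.

Lemma K0_center M : 0 <= M -> exists2 c, 0 < c & forall u v, `|u| <= M -> `|v| <= M ->
  c <= K0 u v.
Proof.
move=> M0.
exists (4 * nbar * expR (- 3 * lnell M) * (expR (- (2 * M)) / (3 * expR M))).
  by rewrite !mulr_gt0 ?expR_gt0 ?invr_gt0 ?mulr_gt0 ?expR_gt0.
move=> u v; rewrite !ler_norml => /andP[u1 u2] /andP[v1 v2].
have lamM x : x <= M -> lnell x <= lnell M.
  by move=> xM; rewrite ler_ln ?posrE ?ell_gt0// ell_homo.
have lu := lamM _ u2; have lv := lamM _ v2.
rewrite /K0 -[leLHS]mulr1; apply: ler_pM => //.
- by rewrite !mulr_ge0 ?invr_ge0 ?mulr_ge0 ?expR_ge0// ltW.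
- apply: ler_pM; rewrite ?mulr_ge0 ?invr_ge0 ?mulr_ge0 ?expR_ge0 ?(ltW nbar_gt0)//.
    by rewrite ler_wpM2l ?mulr_ge0 ?(ltW nbar_gt0)// ler_expR; lra.
  apply: ler_pM; rewrite ?expR_ge0 ?invr_ge0 ?mulr_ge0 ?expR_ge0//.
    by rewrite ler_expR lerN2 ler_norml; apply/andP; split; lra.
  rewrite lef_pV2 ?posrE ?denom_gt0 ?mulr_gt0 ?expR_gt0//.
  have e1 : 1 <= expR M by rewrite -expR0 ler_expR.
  have e2 : expR (- Num.min u v) <= expR M.
    by rewrite ler_expR lerNl le_min u1 v1.
  have e3 : expR (- Num.max u v) <= expR M.
    by rewrite ler_expR lerNl le_max u1.
  by move: (expR M) (expR _) (expR _) e1 e2 e3 => *; lra.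
- by have := expR_ge0 (Num.max u v); lra.
Qed.

Lemma one_minus_exp_bounds x : 0 < x -> 0 < 1 - expR (- x) <= 1.
Proof.
move=> x0; rewrite subr_gt0 -[X in _ < X]expR0 ltr_expR oppr_lt0 x0/=.
by rewrite gerBl expR_ge0.
Qed.

Lemma K0_le_K3 u v : u <> v -> K0 u v <= K3 nbar u v.
Proof.
move=> uv; rewrite K3E.
have /one_minus_exp_bounds/andP[d0 d1] : 0 < `|u - v|.
  by rewrite normr_gt0 subr_eq0; apply/eqP.
by rewrite ler_pdivlMr// ler_piMr// ltW// K0_gt0.
Qed.

Lemma K3_ge0 u v : 0 <= K3 nbar u v.
Proof.
by rewrite K3E divr_ge0 ?(ltW (K0_gt0 _ _)).
Qed.

Variables eps0 mu' gamma0 a1 : R.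
Hypothesis eps0_gt0 : 0 < eps0.
Local Notation Keps := (K3eps nbar eps0 mu' gamma0 a1).
Local Notation eps := (epsuv eps0 mu' gamma0 a1).

Lemma eps_gt0 u v : 0 < eps u v.
Proof. by rewrite mulr_gt0// expR_gt0. Qed.

(* The regularising factor only replaces [1 / (1 - exp (- d))] by
   [1 / (1 - exp (- max d eps))]. *)
Lemma K0_le_K3eps u v : u <> v -> K0 u v <= Keps u v.
Proof.
move=> uv; rewrite /K3eps K3E.
have d0 : 0 < `|u - v| by rewrite normr_gt0 subr_eq0; apply/eqP.
have e0 := eps_gt0 u v; move: (eps u v) (`|u - v|) e0 d0 => e x e0 x0.
have /andP[a0 a1'] := one_minus_exp_bounds e0.
have /andP[b0 b1'] := one_minus_exp_bounds x0.
have K := ltW (K0_gt0 u v).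
have [ex|xe] := leP e x.
  by rewrite divff ?gt_eqF// mulr1 ler_pdivlMr// ler_piMr.
by rewrite mulrA divfK ?gt_eqF// ler_pdivlMr// ler_piMr.
Qed.

Lemma K3eps_ge0 u v : 0 <= Keps u v.
Proof.
have e0 := eps_gt0 u v.
rewrite /K3eps mulr_ge0 ?K3_ge0// mulr_ge0//; last first.
  by have /andP[+ _] := one_minus_exp_bounds e0; rewrite invr_ge0 => /ltW.
rewrite subr_ge0 -[X in _ <= X]expR0 ler_expR oppr_le0 le_min normr_ge0 andbT.
exact: ltW.
Qed.

End kernels.
End bounds.

(** * Measurability of the kernels and of the jump relation *)

Lemma measurable_funV_ge0 d (T : measurableType d) (R : realType) (f : T -> R) :
  (forall x, 0 <= f x) -> measurable_fun setT f -> measurable_fun setT (fun x => (f x)^-1).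
Proof.
move=> f0 mf; rewrite (_ : (fun x => _) = fun x => f x `^ (-1)).
  exact: measurableT_comp (measurable_powR _) mf.
by apply/funext => x; rewrite powR_inv1.
Qed.

Section measurable_kernels.
Context (R : realType) d (T : measurableType d).
Implicit Types f g : T -> R.

Lemma measurable_exp_fun f : measurable_fun setT f -> measurable_fun setT (fun x => expR (f x)).
Proof. exact: measurableT_comp. Qed.

Lemma measurable_opp_fun f : measurable_fun setT f -> measurable_fun setT (fun x => - f x).
Proof. by move=> mf; apply: measurableT_comp. Qed.

Lemma measurable_abs_fun f : measurable_fun setT f -> measurable_fun setT (fun x => `|f x|).
Proof. by move=> mf; apply: measurableT_comp. Qed.

Lemma measurable_K3 nbar f g : measurable_fun setT f -> measurable_fun setT g ->
  measurable_fun setT (fun x => K3 nbar (f x) (g x)).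
Proof.
move=> mf mg; have mmin := measurable_minr mf mg; have mmax := measurable_maxr mf mg.
have mdist : measurable_fun setT (fun x => expR (- `|f x - g x|)).
  by apply/measurable_exp_fun/measurable_opp_fun/measurable_abs_fun/measurable_funB.
have ml (h : T -> R) : measurable_fun setT h ->
    measurable_fun setT (fun x => ln (1 + expR (h x))).
  move=> mh; apply: measurableT_comp => //; apply: measurable_funD => //.
  exact: measurable_exp_fun.
rewrite /K3; apply: measurable_funM; first apply: measurable_funM.
- apply: measurable_funM => //; apply: (measurableT_comp (measurable_powR _)).
  by apply: measurable_funM; exact: ml.
- apply: measurable_funM => //; apply: measurable_funV_ge0.
    by move=> x; rewrite !addr_ge0 ?expR_ge0.
  apply: measurable_funD; first apply: measurable_funD => //.
    exact/measurable_exp_fun/measurable_opp_fun.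
  exact/measurable_exp_fun/measurable_opp_fun.
- apply: measurable_funM.
    by apply: measurable_funD => //; exact: measurable_exp_fun.
  apply: measurable_funV_ge0; last exact: measurable_funB.
  by move=> x; rewrite subr_ge0 -[X in _ <= X]expR0 ler_expR oppr_le0.
Qed.

Lemma measurable_K3eps nbar eps0 mu' gamma0 a1 f g : 0 < eps0 ->
  measurable_fun setT f -> measurable_fun setT g ->
  measurable_fun setT (fun x => K3eps nbar eps0 mu' gamma0 a1 (f x) (g x)).
Proof.
move=> e0 mf mg; rewrite /K3eps; apply: measurable_funM; first exact: measurable_K3.
have meps : measurable_fun setT (fun x => epsuv eps0 mu' gamma0 a1 (f x) (g x)).
  apply: measurable_funM => //; apply: measurable_exp_fun; apply: measurable_funM => //.
  by apply: measurable_maxr => //; exact: measurable_maxr.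
apply: measurable_funM.
  apply: measurable_funB => //; apply/measurable_exp_fun/measurable_opp_fun.
  by apply: measurable_minr => //; apply/measurable_abs_fun/measurable_funB.
apply: measurable_funV_ge0; last first.
  by apply: measurable_funB => //; exact/measurable_exp_fun/measurable_opp_fun.
move=> x; rewrite subr_ge0 -[X in _ <= X]expR0 ler_expR oppr_le0.
by rewrite mulr_ge0 ?expR_ge0// ltW.
Qed.

Lemma measurable_jump f g : measurable_fun setT f -> measurable_fun setT g ->
  measurable_fun setT (fun x => jump (f x) (g x)).
Proof.
move=> mf mg; rewrite /jump; apply: measurable_and.
  by apply: measurable_fun_ltr => //; exact: measurable_abs_fun.
have mf2 : measurable_fun setT (fun x => f x ^+ 2) by exact: measurable_funX.
apply: measurable_and; apply: measurable_fun_ler.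
- exact: measurable_funM.
- exact: measurable_funM.
- exact: measurable_funM.
- exact: measurable_funM.
Qed.

End measurable_kernels.

(** * Finiteness of [nu] and total jump intensities *)

Section gap.
Context (R : realType).
Local Notation leb := (@lebesgue_measure R).
Local Notation N := (tail_start R).
Local Notation rho := (@nu_density R).

Lemma integral_indic_itv (c a b : R) : 0 <= c -> a <= b ->
  (\int[leb]_x (c * \1_(`[a, b]%classic : set (measurableTypeR R)) x)%:E = (c * (b - a))%:E)%E.
Proof.
move=> c0 ab; under eq_integral do rewrite EFinM.
rewrite ge0_integralZl//; last first.
  by apply/measurable_EFinP; exact: measurable_indic.
have L : lebesgue_measure (`[a, b]%classic : set R) = (b - a)%:E.
  rewrite lebesgue_measure_itv/= lte_fin.
  case: ltP => ba; first by rewrite -EFinB.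
  by rewrite (le_anti (_ : a <= b <= a)) ?ab// subrr.
rewrite integral_indic// setIT EFinM; congr (_ * _)%E; exact: L.
Qed.

Lemma nu_finite : (@nu R setT < +oo)%E.
Proof.
pose h (x : R) := expR (- (1 / 2) * `|x|).
have mh : measurable_fun setT (fun x : measurableTypeR R => h x).
  by apply/measurable_exp_fun/measurable_funM => //; exact: measurable_abs_fun.
have h0 x : 0 <= h x by exact: expR_ge0.
have hfin : (\int[leb]_x (h x)%:E < +oo)%E.
  rewrite ge0_symfun_integralT//; last 2 first.
  - move=> x; apply: (@continuous_comp _ _ _ (fun y : R => - (1 / 2) * `|y|) expR).
      apply: (@continuousM _ _ (cst (- (1 / 2))) (fun y : R => `|y|)).
        exact: cst_continuous.
      exact: norm_continuous.
    exact: continuous_expR.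
  - by move=> x /=; rewrite /h normrN.
  (* On the half-line [h] is twice the exponential density of rate 1/2, whose integral is 1. *)
  pose p := @exponential_pdf R (1 / 2).
  apply: (@le_lt_trans _ _ (2%:E * (\int[leb]_x (2 * p x)%:E))%E).
    rewrite lee_wpmul2l// integral_mkcond; apply: ge0_le_integral => //.
    - move=> x _; rewrite patchE; case: ifP => _; last exact: lexx.
      by rewrite lee_fin h0.
    - apply/(measurable_restrictT _ _).1.
      + have -> : [set x : R | 0 <= x] = `[0, +oo[%classic.
          by apply/seteqP; split=> x /=; rewrite in_itv/= andbT.
        exact: measurable_itv.
      + by apply: measurable_funTS; exact/measurable_EFinP.
    - apply/measurable_EFinP; apply: measurable_funM => //.
      exact: measurable_exponential_pdf.
    - move=> x _; rewrite patchE; case: ifPn => x0; last first.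
        by rewrite lee_fin mulr_ge0// exponential_pdf_ge0.
      rewrite inE/= in x0; rewrite lee_fin /p exponential_pdfE// /h ger0_norm//.
      by move: (expR _) => e; lra.
  under eq_integral do rewrite EFinM.
  rewrite ge0_integralZl//; last 2 first.
  - by apply/measurable_EFinP; exact: measurable_exponential_pdf.
  - by move=> x _; rewrite lee_fin exponential_pdf_ge0.
  by rewrite integral_exponential_pdf// mule1 -EFinM ltry.
apply: (@le_lt_trans _ _ (\int[leb]_x ((expR (5 / 2 * @lnell_const R))%:E * (h x)%:E))%E).
  apply: ge0_le_integral => //.
  - by move=> x _; rewrite lee_fin nu_density_ge0.
  - by apply/measurable_EFinP; exact: measurable_nu_density.
  - by apply: measurable_funeM; exact/measurable_EFinP.
  - by move=> x _; rewrite -EFinM lee_fin nu_density_le.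
rewrite ge0_integralZl//; [|by apply/measurable_EFinP|by move=> x _; rewrite lee_fin h0].
by rewrite lte_mul_pinfty// lee_fin expR_ge0.
Qed.

Definition nu_core : set (measurableTypeR R) := `[- N, N]%classic.

Lemma nu_coreP u : nu_core u <-> `|u| <= N.
Proof. by rewrite /nu_core /= in_itv/= ler_norml. Qed.

Lemma nu_core_gt0 : (0 < @nu R nu_core)%E.
Proof.
have N0 := tail_start_ge R.
(* A lower bound of the density on the core: the decreasing term [- u] is taken at [N], the
   increasing term [lnell u] at [- N]. *)
pose c := expR (- N + 5 / 2 * lnell (- N)) : R.
apply: (@lt_le_trans _ _ (\int[leb]_x (c * \1_nu_core x)%:E)%E).
  rewrite integral_indic_itv ?expR_ge0//; last by lra.
  by rewrite lte_fin mulr_gt0 ?expR_gt0//; lra.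
rewrite [leRHS](_ : _ = (\int[leb]_(w in nu_core) (rho w)%:E)%E); last by [].
rewrite [leRHS]integral_mkcond; apply: ge0_le_integral => //.
- by move=> x _; rewrite lee_fin mulr_ge0 ?expR_ge0// indicE.
- apply/measurable_EFinP; apply: measurable_funM => //; apply: measurable_indic.
  exact: measurable_itv.
- apply/(measurable_restrictT _ _).1; first exact: measurable_itv.
  by apply: measurable_funTS; apply/measurable_EFinP; exact: measurable_nu_density.
move=> x _; rewrite patchE indicE; case: ifPn => [|_]; last by rewrite mulr0.
rewrite mulr1 inE => /nu_coreP; rewrite ler_norml => /andP[x1 x2].
rewrite lee_fin nu_densityE ler_expR lerD ?lerN2//.
rewrite ler_pM2l ?divr_gt0//.
by rewrite ler_ln ?posrE ?ell_gt0// ell_homo.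
Qed.

(* [nu_density w] in the denominator turns the [nu]-integral over [w] into a
   Lebesgue one. *)
Definition jump_intensity (u w : R) : R :=
  if jump u w then 4 / `|u| / rho w else 0.
Local Notation g := jump_intensity.

Lemma jump_intensity_ge0 u w : 0 <= g u w.
Proof. by rewrite /g; case: ifP => // _; rewrite !divr_ge0// nu_density_ge0. Qed.

Lemma measurable_jump_intensity d (T : measurableType d) (f1 f2 : T -> R) :
  measurable_fun setT f1 -> measurable_fun setT f2 ->
  measurable_fun setT (fun x => g (f1 x) (f2 x)).
Proof.
move=> m1 m2; rewrite /g; apply: measurable_fun_ifT => //.
  exact: measurable_jump.
apply: measurable_funM.
  apply: measurable_funM => //; apply: measurable_funV_ge0 => //.
  exact: measurable_abs_fun.
apply: measurable_funV_ge0; first by move=> x; exact: nu_density_ge0.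
exact: (measurableT_comp (@measurable_nu_density R)).
Qed.

Lemma jump_out u : ~ nu_core u -> (1 <= \int[@nu R]_w (g u w)%:E)%E.
Proof.
move=> /nu_coreP/negP; rewrite -ltNge => Nu.
have N0 := tail_start_ge R.
have u0 : 0 < `|u| by lra.
have mg : measurable_fun setT (fun w : measurableTypeR R => (g u w)%:E).
  by apply/measurable_EFinP; exact: measurable_jump_intensity.
rewrite integral_nu//; last by move=> w; rewrite lee_fin jump_intensity_ge0.
have [a [b [ab bE abj]]] : exists a b : R, [/\ a <= b, b - a = `|u| / 4 &
    forall w, a <= w <= b -> jump u w].
  have [up|un] := leP 0 u.
    exists (u / 2), (3 / 4 * u); rewrite ger0_norm//; split; [lra|lra|].
    move=> w /andP[w1 w2]; rewrite /jump Nu/=; apply/andP; split; nra.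
  exists (3 / 4 * u), (u / 2); rewrite ltr0_norm//; split; [lra|lra|].
  move=> w /andP[w1 w2]; rewrite /jump Nu/=; apply/andP; split; nra.
apply: (@le_trans _ _
    (\int[leb]_x (4 / `|u| * \1_(`[a, b]%classic : set (measurableTypeR R)) x)%:E)%E).
  rewrite integral_indic_itv ?divr_ge0// bE lee_fin.
  by rewrite (_ : 4 / `|u| * (`|u| / 4) = 1)//; field; rewrite gt_eqF.
apply: ge0_le_integral => //.
- by apply/measurable_EFinP; apply: measurable_funM.
- apply: emeasurable_funM => //; apply/measurable_EFinP; exact: measurable_nu_density.
move=> w _; rewrite -EFinM lee_fin indicE.
have [wI|wI] := boolP (w \in _); last first.
  by rewrite mulr0 mulr_ge0 ?jump_intensity_ge0 ?nu_density_ge0.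
rewrite inE/= in_itv/= in wI.
by rewrite mulr1 /g abj// divfK// gt_eqF// nu_density_gt0.
Qed.

(** Jumps into [w] start between [4/3 w] and [2 w], an interval of length [2/3 |w|]. There the ratio
    of densities is at most 1/8 and [4 / |u| <= 3 / |w|], so the integrand is at most [3 / (8 |w|)],
    and the product of the two is 1/4. *)
Lemma jump_in w : (\int[@nu R]_u (g u w)%:E <= (4^-1)%:E)%E.
Proof.
have N0 := tail_start_ge R.
have mg : measurable_fun setT (fun u : measurableTypeR R => (g u w)%:E).
  by apply/measurable_EFinP; exact: measurable_jump_intensity.
rewrite integral_nu//; last by move=> u; rewrite lee_fin jump_intensity_ge0.
(* No jump ends at 0, since a jump at most halves the modulus; elsewhere [|w|] may be a
   denominator. *)
have [w0|w0] := eqVneq w 0.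
  rewrite integral0_eq ?lee_fin ?invr_ge0// => u _.
  rewrite /g; case: ifPn => [|_]; last by rewrite mul0e.
  by move=> /jumpP; rewrite w0; case=> -[h1 /andP[h2 h3]]; exfalso; lra.
have [a [b [ab bE abj]]] : exists a b : R, [/\ a <= b, b - a = 2 / 3 * `|w| &
    forall u, jump u w -> a <= u <= b /\ 4 / 3 * `|w| <= `|u|].
  have [wp|wn] := leP 0 w.
    exists (4 / 3 * w), (2 * w); rewrite ger0_norm//; split; [lra|lra|].
    move=> u /jumpP; case=> -[h1 /andP[h2 h3]]; last by exfalso; lra.
    by rewrite ger0_norm; [split; [apply/andP; split|]|]; lra.
  exists (2 * w), (4 / 3 * w); rewrite ltr0_norm//; split; [lra|lra|].
  move=> u /jumpP; case=> -[h1 /andP[h2 h3]]; first by exfalso; lra.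
  by rewrite ltr0_norm; [split; [apply/andP; split|]|]; lra.
have wp : 0 < `|w| by rewrite normr_gt0.
pose c := 3 / 8 / `|w|.
have c_ge0 : 0 <= c by rewrite !divr_ge0.
apply: (@le_trans _ _
    (\int[leb]_x (c * \1_(`[a, b]%classic : set (measurableTypeR R)) x)%:E)%E); last first.
  rewrite integral_indic_itv// bE lee_fin /c le_eqVlt; apply/orP; left; apply/eqP.
  by field; rewrite gt_eqF.
apply: ge0_le_integral => //.
- by move=> u _; rewrite mule_ge0// lee_fin ?jump_intensity_ge0 ?nu_density_ge0.
- apply: emeasurable_funM => //; apply/measurable_EFinP; exact: measurable_nu_density.
- by apply/measurable_EFinP; apply: measurable_funM.
move=> u _; rewrite -EFinM lee_fin indicE /g; case: ifPn => ju; last first.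
  by rewrite mul0r mulr_ge0.
have [uab uw] := abj u ju.
rewrite mem_set/= ?in_itv//= mulr1.
have r0 := nu_density_gt0 w; have h := jump_density ju.
have up : 0 < `|u| by apply: lt_le_trans uw; rewrite mulr_gt0.
rewrite /c; move: (rho w) (rho u) (`|w|) (`|u|) r0 h wp up uw.
clear => x y r s x0 yx r0 s0 rs.
apply: (@le_trans _ _ (4 / s / x * (x / 8))).
  by rewrite ler_wpM2l ?divr_ge0 ?(ltW s0) ?(ltW x0)// ler_pdivlMr// mulrC.
have -> : 4 / s / x * (x / 8) = 2^-1 * s^-1 by field; rewrite !gt_eqF.
have -> : 3 / 8 / r = 2^-1 * (4 / 3 * r)^-1 by field; rewrite gt_eqF.
by rewrite ler_wpM2l// lef_pV2 ?posrE// mulr_gt0.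
Qed.

End gap.

(** * The Poincare inequality for [nu] and the spectral gap *)

Lemma nu_setT_gt0 (R : realType) : (0 < @nu R setT)%E.
Proof.
apply: lt_le_trans (nu_core_gt0 R) _.
by apply: le_measure; rewrite ?inE//; exact: measurable_itv.
Qed.

Lemma nu_poincare (R : realType) (nbar : R) (k : measurableTypeR R -> measurableTypeR R -> R) :
  0 < nbar -> (forall u v, 0 <= k u v) ->
  measurable_fun setT (fun p : measurableTypeR R * measurableTypeR R => k p.1 p.2) ->
  (forall u v, u <> v -> K0 nbar u v <= k u v) ->
  exists2 lam, 0 < lam & forall f : measurableTypeR R -> Rcomplex R,
    form_domain (@nu R) k f ->
    ip (@nu R) (cst 1) f = 0 -> ip (@nu R) (imul (cst 1)) f = 0 ->
    lam * ip (@nu R) f f <= dip (@nu R) k f f.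
Proof.
move=> nbar_gt0 k0 mk Kk.
have N0 : 0 <= tail_start R by apply: le_trans (tail_start_ge R).
have [c cp Kc] := K0_center nbar_gt0 N0.
refine (@poincare_criterion _ _ _ (@nu R) k k0 mk (nu_finite R) (@nu_core R)
  (@jump_intensity R) (24 / nbar) c _ _ _ _ _ _ _ _ _ _).
- exact: measurable_itv.
- exact: nu_core_gt0.
- exact: jump_intensity_ge0.
- by apply: measurable_jump_intensity; [exact: measurable_fst|exact: measurable_snd].
- by rewrite divr_gt0.
- by [].
- exact: jump_out.
- exact: jump_in.
- move=> u w uw; apply: (@le_trans _ _ (24 / nbar * K0 nbar u w)); last first.
    by rewrite ler_pM2l ?divr_gt0// Kk.
  rewrite /jump_intensity; case: ifPn => ju; last first.
    by rewrite mulr_ge0 ?divr_ge0 ?(ltW nbar_gt0)// ltW// K0_gt0.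
  rewrite ler_pdivrMr ?nu_density_gt0// -[leRHS]mulrA [X in _ <= _ * X]mulrC.
  exact: jump_kernel.
- move=> u v /nu_coreP Cu /nu_coreP Cv uv; exact: le_trans (Kc _ _ Cu Cv) (Kk _ _ uv).
Qed.

Theorem theorem2p2 (R : realType) (nbar eps0 mu' gamma0 a1 : R)
    (nbar_gt0 : 0 < nbar) (eps0_gt0 : 0 < eps0) (mu'_gt0 : 0 < mu')
    (gamma0_gt0 : 0 < gamma0) (a1_gt0 : 0 < a1)
    (k : R -> R -> R)
    (kE : k = K3 nbar \/ k = K3eps nbar eps0 mu' gamma0 a1) :
  let L := form_operator (@nu R) k in
  [/\ nonneg_operator (@nu R) L,
      operator_kernel L (cst 1) /\
        (forall f, operator_kernel L f ->
           exists c : R[i], f = cst c %[ae @nu R]),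
      (exists lambda : R, 0 < lambda /\
         spectrum (@nu R) L `<=`
           [set z | z = 0 \/ exists x : R, lambda <= x /\ z = x%:C]) &
      forall S : R -> (R -> R[i]) -> (R -> R[i]),
        is_semigroup_exp (@nu R) L S ->
        forall t : R, 0 < t ->
          (opnorm_on (@nu R) (orthocompl (@nu R) (operator_kernel L)) (S t) < 1)%E].
Proof.
have [k0 mk Kk] : [/\ forall u v, 0 <= k u v,
    measurable_fun setT (fun p : measurableTypeR R * measurableTypeR R => k p.1 p.2) &
    forall u v, u <> v -> K0 nbar u v <= k u v].
  case: kE => ->; split=> *.
  - exact: K3_ge0.
  - exact: measurable_K3.
  - exact: K0_le_K3.
  - exact: K3eps_ge0.
  - exact: measurable_K3eps.
  - exact: K0_le_K3eps.
have [l l0 gap] := nu_poincare nbar_gt0 k0 mk Kk.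
have nf := nu_finite R; have np := nu_setT_gt0 R.
split.
- exact: form_operator_nonneg.
- split; first exact: form_rel_cst.
  exact: (@form_operator_kernel _ _ _ (@nu R) k k0 mk nf np l l0 gap).
- by exists l; split=> //; exact: (@form_operator_spectrum _ _ _ (@nu R) k k0 mk nf np l gap).
- move=> S SL t t0.
  exact: (@form_operator_semigroup _ _ _ (@nu R) k k0 mk nf np l l0 gap S SL t t0).
Qed.
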